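(* Let $\lambda_1,\lambda_2>0$ and let $\tilde\beta>0$ be fixed. Let $\mathbf u_0=(U_1,V_2)$, where $$U_1(x)=\sqrt{2\lambda_1}\,\operatorname{sech}(\sqrt{\lambda_1}\,x),\qquad V_2(x)=3\lambda_2\,\operatorname{sech}^2\!\left(\tfrac{\sqrt{\lambda_2}}{2}x\right).$$ There exists $\varepsilon_0>0$ such that for every $0<\varepsilon<\varepsilon_0$, with $\beta=\varepsilon\tilde\beta$, the system $$ \begin{cases} -u''+\lambda_1 u = u^3+\beta uv,\\ -v''+\lambda_2 v = \tfrac12 v^2+\tfrac12\beta u^2, \end{cases} \qquad x\in\mathbb{R}, $$ has an even bound state $\mathbf u_\varepsilon=(u_\varepsilon,v_\varepsilon)\in\mathbb{H}$ with $\mathbf u_\varepsilon>\mathbf 0$ (i.e. $u_\varepsilon>0$ and $v_\varepsilon>0$ on $\mathbb{R}$), and $\mathbf u_\varepsilon\to\mathbf u_0$ in $\mathbb{H}$ as $\varepsilon\to0$.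
   Context: $E=W^{1,2}(\mathbb{R})$ (real-valued functions), $\mathbb{E}=E\times E$, with elements $\mathbf u=(u,v)$ and $\mathbf 0=(0,0)$; $H$ is the subspace of even functions in $E$ and $\mathbb{H}=H\times H$. For $j=1,2$, $\|u\|_j^2=\int_{\mathbb{R}}(|u'|^2+\lambda_j u^2)\,dx$, and $\mathbb{E}$ (hence $\mathbb{H}$) carries the norm $\|\mathbf u\|=\sqrt{\|u\|_1^2+\|v\|_2^2}$. The energy functional $\Phi:\mathbb{E}\to\mathbb{R}$ associated with the system is $$\Phi(\mathbf u)=\tfrac12\|u\|_1^2-\tfrac14\int_{\mathbb{R}}u^4\,dx+\tfrac12\|v\|_2^2-\tfrac16\int_{\mathbb{R}}v^3\,dx-\tfrac12\beta\int_{\mathbb{R}}u^2v\,dx .$$ A (non-trivial) bound state of the system is a critical point $\mathbf u\in\mathbb{E}\setminus\{\mathbf 0\}$ of $\Phi$. *)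

(* Defs.v *)
From HB Require Import structures.
From mathcomp Require Import all_boot all_order all_algebra.
From mathcomp Require Import all_classical all_reals all_analysis.

Set Implicit Arguments.
Unset Strict Implicit.
Unset Printing Implicit Defensive.

Import Order.TTheory GRing.Theory Num.Theory.
Import numFieldNormedType.Exports.

Local Open Scope classical_set_scope.
Local Open Scope ring_scope.

(* Elements of Lebesgue and Sobolev spaces are represented by functions R -> R;
   two functions that agree almost everywhere represent the same element. *)

Section Sobolev.
Context {R : realType}.
Local Notation mu := (@lebesgue_measure R).

Definition C1c (phi : R -> R) : Prop :=
  [/\ forall x, derivable phi x 1,
      continuous (derive1 phi) &
      compact (closure [set x | phi x != 0])].

Definition weak_derivative (u g : R -> R) : Prop :=
  forall phi, C1c phi ->
    \int[mu]_(x in [set: R]) (u x * derive1 phi x) =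
    - \int[mu]_(x in [set: R]) (g x * phi x).

(* W^{1,2}(R), with test functions in C^1_c as in Brezis, Functional Analysis,
   Sobolev Spaces and Partial Differential Equations, Section 8.2. *)
Definition W12 (u : R -> R) : Prop :=
  u \in Lfun mu 2%:E /\
  exists2 g, g \in Lfun mu 2%:E & weak_derivative u g.

(* The weak derivative is unique up to a null set, so the integrals below do
   not depend on the chosen representative. *)
Definition wderiv (u : R -> R) : R -> R :=
  get [set g | g \in Lfun mu 2%:E /\ weak_derivative u g].

Definition sqnorm (l : R) (u : R -> R) : R :=
  \int[mu]_(x in [set: R]) (`|wderiv u x| ^+ 2 + l * u x ^+ 2).

Definition in_EE (w : (R -> R) * (R -> R)) : Prop := W12 w.1 /\ W12 w.2.

Definition even_fct (u : R -> R) : Prop := forall x, u (- x) = u x.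

(* Every class in W^{1,2} that is even almost everywhere has a representative
   that is even everywhere. *)
Definition in_HH (w : (R -> R) * (R -> R)) : Prop :=
  in_EE w /\ even_fct w.1 /\ even_fct w.2.

Definition normEE (l1 l2 : R) (w : (R -> R) * (R -> R)) : R :=
  Num.sqrt (sqnorm l1 w.1 + sqnorm l2 w.2).

(* Energy functional of the system
     - u'' + l1 u = u^3 + b u v,
     - v'' + l2 v = v^2 / 2 + b u^2 / 2. *)
Definition Phi (l1 l2 b : R) (w : (R -> R) * (R -> R)) : R :=
  2^-1 * sqnorm l1 w.1
  - 4^-1 * \int[mu]_(x in [set: R]) (w.1 x ^+ 4)
  + 2^-1 * sqnorm l2 w.2
  - 6^-1 * \int[mu]_(x in [set: R]) (w.2 x ^+ 3)
  - 2^-1 * b * \int[mu]_(x in [set: R]) (w.1 x ^+ 2 * w.2 x).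

(* F has Frechet derivative L at w on E x E; linearity and boundedness of L
   are immediate for L = 0, the only case used. *)
Definition frechet_expansion (l1 l2 : R) (F : (R -> R) * (R -> R) -> R)
    (w : (R -> R) * (R -> R)) (L : (R -> R) * (R -> R) -> R) : Prop :=
  forall e, 0 < e -> exists2 d, 0 < d &
    forall h, in_EE h -> normEE l1 l2 h < d ->
      `|F (w + h) - F w - L h| <= e * normEE l1 l2 h.

Definition critical_point (l1 l2 b : R) (w : (R -> R) * (R -> R)) : Prop :=
  in_EE w /\ frechet_expansion l1 l2 (Phi l1 l2 b) w (fun=> 0).

Definition bound_state (l1 l2 b : R) (w : (R -> R) * (R -> R)) : Prop :=
  critical_point l1 l2 b w /\
  ~ {ae mu, forall x, w.1 x = 0 /\ w.2 x = 0}.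

(* Pointwise positivity of an element of W^{1,2} refers to its continuous
   representative. *)
Definition positive_rep (w : (R -> R) * (R -> R)) : Prop :=
  [/\ continuous w.1, continuous w.2 & forall x, 0 < w.1 x /\ 0 < w.2 x].

Definition sech (x : R) : R := 2 / (expR x + expR (- x)).

Definition U1 (l1 : R) (x : R) : R :=
  Num.sqrt (2 * l1) * sech (Num.sqrt l1 * x).

Definition V2 (l2 : R) (x : R) : R :=
  3 * l2 * sech (Num.sqrt l2 / 2 * x) ^+ 2.

End Sobolev.

(* Main.v *)
Require Import Defs.
From mathcomp Require Import all_boot all_order all_algebra.
From mathcomp Require Import all_classical all_reals all_analysis.
From mathcomp Require Import measurable_realfun ring lra.
Import Order.TTheory GRing.Theory Num.Theory.
Import numFieldNormedType.Exports.
Local Open Scope classical_set_scope.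
Local Open Scope ring_scope.
Set Implicit Arguments.
Unset Strict Implicit.
Unset Printing Implicit Defensive.

(** Write u = U1 + phi and v = V2 + chi with k1 = sqrt l1, k2 = sqrt l2. The
    system becomes L1 phi = 3 U1 phi^2 + phi^3 + b u v and
    L2 chi = chi^2/2 + b u^2/2, where L1 = -d^2 + l1 - 3 U1^2 and
    L2 = -d^2 + l2 - V2. The kernels of L1 and L2 contain the odd functions U1'
    and V2', and their other solutions are explicit, even and exponentially
    growing, so on even functions both operators have a Green operator that is
    bounded for exponentially weighted sup norms. With the weights e^{-k1 |x|}
    for phi and e^{-a |x|} for chi, a = min k1 k2, the equation is a contraction
    on a ball of radius O(b). The weight of phi decays exactly like U1, which
    makes u positive; v is positive because -v'' + l2 v > 0 and v vanishes at
    infinity. A classical solution that decays exponentially is a critical point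
    of Phi because elements of W^{1,2} are essentially bounded, so that the
    terms of Phi of order at least 2 are O(||h||^2). *)

(** * Derivatives and primitives *)

(** The delicate point is the endpoint rate. Positivity of [u] asks [phi] to decay exactly like
    [U1], but a source of rate [k1] would be resonant and produce |x| e^{-k1 |x|}. The coupling
    [b u v] escapes because [v] adds a rate [a > 0]: sources of rate [k1 + a] are mapped to
    solutions of rate [k1], with a constant of order 1 / a. For [chi] no such sharpness is
    available: the source [b u^2 / 2] is only known to decay like e^{-2 k1 |x|}, possibly slower
    than [V2]. Hence the smaller weight [a], and a minimum principle for [v] in place of a
    comparison with [V2]. Evenness replaces a Lyapunov-Schmidt reduction: it removes the translation
    kernel, and explicit kernel functions replace spectral theory. The radius of the ball bounds
    derivatives as well, so convergence in norm has order [b]. On the variational side functions are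
    only defined almost everywhere. Boundedness of W^{1,2} functions is therefore read off from
    averages over small balls, without constructing a continuous representative. *)

Section Derivatives.
Context {R : realType}.
Implicit Types f g : R -> R.

Definition has_deriv f f' := forall x : R, is_derive x (1 : R) f (f' x).

Lemma has_deriv_eq f f' g' : has_deriv f f' -> f' =1 g' -> has_deriv f g'.
Proof. by move=> h e x; rewrite -e. Qed.

Lemma has_deriv_continuous f f' : has_deriv f f' -> continuous f.
Proof.
by move=> h x; apply/differentiable_continuous/derivable1_diffP; case: (h x).
Qed.

Lemma has_derivD f f' g g' : has_deriv f f' -> has_deriv g g' ->
  has_deriv (fun x => f x + g x) (fun x => f' x + g' x).
Proof. by move=> hf hg x; have := hf x; have := hg x => ? ?; exact: is_deriveD. Qed.

Lemma has_derivN f f' : has_deriv f f' ->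
  has_deriv (fun x => - f x) (fun x => - f' x).
Proof. by move=> hf x; have := hf x => ?; exact: is_deriveN. Qed.

Lemma has_derivB f f' g g' : has_deriv f f' -> has_deriv g g' ->
  has_deriv (fun x => f x - g x) (fun x => f' x - g' x).
Proof. by move=> hf hg; apply: has_derivD => //; exact: has_derivN. Qed.

Lemma has_derivM f f' g g' : has_deriv f f' -> has_deriv g g' ->
  has_deriv (fun x => f x * g x) (fun x => f' x * g x + f x * g' x).
Proof.
move=> hf hg x; have := @is_deriveM _ _ _ _ _ _ _ _ (hf x) (hg x) => h.
by apply: (is_derive_eq h); rewrite /GRing.scale /= addrC mulrC.
Qed.

Lemma has_deriv_cst (c : R) : has_deriv (fun=> c) (fun=> 0).
Proof. by move=> x; exact: is_derive_cst. Qed.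

Lemma has_deriv_id : has_deriv id (fun=> 1).
Proof. by move=> x; exact: is_derive_id. Qed.

Lemma has_derivZ (c : R) f f' : has_deriv f f' ->
  has_deriv (fun x => c * f x) (fun x => c * f' x).
Proof.
move=> hf; apply: has_deriv_eq; first exact: (has_derivM (has_deriv_cst c) hf).
by move=> x; rewrite mul0r add0r.
Qed.

Lemma has_deriv_sqr f f' : has_deriv f f' ->
  has_deriv (fun x => f x ^+ 2) (fun x => 2 * f x * f' x).
Proof.
move=> hf; apply: has_deriv_eq; first exact: (has_derivM hf hf).
by move=> x /=; ring.
Qed.

Lemma has_deriv_comp f f' g g' : has_deriv f f' -> has_deriv g g' ->
  has_deriv (fun x => f (g x)) (fun x => f' (g x) * g' x).
Proof. by move=> hf hg x; have := hf (g x); have := hg x => ? ?; exact: is_derive1_comp. Qed.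

Lemma has_deriv_expR : has_deriv (@expR R) (@expR R).
Proof. by move=> x; exact: is_derive_expR. Qed.

Lemma has_deriv_expZ (k : R) :
  has_deriv (fun x => expR (k * x)) (fun x => k * expR (k * x)).
Proof.
apply: has_deriv_eq.
  by apply: (has_deriv_comp has_deriv_expR); exact: (has_derivZ k has_deriv_id).
by move=> x /=; rewrite mulr1 mulrC.
Qed.

Lemma has_deriv_inv f f' : (forall x, f x != 0) -> has_deriv f f' ->
  has_deriv (fun x => (f x)^-1) (fun x => - f' x / f x ^+ 2).
Proof.
move=> f0 hf x; have h := @is_deriveV _ _ _ _ _ (f0 x) (hf x).
by apply: (is_derive_eq h); rewrite /GRing.scale /= !mulNr mulrC.
Qed.

Lemma has_deriv_derive1 f f' x : has_deriv f f' -> derive1 f x = f' x.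
Proof. by move=> h; rewrite derive1E; have := h x => ?; exact: derive_val. Qed.

Lemma has_deriv_uniq f f' g' : has_deriv f f' -> has_deriv f g' -> f' =1 g'.
Proof. by move=> h1 h2 x; rewrite -(has_deriv_derive1 x h1) (has_deriv_derive1 x h2). Qed.

(** Mean value theorem for [g - f]. Primitives are estimated below by comparison with an explicit
    primitive of the bound, so that no integral has to be manipulated. *)
Lemma has_deriv_le f f' g g' x y : has_deriv f f' -> has_deriv g g' -> x <= y ->
  (forall z, x <= z <= y -> f' z <= g' z) -> f y - f x <= g y - g x.
Proof.
move=> hf hg xy le.
have hd := has_derivB hg hf.
have [|c + e] := @MVT_segment R _ _ _ _ xy (fun z _ => hd z).
  by apply: continuous_subspaceT; exact: has_deriv_continuous hd.
rewrite in_itv /= => /le h.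
have : 0 <= g y - f y - (g x - f x) by rewrite e mulr_ge0 ?subr_ge0.
lra.
Qed.

Lemma has_deriv_abs_le f f' g g' x y : has_deriv f f' -> has_deriv g g' -> x <= y ->
  (forall z, x <= z <= y -> `|f' z| <= g' z) -> `|f y - f x| <= g y - g x.
Proof.
move=> hf hg xy le; rewrite ler_norml; apply/andP; split; last first.
  by apply: (has_deriv_le hf hg xy) => z /le; rewrite ler_norml => /andP[].
have := has_deriv_le (has_derivN hf) hg xy.
have h z : x <= z <= y -> - f' z <= g' z.
  by move=> /le; rewrite ler_norml => /andP[+ _]; rewrite lerNl.
by move=> /(_ h); lra.
Qed.

Lemma has_deriv0_cst f : has_deriv f (fun=> 0) -> forall x y, f x = f y.
Proof. by move=> h x y; apply: is_derive_0_is_cst => z; exact: h. Qed.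

Lemma deriv_even f f' : has_deriv f f' -> (forall x, f (- x) = f x) ->
  forall x, f' (- x) = - f' x.
Proof.
move=> hf e x.
have h := has_deriv_comp hf (has_derivN has_deriv_id).
have : has_deriv f (fun x => f' (- x) * - 1).
  by move=> y; have := h y; rewrite (_ : (fun x => f (- id x)) = f)//; apply/funext => z /=; exact: e.
by move=> /has_deriv_uniq /(_ hf x); rewrite mulrN1 => <-; rewrite opprK.
Qed.

Lemma primitive_odd f F : has_deriv F f -> F 0 = 0 -> (forall x, f (- x) = f x) ->
  forall x, F (- x) = - F x.
Proof.
move=> hF F0 e x.
have h := has_derivD hF (has_deriv_comp hF (has_derivN has_deriv_id)).
have : has_deriv (fun x => F x + F (- x)) (fun=> 0).
  by apply: (has_deriv_eq h) => y /=; rewrite mulrN1 e subrr.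
by move=> /has_deriv0_cst /(_ x 0); rewrite oppr0 F0; lra.
Qed.

Lemma primitive_even f F : has_deriv F f -> (forall x, f (- x) = - f x) ->
  forall x, F (- x) = F x.
Proof.
move=> hF e x.
have h := has_derivB hF (has_deriv_comp hF (has_derivN has_deriv_id)).
have : has_deriv (fun x => F x - F (- x)) (fun=> 0).
  by apply: (has_deriv_eq h) => y /=; rewrite mulrN1 e; lra.
by move=> /has_deriv0_cst /(_ x 0); rewrite oppr0; lra.
Qed.

Local Notation mu := (@lebesgue_measure R).

(** The integral starts at [- n], so that one closed interval serves every [x] of the open one;
    subtracting the value at 0 makes the primitives for different [n] compatible. *)
Lemma primitive_on f (n : R) : 0 < n -> continuous f ->
  exists F, F 0 = 0 /\ forall x, `|x| < n -> is_derive x (1 : R) F (f x).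
Proof.
move=> n0 cf.
pose G x := \int[mu]_(t in `[- n, x]) f t.
exists (fun x => G x - G 0); split; first by rewrite subrr.
move=> x; rewrite ltr_norml => /andP[nx xn].
have int : mu.-integrable `[- n, n] (EFin \o f).
  apply: continuous_compact_integrable; first exact: segment_compact.
  exact: continuous_subspaceT.
have [dG GE] := continuous_FTC1_closed xn int nx (cf x).
rewrite -[f x]subr0.
have : is_derive x (1 : R) G (f x) by rewrite -GE derive1E; exact: derivableP.
move=> ?; exact: is_deriveB.
Qed.

(** Primitives on growing intervals are glued: the one used at [x] has index [Num.truncn] of |x|,
    whose domain contains [x], and normalization at 0 makes them coincide on common domains. *)
Lemma primitive_exists f : continuous f -> exists F, F 0 = 0 /\ has_deriv F f.
Proof.
move=> cf.
have /choice [F hF] : forall n : nat, exists F : R -> R, F 0 = 0 /\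
    forall x : R, `|x| < n.+1%:R -> is_derive x (1 : R) F (f x).
  by move=> n; exact: primitive_on.
have agree m n (x : R) : (m <= n)%N -> `|x| < m.+1%:R -> F m x = F n x.
  move=> mn xm.
  have lemn : m.+1%:R <= n.+1%:R :> R by rewrite ler_nat.
  have key (y z : R) : y <= z -> - m.+1%:R < y -> z < m.+1%:R ->
      F n z - F m z = F n y - F m y.
    move=> yz ym zm.
    have itv u : u \in `[y, z] -> `|u| < m.+1%:R.
      rewrite in_itv /= => /andP[yu uz]; rewrite ltr_norml.
      by rewrite (lt_le_trans ym yu) (le_lt_trans uz zm).
    have dd u : u \in `[y, z] -> is_derive u (1 : R) (fun x => F n x - F m x) 0.
      move=> /itv um; have := (hF m).2 u um; have := (hF n).2 u (lt_le_trans um lemn).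
      by move=> ? ?; rewrite -(subrr (f u)); exact: is_deriveB.
    have dd' u : u \in `]y, z[ -> is_derive u (1 : R) (fun x => F n x - F m x) 0.
      by move=> h; apply: dd; exact: subset_itv_oo_cc.
    have cont : {within `[y, z], continuous (fun x => F n x - F m x)}.
      by apply: derivable_within_continuous => u /dd; case.
    have [c _] := MVT_segment yz dd' cont.
    by rewrite mul0r => /eqP; rewrite subr_eq0 => /eqP.
  move: (xm); rewrite ltr_norml => /andP[x1 x2].
  have m1 : - m.+1%:R < 0 :> R by rewrite oppr_lt0.
  have m2 : 0 < m.+1%:R :> R by [].
  have : F n x - F m x = F n 0 - F m 0.
    have [x0|x0] := leP x 0; [apply/esym|]; apply: key => //; exact: ltW.
  by rewrite (hF n).1 (hF m).1; lra.
exists (fun x => F (Num.truncn `|x|) x); split; first by rewrite (hF _).1.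
move=> x.
(* One index more than the one selected at [x]: points [y] near [x] may select another index, but
   all of them lie in the domain of [F n]. *)
pose n := (Num.truncn `|x|).+1.
have xn : `|x| < n%:R by rewrite truncnS_gt.
have := (hF n).2 x; rewrite (lt_trans xn) ?ltr_nat// => /(_ isT).
apply: near_eq_is_derive => //.
near=> y.
have yn : `|y| < n.+1%:R.
  near: y; apply: (cvgr_lt `|x|); last by rewrite (lt_trans xn) ?ltr_nat.
  exact: cvg_norm.
have yt : `|y| < (Num.truncn `|y|).+1%:R by rewrite truncnS_gt.
have [le|le] := leqP (Num.truncn `|y|) n.
  by apply/esym; exact: agree.
by apply: agree => //; exact: ltnW.
Unshelve. all: by end_near. Qed.

Definition primitive f : R -> R := get [set F | F 0 = 0 /\ has_deriv F f].

Lemma primitiveP f : continuous f -> primitive f 0 = 0 /\ has_deriv (primitive f) f.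
Proof. by move=> /primitive_exists h; exact: (@getPex _ [set F | F 0 = 0 /\ has_deriv F f]). Qed.

End Derivatives.

(** * Fixed points, exponential decay and Green operators *)

Section FixedPoint.
Context {R : realType}.

(** Completeness in the form used below: it yields both the common point of nested intervals and the
    limit of a primitive at infinity, without convergence of sequences. *)
Lemma le_separation (T : Type) (t0 : T) (l u : T -> R) :
  (forall s t, l s <= u t) -> exists z, forall t, l t <= z <= u t.
Proof.
move=> lu; exists (sup (range l)) => t; apply/andP; split.
  apply: ub_le_sup; last by exists t.
  by exists (u t) => _ [s _ <-].
apply: ge_sup; first by exists (l t0); exists t0.
by move=> _ [s _ <-].
Qed.

Lemma half_pow_small (r e : R) : 0 <= r -> 0 < e -> exists n : nat, r / 2 ^+ n <= e.
Proof.
move=> r0 e0; exists (Num.truncn (r / e)).+1.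
rewrite ler_pdivrMr ?exprn_gt0// mulrC -ler_pdivrMr//.
apply: (le_trans (ltW (truncnS_gt _))).
by rewrite -natrX ler_nat ltnW// ltn_expl.
Qed.

Lemma le_half_pow (x y r : R) : 0 <= r -> (forall n, x <= y + r / 2 ^+ n) -> x <= y.
Proof.
move=> r0 h; apply/ler_addgt0Pr => e e0.
have [n hn] := half_pow_small r0 e0.
by apply: (le_trans (h n)); rewrite lerD2l.
Qed.

(** Banach's fixed point theorem with ratio 1/2 for the norm sup |z| / w, on the ball of radius [r].
    The closed predicate [P] will carry continuity and evenness; an abstract [T] lets a pair of
    functions be a single function on [bool * R]. *)
Lemma weighted_contraction (T : Type) (w : T -> R) (P : (T -> R) -> Prop)
    (F : (T -> R) -> T -> R) (r : R) :
  (forall t, 0 < w t) -> 0 <= r -> P (fun=> 0) ->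
  (forall z, (forall e, 0 < e -> exists2 z', P z' &
      forall t, `|z t - z' t| <= e * w t) -> P z) ->
  (forall z, P z -> (forall t, `|z t| <= r * w t) ->
      P (F z) /\ forall t, `|F z t| <= r * w t) ->
  (forall z z' c, P z -> (forall t, `|z t| <= r * w t) ->
      P z' -> (forall t, `|z' t| <= r * w t) ->
      0 <= c -> (forall t, `|z t - z' t| <= c * w t) ->
      forall t, `|F z t - F z' t| <= c / 2 * w t) ->
  exists z, [/\ P z, forall t, `|z t| <= r * w t & F z = z].
Proof.
move=> w0 r0 P0 closedP ballF contrF.
pose B z := P z /\ forall t, `|z t| <= r * w t.
pose z_ n := iter n F (fun=> 0).
have Bz n : B (z_ n).
  elim: n => [|n [Pn bn]]; last by apply: ballF.
  by split => // t; rewrite normr0 mulr_ge0// ltW.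
pose c n : R := r / 2 ^+ n.
have c0 n : 0 <= c n by rewrite /c divr_ge0// exprn_ge0.
have cS n : c n.+1 = c n / 2 by rewrite /c exprS; field; rewrite expf_neq0.
have step n : forall t, `|z_ n.+1 t - z_ n t| <= c n * w t.
  elim: n => [|n IH] t.
    have [_ /(_ t)] := Bz 1%N.
    by rewrite /c expr0 divr1 [z_ 0%N]/z_ /= subr0.
  rewrite cS; have [P1 b1] := Bz n.+1; have [P2 b2] := Bz n.
  exact: (contrF _ _ (c n) P1 b1 P2 b2).
(* Consecutive iterates differ by at most [c n * w] and [c] halves at each step, so the tail from
   [n] sums to [2 * c n * w]: intervals of this radius around the iterates are nested and share a
   point. *)
have [z hz] : exists z, forall n t, `|z t - z_ n t| <= 2 * c n * w t.
  suff /choice [z hz] : forall t, exists s, forall n,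
      z_ n t - 2 * c n * w t <= s <= z_ n t + 2 * c n * w t.
    by exists z => n t; have := hz t n; rewrite ler_distl.
  move=> t; apply: (le_separation 0%N).
  pose l n := z_ n t - 2 * c n * w t; pose u n := z_ n t + 2 * c n * w t.
  have lu n : l n <= u n.
    have : 0 <= c n * w t by rewrite mulr_ge0// ltW.
    by rewrite /l /u; lra.
  have lS : {homo l : n m / (n <= m)%N >-> n <= m}.
    apply: homo_leq => [//|? ? ?|n]; first exact: le_trans.
    have := step n t; rewrite ler_distl /l cS => /andP[]; nra.
  have uS : {homo u : n m / (n <= m)%N >-> m <= n}.
    apply: homo_leq => [//|? ? ? h1 h2|n]; first exact: (le_trans h2 h1).
    have := step n t; rewrite ler_distl /u cS => /andP[]; nra.
  move=> m n; apply: (le_trans (lS _ _ (leq_maxl m n))).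
  by apply: (le_trans (lu _)); apply: uS; exact: leq_maxr.
have Pz : P z.
  apply: closedP => e e0.
  have [n hn] := half_pow_small r0 (divr_gt0 e0 (ltr0Sn R 1)).
  exists (z_ n); first by have [] := Bz n.
  move=> t; apply: (le_trans (hz n t)).
  by rewrite ler_pM2r//; move: hn; rewrite -/(c n); lra.
have bz t : `|z t| <= r * w t.
  apply: (@le_half_pow _ _ (2 * r * w t)); first by rewrite !mulr_ge0// ltW.
  move=> n; have := hz n t; have [_ /(_ t) h1 h2] := Bz n.
  rewrite -[z t](subrK (z_ n t)); apply: (le_trans (ler_normD _ _)).
  rewrite addrC lerD//; apply: (le_trans h2).
  by rewrite le_eqVlt; apply/orP; left; apply/eqP; rewrite /c; ring.
exists z; split => //; apply/funext => t; apply/eqP.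
rewrite -subr_eq0 -normr_le0.
apply: (@le_half_pow _ _ (2 * r * w t)); first by rewrite !mulr_ge0// ltW.
move=> n; rewrite add0r.
have [Pn bn] := Bz n.
have h1 := contrF z (z_ n) (2 * c n) Pz bz Pn bn (mulr_ge0 (ler0n _ _) (c0 n)) (hz n) t.
have h2 := hz n.+1 t.
have -> : F z t - z t = (F z t - F (z_ n) t) - (z t - z_ n.+1 t).
  by rewrite /z_ iterS; ring.
apply: (le_trans (ler_normB _ _)); apply: (le_trans (lerD h1 h2)).
rewrite cS le_eqVlt; apply/orP; left; apply/eqP; rewrite /c; field.
by rewrite expf_neq0.
Qed.

Lemma continuous_uniform_limit (f : R -> R) :
  (forall e, 0 < e -> exists2 g : R -> R, continuous g & forall x, `|f x - g x| <= e) ->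
  continuous f.
Proof.
move=> h x; apply/cvgrPdist_le => e e0.
have [g cg fg] := h _ (divr_gt0 e0 (ltr0Sn R 2)).
have /cvgrPdist_le /(_ _ (divr_gt0 e0 (ltr0Sn R 2))) := cg x.
apply: filterS => y gxy.
have h1 := fg x; have h2 := fg y.
have -> : f x - f y = (f x - g x) + (g x - g y) - (f y - g y) by ring.
apply: (le_trans (ler_normB _ _)).
have := ler_normD (f x - g x) (g x - g y); lra.
Qed.

End FixedPoint.

Section Decay.
Context {R : realType}.
Implicit Types (f g : R -> R).

(** A negative rate is allowed and is then a growth bound; rate 0 means boundedness. In products
    rates add, whatever their signs. *)
Definition decay (c M : R) f := forall x, `|f x| <= M * expR (- c * `|x|).

Lemma decay_ge0 c M f : decay c M f -> 0 <= M.
Proof.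
move=> /(_ 0) h; have := le_trans (normr_ge0 _) h.
by rewrite normr0 mulr0 expR0 mulr1.
Qed.

Lemma decayW c M d N f : d <= c -> M <= N -> decay c M f -> decay d N f.
Proof.
move=> dc MN h x; apply: (le_trans (h x)).
rewrite ler_pM ?expR_ge0// ?(decay_ge0 h)// ler_expR ler_wpM2r//.
by rewrite lerN2.
Qed.

Lemma decayD c M N f g : decay c M f -> decay c N g ->
  decay c (M + N) (fun x => f x + g x).
Proof.
move=> hf hg x; apply: (le_trans (ler_normD _ _)).
by rewrite mulrDl lerD.
Qed.

Lemma decayM c d M N f g : decay c M f -> decay d N g ->
  decay (c + d) (M * N) (fun x => f x * g x).
Proof.
move=> hf hg x; rewrite normrM opprD mulrDl expRD mulrACA.
by rewrite ler_pM.
Qed.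

Lemma decayZ c M k f : decay c M f -> decay c (`|k| * M) (fun x => k * f x).
Proof. by move=> hf x; rewrite normrM -mulrA ler_wpM2l. Qed.

Lemma decayN c M f : decay c M f -> decay c M (fun x => - f x).
Proof. by move=> hf x; rewrite normrN. Qed.

Lemma decayB c M N f g : decay c M f -> decay c N g ->
  decay c (M + N) (fun x => f x - g x).
Proof. by move=> hf hg; apply: decayD => //; exact: decayN. Qed.

Lemma decay_half_line c M f : (forall x, `|f (- x)| = `|f x|) ->
  (forall x, 0 <= x -> `|f x| <= M * expR (- c * x)) -> decay c M f.
Proof.
move=> e h x; have [x0|x0] := leP 0 x; first by rewrite (ger0_norm x0); exact: h.
by rewrite (ltr0_norm x0) -e; apply: h; rewrite oppr_ge0 ltW.
Qed.

End Decay.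

(** * Green operator of -d^2 + q on even functions *)

Section Green.
Context {R : realType}.
Variables (q psi1 dpsi1 psi2 dpsi2 : R -> R) (W k C : R).
Hypotheses (k0 : 0 < k) (W0 : W != 0)
  (d1 : has_deriv psi1 dpsi1) (dd1 : has_deriv dpsi1 (fun x => q x * psi1 x))
  (d2 : has_deriv psi2 dpsi2) (dd2 : has_deriv dpsi2 (fun x => q x * psi2 x))
  (odd1 : forall x, psi1 (- x) = - psi1 x) (even2 : forall x, psi2 (- x) = psi2 x)
  (wronsk0 : psi1 0 * dpsi2 0 - dpsi1 0 * psi2 0 = W)
  (b1 : decay k C psi1) (b1' : decay k C dpsi1)
  (b2 : decay (- k) C psi2) (b2' : decay (- k) C dpsi2).

(** Derivative of the Wronskian when [f] has source [h] and [g] has none; it is applied with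
    [h = 0], where the Wronskian is constant. *)
Lemma wronskian_cst (f df g dg : R -> R) (h : R -> R) :
  has_deriv f df -> has_deriv df (fun x => q x * f x - h x) ->
  has_deriv g dg -> has_deriv dg (fun x => q x * g x) ->
  has_deriv (fun x => f x * dg x - df x * g x) (fun x => h x * g x).
Proof.
move=> hf hdf hg hdg.
apply: (has_deriv_eq (has_derivB (has_derivM hf hdg) (has_derivM hdf hg))).
by move=> x /=; ring.
Qed.

Let wronskian x : psi1 x * dpsi2 x - dpsi1 x * psi2 x = W.
Proof.
have dd1' : has_deriv dpsi1 (fun x => q x * psi1 x - 0).
  by apply: (has_deriv_eq dd1) => y; rewrite subr0.
have h := wronskian_cst d1 dd1' d2 dd2.
have h0 := has_deriv_eq h (fun y => mul0r _).
by rewrite (has_deriv0_cst h0 x 0).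
Qed.

(* Variation of constants: for even f the integrals of psi2 f from 0 and of
   psi1 f from infinity make phi even, so no matching at 0 is needed. *)
Lemma green_exists (f : R -> R) (a c M : R) : 0 < a -> 0 <= c <= k ->
  continuous f -> (forall x, f (- x) = f x) -> decay (c + a) M f ->
  exists phi dphi, [/\ has_deriv phi dphi,
    has_deriv dphi (fun x => q x * phi x - f x),
    forall x, phi (- x) = phi x,
    decay c (2 * C ^+ 2 / (`|W| * a) * M) phi &
    decay c (2 * C ^+ 2 / (`|W| * a) * M) dphi].
Proof.
move=> a0 /andP[c0 ck] cf ef bf.
have C0 := decay_ge0 b1; have M0 := decay_ge0 bf.
have c1 := has_deriv_continuous d1; have c2 := has_deriv_continuous d2.
have cpf (p : R -> R) : continuous p -> continuous (fun x => p x * f x).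
  by move=> cp x; apply: cvgM; [exact: cp|exact: cf].
have [A0 dA] := primitiveP (cpf _ c2).
have [B0 dB] := primitiveP (cpf _ c1).
set A := primitive _ in A0 dA; set B := primitive _ in B0 dB.
have oddA : forall x, A (- x) = - A x.
  by apply: (primitive_odd dA A0) => x; rewrite even2 ef.
have evenB : forall x, B (- x) = B x.
  by apply: (primitive_even dB) => x; rewrite odd1 ef mulNr.
(* On [0, x] the integrand is at most C M e^{(k - c) z} e^{- a z}. Freezing the first exponential at
   [z = x] leaves e^{- a z} to integrate, which avoids dividing by [k - c - a], a number of any
   sign. *)
have bA x : 0 <= x -> `|A x| <= C * M / a * expR ((k - c) * x).
  move=> x0.
  have := @has_deriv_abs_le _ _ _ _ _ 0 x dA
    (has_derivZ (- (C * M * expR ((k - c) * x) / a)) (has_deriv_expZ (- a))) x0.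
  rewrite A0 subr0 mulr0 expR0 => h.
  apply: (@le_trans _ _ (- (C * M * expR ((k - c) * x) / a) * expR (- a * x) -
     - (C * M * expR ((k - c) * x) / a) * 1)).
    apply: h => z /andP[z0 zx]; have := decayM b2 bf z.
    rewrite (ger0_norm z0) => /le_trans; apply.
    have -> : - (C * M * expR ((k - c) * x) / a) * (- a * expR (- a * z)) =
      C * M * (expR ((k - c) * x) * expR (- a * z)) by field; rewrite gt_eqF.
    rewrite ler_wpM2l ?mulr_ge0// -expRD ler_expR.
    have : (k - c) * z <= (k - c) * x by rewrite ler_wpM2l// subr_ge0.
    lra.
  have e1 : 0 <= expR (- a * x) by exact: expR_ge0.
  have e2 : 0 <= C * M / a * expR ((k - c) * x).
    by rewrite mulr_ge0 ?expR_ge0// divr_ge0 ?mulr_ge0// ltW.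
  have -> : C * M * expR ((k - c) * x) / a = C * M / a * expR ((k - c) * x) by ring.
  nra.
have kca : 0 < k + (c + a) by lra.
(* The primitive of the bound on |psi1 f| that vanishes at infinity; [- G x] therefore bounds the
   tail of [B] beyond [x]. *)
pose G x := - (C * M / (k + (c + a))) * expR (- (k + (c + a)) * x).
have dG : has_deriv G (fun x => C * M * expR (- (k + (c + a)) * x)).
  apply: (has_deriv_eq (has_derivZ _ (has_deriv_expZ _))) => x.
  by field; rewrite gt_eqF.
have G0 x : G x <= 0.
  by rewrite /G mulNr oppr_le0 mulr_ge0 ?expR_ge0// divr_ge0 ?mulr_ge0// ltW.
have BG x y : 0 <= x -> x <= y -> `|B y - B x| <= G y - G x.
  move=> x0 xy; apply: (has_deriv_abs_le dB dG xy) => z /andP[xz zy].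
  by have := decayM b1 bf z; rewrite (ger0_norm (le_trans x0 xz)).
(* [Binf] is the limit of [B] at infinity, so that [Binf - B x] is the integral of [psi1 f] from [x]
   to infinity. *)
have [Binf hB] : exists s, forall x : {x : R | 0 <= x},
    B (sval x) + G (sval x) <= s <= B (sval x) - G (sval x).
  apply: (@le_separation R {x : R | 0 <= x} (exist _ 0 (lexx 0))).
  move=> [s s0] [t t0] /=.
  have := G0 s; have := G0 t.
  have [st|/ltW ts] := leP s t.
    by have := BG _ _ s0 st; rewrite ler_norml => /andP[]; lra.
  by have := BG _ _ t0 ts; rewrite ler_norml => /andP[]; lra.
have bB x : 0 <= x -> `|Binf - B x| <= C * M / a * expR (- (k + c) * x).
  move=> x0; have := hB (exist _ x x0) => /= h.
  apply: (@le_trans _ _ (- G x)).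
    by rewrite ler_distl; move: h => /andP[]; lra.
  rewrite /G mulNr opprK.
  apply: ler_pM; rewrite ?expR_ge0//; first by rewrite divr_ge0 ?mulr_ge0// ltW.
    by rewrite ler_wpM2l ?mulr_ge0// lef_pV2 ?posrE//; lra.
  rewrite ler_expR; have : 0 <= a * x by rewrite mulr_ge0// ltW.
  lra.
pose phi x := W^-1 * (psi1 x * A x + psi2 x * (Binf - B x)).
pose dphi x := W^-1 * (dpsi1 x * A x + dpsi2 x * (Binf - B x)).
have dphiP : has_deriv phi dphi.
  have := has_derivZ W^-1 (has_derivD (has_derivM d1 dA)
    (has_derivM d2 (has_derivB (has_deriv_cst Binf) dB))).
  by move=> /has_deriv_eq; apply => x; rewrite /dphi; ring.
have ddphiP : has_deriv dphi (fun x => q x * phi x - f x).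
  have := has_derivZ W^-1 (has_derivD (has_derivM dd1 dA)
    (has_derivM dd2 (has_derivB (has_deriv_cst Binf) dB))).
  move=> /has_deriv_eq; apply => x; rewrite /phi.
  have := wronskian x => e.
  rewrite -[f x in RHS](mulKf W0) -[X in W^-1 * (X * f x)]e; ring.
have ephi x : phi (- x) = phi x.
  by rewrite /phi odd1 oddA even2 evenB mulrNN.
have bnd (p1 p2 : R -> R) : decay k C p1 -> decay (- k) C p2 -> forall x, 0 <= x ->
   `|W^-1 * (p1 x * A x + p2 x * (Binf - B x))| <=
   2 * C ^+ 2 / (`|W| * a) * M * expR (- c * x).
  move=> h1 h2 x x0; rewrite normrM normfV.
  have -> : 2 * C ^+ 2 / (`|W| * a) * M * expR (- c * x) = `|W|^-1 *
    (C * (C * M / a) * expR (- c * x) + C * (C * M / a) * expR (- c * x)).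
    by field; rewrite normr_eq0 W0 gt_eqF.
  rewrite ler_wpM2l ?invr_ge0//; apply: (le_trans (ler_normD _ _)).
  rewrite !normrM; apply: lerD.
    have := ler_pM (normr_ge0 _) (normr_ge0 _) (h1 x) (bA _ x0).
    rewrite (ger0_norm x0) mulrACA -expRD => /le_trans; apply.
    by rewrite (_ : - k * x + (k - c) * x = - c * x)//; ring.
  have := ler_pM (normr_ge0 _) (normr_ge0 _) (h2 x) (bB _ x0).
  rewrite (ger0_norm x0) mulrACA -expRD => /le_trans; apply.
  by rewrite (_ : - - k * x + - (k + c) * x = - c * x)//; ring.
exists phi, dphi; split => //.
  by apply: decay_half_line => [x|]; [rewrite ephi|exact: bnd].
apply: decay_half_line => [x|]; last exact: bnd.
by rewrite (deriv_even dphiP ephi) normrN.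
Qed.

(* The Wronskian of phi with psi2 vanishes at 0 and the one with psi1 vanishes at
   infinity; both are constant. *)
Lemma green_unique (phi dphi : R -> R) (D : R) :
  has_deriv phi dphi -> has_deriv dphi (fun x => q x * phi x) ->
  (forall x, phi (- x) = phi x) ->
  (forall x, `|phi x| <= D) -> (forall x, `|dphi x| <= D) -> phi =1 (fun=> 0).
Proof.
move=> dphiP ddphi ephi bphi bdphi x.
have ddphi' : has_deriv dphi (fun x => q x * phi x - 0).
  by apply: (has_deriv_eq ddphi) => y; rewrite subr0.
have cstW p dp : has_deriv p dp -> has_deriv dp (fun x => q x * p x) ->
    forall y z, phi y * dp y - dphi y * p y = phi z * dp z - dphi z * p z.
  move=> hp hdp y z.
  have h0 := has_deriv_eq (wronskian_cst dphiP ddphi' hp hdp) (fun u => mul0r _).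
  exact: (has_deriv0_cst h0 y z).
have dphi0 : dphi 0 = 0.
  by have := deriv_even dphiP ephi 0; rewrite oppr0; lra.
have dpsi20 : dpsi2 0 = 0.
  by have := deriv_even d2 even2 0; rewrite oppr0; lra.
have W2 : phi x * dpsi2 x - dphi x * psi2 x = 0.
  by rewrite (cstW _ _ d2 dd2 x 0) dphi0 dpsi20; ring.
have D0 : 0 <= D by apply: (le_trans _ (bphi 0)).
have C0 := decay_ge0 b1.
have W1 : phi x * dpsi1 x - dphi x * psi1 x = 0.
  apply/eqP; rewrite -normr_le0; apply/ler_addgt0Pr => e e0; rewrite add0r.
  (* Since e^{k y} >= 1 + k y, this [y] brings the bound 2 D C e^{- k y} on the Wronskian below
     [e]. *)
  pose y := 2 * D * C / e / k.
  have y0 : 0 <= y by rewrite !divr_ge0 ?mulr_ge0// ltW.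
  rewrite (cstW _ _ d1 dd1 x y); apply: (le_trans (ler_normB _ _)).
  rewrite !normrM.
  have := ler_pM (normr_ge0 _) (normr_ge0 _) (bphi y) (b1' y).
  have := ler_pM (normr_ge0 _) (normr_ge0 _) (bdphi y) (b1 y).
  rewrite (ger0_norm y0) => h1 h2; apply: (le_trans (lerD h2 h1)).
  rewrite mulNr expRN.
  have h3 : 2 * D * C / e <= expR (k * y).
    apply: (@le_trans _ _ (1 + k * y)); last exact: expR_ge1Dx.
    by rewrite (_ : k * y = 2 * D * C / e) ?lerDr// /y; field; rewrite !gt_eqF.
  have ep : 0 < expR (k * y) by exact: expR_gt0.
  rewrite (_ : _ + _ = 2 * D * C / expR (k * y)); last by ring.
  by rewrite ler_pdivrMr// [e * _]mulrC -ler_pdivrMr.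
(* Both Wronskians with [phi] vanish, and eliminating [dphi x] between them leaves [phi x * W]. *)
have : phi x * W = 0.
  rewrite -(wronskian x).
  have -> : phi x * (psi1 x * dpsi2 x - dpsi1 x * psi2 x) =
    psi1 x * (phi x * dpsi2 x - dphi x * psi2 x) -
    psi2 x * (phi x * dpsi1 x - dphi x * psi1 x) by ring.
  by rewrite W1 W2; ring.
by move=> /eqP; rewrite mulf_eq0 (negbTE W0) orbF => /eqP.
Qed.

(** The class in which solutions are unique: evenness excludes the kernel element [psi1],
    boundedness the growing [psi2]. *)
Definition bounded_solution (f phi dphi : R -> R) :=
  [/\ has_deriv phi dphi, has_deriv dphi (fun x => q x * phi x - f x),
      forall x, phi (- x) = phi x &
      exists D, (forall x, `|phi x| <= D) /\ (forall x, `|dphi x| <= D)].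

Lemma bounded_solutionB f g phi dphi psi dpsi :
  bounded_solution f phi dphi -> bounded_solution g psi dpsi ->
  bounded_solution (fun x => f x - g x) (fun x => phi x - psi x)
    (fun x => dphi x - dpsi x).
Proof.
move=> [p1 p2 p3 [D [p4 p5]]] [r1 r2 r3 [E [r4 r5]]]; split.
- exact: has_derivB.
- by apply: (has_deriv_eq (has_derivB p2 r2)) => x; ring.
- by move=> x; rewrite p3 r3.
- exists (D + E); split => x; apply: (le_trans (ler_normB _ _)); exact: lerD.
Qed.

Lemma bounded_solution_unique f phi dphi psi dpsi :
  bounded_solution f phi dphi -> bounded_solution f psi dpsi ->
  phi =1 psi /\ dphi =1 dpsi.
Proof.
move=> s1 s2; have [h1 h2 h3 [D [h4 h5]]] := bounded_solutionB s1 s2.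
have e : phi = psi.
  apply/funext => x; apply/eqP; rewrite -subr_eq0; apply/eqP.
  apply: (green_unique h1 _ h3 h4 h5).
  by apply: (has_deriv_eq h2) => y; ring.
split; first by rewrite e.
case: s1 s2 => + _ _ _ [+ _ _ _]; rewrite e; exact: has_deriv_uniq.
Qed.

Definition source (c M : R) f :=
  [/\ continuous f, forall x, f (- x) = f x & decay c M f].

(** [K] depends on neither [f] nor [M]. The operator is selected by choice and is arbitrary off the
    sources. Its Lipschitz bound comes from uniqueness: [S f - S g] must be the solution constructed
    for [f - g], which satisfies the decay estimate. *)
Lemma green_solver (a c : R) : 0 < a -> 0 <= c <= k ->
  exists2 K, 0 < K & exists S dS : (R -> R) -> R -> R,
  (forall f M, source (c + a) M f ->
    [/\ has_deriv (S f) (dS f), has_deriv (dS f) (fun x => q x * S f x - f x),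
        forall x, S f (- x) = S f x, decay c (K * M) (S f) &
        decay c (K * M) (dS f)]) /\
  (forall f g L M N, source (c + a) L f -> source (c + a) M g ->
    decay (c + a) N (fun x => f x - g x) ->
    decay c (K * N) (fun x => S f x - S g x)).
Proof.
move=> a0 ck; have /andP[c0 _] := ck.
have Wp : 0 < `|W| by rewrite normr_gt0.
(* The [+ 1] makes [K] positive without a lower bound on [C]. *)
pose K := 2 * C ^+ 2 / (`|W| * a) + 1.
have K0 : 0 < K.
  by rewrite ltr_wpDl// divr_ge0// mulr_ge0 ?sqr_ge0// ltW.
have ex f M : source (c + a) M f -> exists phi dphi,
    [/\ bounded_solution f phi dphi, decay c (K * M) phi & decay c (K * M) dphi].
  move=> [cf ef bf].
  have [phi [dphi [h1 h2 h3 h4 h5]]] := green_exists a0 ck cf ef bf.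
  have M0 := decay_ge0 bf.
  have KM : 2 * C ^+ 2 / (`|W| * a) * M <= K * M by rewrite ler_wpM2r// lerDl.
  have bnd p : decay c (K * M) p -> forall x, `|p x| <= K * M.
    move=> hp x; apply: (le_trans (hp x)); rewrite ler_piMr ?mulr_ge0 ?(ltW K0)//.
    by rewrite -expR0 ler_expR mulNr oppr_le0 mulr_ge0.
  exists phi, dphi; split; [split => //|exact: decayW h4|exact: decayW h5].
  by exists (K * M); split; apply: bnd; [exact: decayW h4|exact: decayW h5].
exists K => //.
have /choice [S hS] : forall f, exists s : (R -> R) * (R -> R),
    (exists M, source (c + a) M f) -> bounded_solution f s.1 s.2.
  move=> f; have [[M /ex [phi [dphi []]]]|nf] := pselect (exists M, source (c + a) M f).
    by exists (phi, dphi).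
  by exists (f, f).
exists (fun f => (S f).1), (fun f => (S f).2); split.
  move=> f M sf; have hf := hS f (ex_intro _ M sf).
  have [phi [dphi [h1 h2 h3]]] := ex f M sf.
  have [e1 e2] := bounded_solution_unique hf h1; case: (hf) => r1 r2 r3 _.
  by split => // x; [rewrite e1|rewrite e2].
move=> f g L M N sf sg bfg.
have hfg := bounded_solutionB (hS f (ex_intro _ L sf)) (hS g (ex_intro _ M sg)).
have [|phi [dphi [h1 h2 h3]]] := ex (fun x => f x - g x) N.
  case: sf sg => cf ef _ [cg eg _]; split => //.
    by move=> x; apply: cvgB; [exact: cf|exact: cg].
  by move=> x; rewrite ef eg.
have [e _] := bounded_solution_unique hfg h1.
by move=> x; rewrite e.
Qed.

End Green.

(** * Hyperbolic functions and the linearized operators *)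

Section Hyperbolic.
Context {R : realType}.
Implicit Types x y : R.

Definition cosh x : R := (expR x + expR (- x)) / 2.
Definition tanh x : R := (expR x - expR (- x)) / 2 * sech x.

Lemma cosh_gt0 x : 0 < cosh x.
Proof. by rewrite divr_gt0// addr_gt0 ?expR_gt0. Qed.

Lemma sech_inv x : sech x = (cosh x)^-1.
Proof. by rewrite /sech /cosh invf_div. Qed.

Lemma sech_gt0 x : 0 < sech x.
Proof. by rewrite sech_inv invr_gt0 cosh_gt0. Qed.

(** Stated with right-hand side 0, like [sech_tanh_sqr], so that multiples of these relations can be
    added to a polynomial expression and the rest left to [ring]. *)
Lemma cosh_sech x : cosh x * sech x - 1 = 0.
Proof. by rewrite sech_inv mulfV ?subrr// gt_eqF ?cosh_gt0. Qed.

Lemma sech_tanh_sqr x : sech x ^+ 2 + tanh x ^+ 2 - 1 = 0.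
Proof.
rewrite /tanh [X in _ + X - _]exprMn.
have -> : ((expR x - expR (- x)) / 2) ^+ 2 = cosh x ^+ 2 - 1.
  have e : expR x * expR (- x) = 1 by rewrite expRN mulfV// gt_eqF ?expR_gt0.
  transitivity (cosh x ^+ 2 - expR x * expR (- x)); last by rewrite e.
  by rewrite /cosh; field.
have := cosh_sech x; move/eqP; rewrite subr_eq0 => /eqP e.
have -> : sech x ^+ 2 + (cosh x ^+ 2 - 1) * sech x ^+ 2 - 1 = (cosh x * sech x) ^+ 2 - 1 by ring.
by rewrite e; ring.
Qed.

Lemma sechN x : sech (- x) = sech x.
Proof. by rewrite /sech opprK addrC. Qed.

Lemma coshN x : cosh (- x) = cosh x.
Proof. by rewrite /cosh opprK addrC. Qed.

Lemma tanhN x : tanh (- x) = - tanh x.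
Proof. by rewrite /tanh opprK sechN; ring. Qed.

(** The hyperbolic sine is written [tanh x * cosh x], which keeps all derivatives polynomial in
    [sech], [tanh], [cosh] and [x]. *)
Lemma has_deriv_cosh : has_deriv cosh (fun x => tanh x * cosh x).
Proof.
have h := has_derivZ (2^-1 : R) (has_derivD has_deriv_expR (has_deriv_expZ (-1))).
rewrite [X in has_deriv X](_ : cosh = (fun x => 2^-1 * (expR x + expR (-1 * x)))); last first.
  by apply/funext => x; rewrite /cosh mulN1r mulrC.
apply: (has_deriv_eq h) => x; rewrite /tanh sech_inv mulfVK ?gt_eqF ?cosh_gt0//.
by rewrite !mulN1r; ring.
Qed.

Lemma has_deriv_sech : has_deriv sech (fun x => - (sech x * tanh x)).
Proof.
rewrite [X in has_deriv X](_ : sech = (fun x => (cosh x)^-1)); last by apply/funext => x; rewrite sech_inv.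
apply: (has_deriv_eq (has_deriv_inv _ has_deriv_cosh)) => x.
  by rewrite gt_eqF ?cosh_gt0.
by rewrite sech_inv; field; rewrite gt_eqF ?cosh_gt0.
Qed.

Lemma has_deriv_tanh : has_deriv tanh (fun x => sech x ^+ 2).
Proof.
have h1 := has_derivZ (2^-1 : R) (has_derivB has_deriv_expR (has_deriv_expZ (-1))).
have h := has_derivM h1 has_deriv_sech.
rewrite [X in has_deriv X](_ : tanh = (fun x => 2^-1 * (expR x - expR (-1 * x)) * sech x)); last first.
  by apply/funext => x; rewrite /tanh mulN1r; ring.
apply: (has_deriv_eq h) => x; rewrite [-1 * x]mulN1r.
have -> : 2^-1 * (expR x - -1 * expR (- x)) = cosh x by rewrite /cosh; ring.
have -> : 2^-1 * (expR x - expR (- x)) * - (sech x * tanh x) = - tanh x ^+ 2.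
  by rewrite /tanh; ring.
have := cosh_sech x; have := sech_tanh_sqr x; lra.
Qed.

Lemma cosh_le x : cosh x <= expR `|x|.
Proof.
have h y : 0 <= y -> expR (- y) <= expR y by move=> y0; rewrite ler_expR; lra.
have [x0|x0] := leP 0 x.
  by rewrite (ger0_norm x0) /cosh; have := h _ x0; lra.
rewrite (ltr0_norm x0) /cosh.
by have := h (- x); rewrite opprK oppr_ge0 (ltW x0) => /(_ isT); lra.
Qed.

Lemma sech_ge x : expR (- `|x|) <= sech x.
Proof. by rewrite expRN sech_inv lef_pV2 ?posrE ?expR_gt0 ?cosh_gt0// cosh_le. Qed.

Lemma sech_le x : sech x <= 2 * expR (- `|x|).
Proof.
rewrite expRN /sech ler_pM2l// lef_pV2 ?posrE ?addr_gt0 ?expR_gt0//.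
have [x0|x0] := leP 0 x; first by rewrite (ger0_norm x0) lerDl expR_ge0.
by rewrite (ltr0_norm x0) lerDr expR_ge0.
Qed.

Lemma tanh_le1 x : `|tanh x| <= 1.
Proof.
rewrite -(ler_pXn2r (n := 2)) ?nnegrE// real_normK ?num_real// expr1n.
have := sech_tanh_sqr x; have := sqr_ge0 (sech x); lra.
Qed.

Lemma decay_sech : decay 1 2 (@sech R).
Proof. by move=> x; rewrite ger0_norm ?(ltW (sech_gt0 _))// mulN1r sech_le. Qed.

Lemma decay_tanh : decay 0 1 tanh.
Proof. by move=> x; rewrite oppr0 mul0r expR0 mul1r tanh_le1. Qed.

Lemma decay_cosh : decay (-1) 1 cosh.
Proof. by move=> x; rewrite ger0_norm ?(ltW (cosh_gt0 _))// opprK !mul1r cosh_le. Qed.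

(** A factor [x] is charged one unit of rate. This is crude but affordable: below it multiplies
    decaying terms inside solutions that may grow. *)
Lemma decay_id : decay (-1) 1 (@id R).
Proof.
move=> x /=; rewrite opprK !mul1r; apply: le_trans (expR_ge1Dx _); lra.
Qed.

Lemma decay_cst (c : R) : decay 0 `|c| (fun=> c).
Proof. by move=> x; rewrite oppr0 mul0r expR0 mulr1. Qed.

Lemma decay_scale (k c M : R) (f : R -> R) : 0 <= k -> decay c M f ->
  decay (c * k) M (fun x => f (k * x)).
Proof.
by move=> k0 h x; have := h (k * x); rewrite normrM (ger0_norm k0) mulrA mulNr.
Qed.

(* The odd solution is minus the derivative of sech; the even one comes from the
   Legendre function Q_2^1 and grows like cosh. *)
Lemma sech_fundamental_pair : exists p dp r dr : R -> R,
  ([/\ has_deriv p dp, has_deriv dp (fun x => (1 - 6 * sech x ^+ 2) * p x),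
      has_deriv r dr & has_deriv dr (fun x => (1 - 6 * sech x ^+ 2) * r x)] /\
  [/\ forall x, p (- x) = - p x, forall x, r (- x) = r x &
      p 0 * dr 0 - dp 0 * r 0 = 2]) /\
  [/\ decay 1 19 p, decay 1 19 dp, decay (-1) 19 r & decay (-1) 19 dr].
Proof.
have hs := has_deriv_sech; have ht := has_deriv_tanh; have hc := has_deriv_cosh.
have hp := has_derivM hs ht.
exists (fun x => sech x * tanh x), (fun x => sech x ^+ 2 * sech x - sech x * tanh x ^+ 2),
  (fun x => cosh x - 3 * sech x + 3 * (x * (sech x * tanh x))),
  (fun x => tanh x * cosh x + 6 * (sech x * tanh x) +
     3 * (x * (sech x ^+ 2 * sech x - sech x * tanh x ^+ 2))).
have hdp := has_derivB (has_derivM (has_deriv_sqr hs) hs) (has_derivM hs (has_deriv_sqr ht)).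
split; [split; split|].
- by apply: (has_deriv_eq hp) => x; ring.
- apply: (has_deriv_eq hdp) => x.
  transitivity ((1 - 6 * sech x ^+ 2) * (sech x * tanh x) +
    sech x * tanh x * (sech x ^+ 2 + tanh x ^+ 2 - 1)); first by ring.
  by rewrite sech_tanh_sqr mulr0 addr0.
- have := has_derivD (has_derivB hc (has_derivZ 3 hs))
    (has_derivZ 3 (has_derivM has_deriv_id hp)).
  by move=> /has_deriv_eq; apply => x /=; ring.
- have := has_derivD (has_derivD (has_derivM ht hc) (has_derivZ 6 hp))
    (has_derivZ 3 (has_derivM has_deriv_id hdp)).
  move=> /has_deriv_eq; apply => x /=.
  (* The equation holds modulo sech^2 + tanh^2 = 1 and cosh sech = 1; the cofactors of the two
     relations are exhibited. *)
  transitivity ((1 - 6 * sech x ^+ 2) *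
      (cosh x - 3 * sech x + 3 * (x * (sech x * tanh x))) +
    (cosh x - 9 * sech x + 3 * (x * (sech x * tanh x))) *
      (sech x ^+ 2 + tanh x ^+ 2 - 1) + 6 * sech x * (cosh x * sech x - 1)); first by ring.
  by rewrite sech_tanh_sqr cosh_sech !mulr0 !addr0.
- by move=> x; rewrite sechN tanhN; ring.
- by move=> x; rewrite sechN tanhN coshN; ring.
(* At 0, [p] vanishes, its derivative is 1 and [r] is 1 - 3 = -2, whence the Wronskian 2. *)
- have t0 : tanh (0 : R) = 0 by rewrite /tanh oppr0 subrr mul0r mul0r.
  have s0 : sech (0 : R) = 1 by rewrite /sech oppr0 expR0; field.
  have c0 : cosh (0 : R) = 1 by rewrite /cosh oppr0 expR0; field.
  by rewrite t0 s0 c0; ring.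
have ds := decay_sech; have dt := decay_tanh; have dc := decay_cosh.
have dst := decayM ds dt.
have dsq : decay 0 1 (fun x => sech x ^+ 2 - tanh x ^+ 2).
  move=> x; rewrite oppr0 mul0r expR0 mul1r ler_norml.
  have := sech_tanh_sqr x; have := sqr_ge0 (sech x); have := sqr_ge0 (tanh x).
  by move=> *; apply/andP; split; lra.
have dp' : decay 1 2 (fun x => sech x ^+ 2 * sech x - sech x * tanh x ^+ 2).
  have := decayM ds dsq; rewrite addr0 mulr1 => h x.
  by rewrite (_ : _ - _ = sech x * (sech x ^+ 2 - tanh x ^+ 2)); [exact: h|ring].
(* The common constant 19 is the largest of the four bounds, 1 + 12 + 6 for [dr]. *)
split.
- by apply: (decayW _ _ dst); lra.
- by apply: (decayW _ _ dp'); lra.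
- have h := decayD (decayD dc (decayW (d := -1) (N := 6) _ _ (decayN (decayZ 3 ds))))
    (decayW (d := -1) (N := 6) _ _ (decayZ 3 (decayM decay_id dst))).
  by apply: (decayW _ _ (h _ _ _ _)); rewrite ?(@ger0_norm R 3)//; lra.
- have dtc : decay (-1) 1 (fun x => tanh x * cosh x).
    by have := decayM dt dc; rewrite add0r mul1r.
  have h := decayD (decayD dtc (decayW (d := -1) (N := 12) _ _ (decayZ 6 dst)))
    (decayW (d := -1) (N := 6) _ _ (decayZ 3 (decayM decay_id dp'))).
  by apply: (decayW _ _ (h _ _ _ _)); rewrite ?(@ger0_norm R 3)// ?(@ger0_norm R 6)//; lra.
Qed.

(* The odd solution is minus half the derivative of sech^2; the even one comes
   from the Legendre function Q_3^2 and grows like cosh^2. *)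
Lemma sech2_fundamental_pair : exists p dp r dr : R -> R,
  ([/\ has_deriv p dp, has_deriv dp (fun x => (4 - 12 * sech x ^+ 2) * p x),
      has_deriv r dr & has_deriv dr (fun x => (4 - 12 * sech x ^+ 2) * r x)] /\
  [/\ forall x, p (- x) = - p x, forall x, r (- x) = r x &
      p 0 * dr 0 - dp 0 * r 0 = 8]) /\
  [/\ decay 2 400 p, decay 2 400 dp, decay (-2) 400 r & decay (-2) 400 dr].
Proof.
have hs := has_deriv_sech; have ht := has_deriv_tanh; have hc := has_deriv_cosh.
have hs2 := has_deriv_sqr hs.
have hp := has_derivM hs2 ht.
pose dp x : R := sech x ^+ 2 * (sech x ^+ 2 - 2 * tanh x ^+ 2).
exists (fun x => sech x ^+ 2 * tanh x), dp,
  (fun x => 2 * cosh x ^+ 2 + (5 - 15 * sech x ^+ 2) + 15 * (x * (sech x ^+ 2 * tanh x))),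
  (fun x => 4 * (tanh x * cosh x ^+ 2) + 45 * (sech x ^+ 2 * tanh x) + 15 * (x * dp x)).
have hdp := has_derivM hs2 (has_derivB hs2 (has_derivZ 2 (has_deriv_sqr ht))).
split; [split; split|].
- by apply: (has_deriv_eq hp) => x; rewrite /dp; ring.
- apply: (has_deriv_eq hdp) => x.
  transitivity ((4 - 12 * sech x ^+ 2) * (sech x ^+ 2 * tanh x) +
    4 * sech x ^+ 2 * tanh x * (sech x ^+ 2 + tanh x ^+ 2 - 1)); first by ring.
  by rewrite sech_tanh_sqr mulr0 addr0.
- have := has_derivD (has_derivD (has_derivZ 2 (has_deriv_sqr hc))
     (has_derivB (has_deriv_cst 5) (has_derivZ 15 hs2)))
    (has_derivZ 15 (has_derivM has_deriv_id hp)).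
  by move=> /has_deriv_eq; apply => x /=; rewrite /dp; ring.
- have := has_derivD (has_derivD (has_derivZ 4 (has_derivM ht (has_deriv_sqr hc)))
     (has_derivZ 45 hp)) (has_derivZ 15 (has_derivM has_deriv_id hdp)).
  move=> /has_deriv_eq; apply => x /=.
  transitivity ((4 - 12 * sech x ^+ 2) * (2 * cosh x ^+ 2 + (5 - 15 * sech x ^+ 2) +
      15 * (x * (sech x ^+ 2 * tanh x))) +
    (8 * cosh x ^+ 2 - 120 * sech x ^+ 2 + 60 * (x * (sech x ^+ 2 * tanh x))) *
      (sech x ^+ 2 + tanh x ^+ 2 - 1) +
    20 * (cosh x * sech x + 1) * (cosh x * sech x - 1)); first by ring.
  by rewrite sech_tanh_sqr cosh_sech !mulr0 !addr0.
- by move=> x; rewrite sechN tanhN; ring.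
- by move=> x; rewrite sechN tanhN coshN; ring.
(* At 0, [p] vanishes, its derivative is 1 and [r] is 2 + 5 - 15 = -8, whence the Wronskian 8. *)
- have t0 : tanh (0 : R) = 0 by rewrite /tanh oppr0 subrr mul0r mul0r.
  have s0 : sech (0 : R) = 1 by rewrite /sech oppr0 expR0; field.
  have c0 : cosh (0 : R) = 1 by rewrite /cosh oppr0 expR0; field.
  by rewrite /dp t0 s0 c0; ring.
have ds := decay_sech; have dt := decay_tanh; have dc := decay_cosh.
have ds2 : decay 2 4 (fun x => sech x ^+ 2).
  by have := decayM ds ds; apply: decayW; lra.
have dc2 : decay (-2) 1 (fun x => cosh x ^+ 2).
  by have := decayM dc dc; apply: decayW; lra.
have dst : decay 2 4 (fun x => sech x ^+ 2 * tanh x).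
  by have := decayM ds2 dt; apply: decayW; lra.
have dsq : decay 0 2 (fun x => sech x ^+ 2 - 2 * tanh x ^+ 2).
  move=> x; rewrite oppr0 mul0r expR0 mulr1 ler_norml.
  have := sech_tanh_sqr x; have := sqr_ge0 (sech x); have := sqr_ge0 (tanh x).
  by move=> *; apply/andP; split; lra.
have ddp : decay 2 8 dp by have := decayM ds2 dsq; apply: decayW; lra.
have nn (n : nat) : `|n%:R| = n%:R :> R by rewrite ger0_norm.
(* The largest of the four bounds is 4 + 180 + 120 = 304, for [dr]; 400 is a round majorant. *)
split.
- by apply: (decayW _ _ dst); lra.
- by apply: (decayW _ _ ddp); lra.
- have h1 : decay (-2) 2 (fun x => 2 * cosh x ^+ 2).
    by have := decayZ 2 dc2; apply: decayW; rewrite ?nn; lra.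
  have h2 : decay (-2) 65 (fun x => 5 - 15 * sech x ^+ 2).
    have h3 : decay (-2) 60 (fun x => 15 * sech x ^+ 2).
      by have := decayZ 15 ds2; apply: decayW; rewrite ?nn; lra.
    have h4 : decay (-2) 5 (fun=> 5 : R).
      by have := @decay_cst 5; apply: decayW; rewrite ?nn; lra.
    by have := decayB h4 h3; apply: decayW; lra.
  have h5 : decay (-2) 60 (fun x => 15 * (x * (sech x ^+ 2 * tanh x))).
    by have := decayZ 15 (decayM decay_id dst); apply: decayW; rewrite ?nn; lra.
  by have := decayD (decayD h1 h2) h5; apply: decayW; lra.
- have h1 : decay (-2) 4 (fun x => 4 * (tanh x * cosh x ^+ 2)).
    by have := decayZ 4 (decayM dt dc2); apply: decayW; rewrite ?nn; lra.
  have h2 : decay (-2) 180 (fun x => 45 * (sech x ^+ 2 * tanh x)).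
    by have := decayZ 45 dst; apply: decayW; rewrite ?nn; lra.
  have h3 : decay (-2) 120 (fun x => 15 * (x * dp x)).
    by have := decayZ 15 (decayM decay_id ddp); apply: decayW; rewrite ?nn; lra.
  by have := decayD (decayD h1 h2) h3; apply: decayW; lra.
Qed.

(** Under x -> kap x the potential gains a factor kap^2, derivatives and the Wronskian a factor
    [kap], and the rate [m] becomes [m * kap]. *)
Lemma scaled_green_solver (q0 p dp r dr : R -> R) (kap m C W a c : R) :
  0 < kap -> 0 < m -> W != 0 -> 0 < a -> 0 <= c <= m * kap ->
  ([/\ has_deriv p dp, has_deriv dp (fun x => q0 x * p x),
      has_deriv r dr & has_deriv dr (fun x => q0 x * r x)] /\
  [/\ forall x, p (- x) = - p x, forall x, r (- x) = r x &
      p 0 * dr 0 - dp 0 * r 0 = W]) /\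
  [/\ decay m C p, decay m C dp, decay (- m) C r & decay (- m) C dr] ->
  let q x := kap ^+ 2 * q0 (kap * x) in
  exists2 K, 0 < K & exists S dS : (R -> R) -> R -> R,
  (forall f M, source (c + a) M f ->
    [/\ has_deriv (S f) (dS f), has_deriv (dS f) (fun x => q x * S f x - f x),
        forall x, S f (- x) = S f x, decay c (K * M) (S f) &
        decay c (K * M) (dS f)]) /\
  (forall f g L M N, source (c + a) L f -> source (c + a) M g ->
    decay (c + a) N (fun x => f x - g x) ->
    decay c (K * N) (fun x => S f x - S g x)).
Proof.
move=> kap0 m0 W0 a0 ck [[[h1 h2 h3 h4] [h5 h6 h7]] [b1 b2 b3 b4]] q.
have hk := has_derivZ kap (@has_deriv_id R).
have sc f df : has_deriv f df -> has_deriv (fun x => f (kap * x)) (fun x => kap * df (kap * x)).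
  by move=> hf; apply: (has_deriv_eq (has_deriv_comp hf hk)) => x; ring.
have sc2 f df : has_deriv df (fun x => q0 x * f x) ->
    has_deriv (fun x => kap * df (kap * x)) (fun x => q x * f (kap * x)).
  by move=> hf; apply: (has_deriv_eq (has_derivZ kap (sc _ _ hf))) => x; rewrite /q; ring.
have C0 := decay_ge0 b1.
(* Dominates both [C], needed for the functions, and [kap * C], needed for their derivatives. *)
pose C' := (1 + kap) * C.
have dec1 c' f : decay c' C f -> decay (c' * kap) C' (fun x => f (kap * x)).
  move=> /(decay_scale (ltW kap0)); apply: decayW => //.
  have : 0 <= kap * C by rewrite mulr_ge0// ltW.
  by rewrite /C'; lra.
have dec2 c' f : decay c' C f -> decay (c' * kap) C' (fun x => kap * f (kap * x)).
  move=> /(decay_scale (ltW kap0)) /(decayZ kap); apply: decayW => //.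
  by rewrite (ger0_norm (ltW kap0)) /C'; lra.
have b3' := dec1 _ _ b3; have b4' := dec2 _ _ b4; rewrite mulNr in b3' b4'.
apply: (green_solver _ _ (sc _ _ h1) (sc2 _ _ h2) (sc _ _ h3) (sc2 _ _ h4) _ _ _
  (dec1 _ _ b1) (dec2 _ _ b2) b3' b4' a0 ck (W := kap * W)).
- by rewrite mulr_gt0.
- by rewrite mulf_neq0// gt_eqF.
- by move=> x; rewrite mulrN h5.
- by move=> x; rewrite mulrN h6.
- by rewrite mulr0 -h7; ring.
Qed.

End Hyperbolic.

(** * The ground states and a minimum principle *)

Section GroundStates.
Context {R : realType}.
Variables (l : R) (l0 : 0 < l).
Let k := Num.sqrt l.

Let k_gt0 : 0 < k. Proof. by rewrite sqrtr_gt0. Qed.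
Let k_sqr : k ^+ 2 = l. Proof. by rewrite sqr_sqrtr// ltW. Qed.

Lemma U1_profile : exists dU C,
  [/\ has_deriv (U1 l) dU, has_deriv dU (fun x => l * U1 l x - U1 l x ^+ 3),
      forall x, U1 l (- x) = U1 l x, decay k C (U1 l) & decay k C dU].
Proof.
pose A := Num.sqrt (2 * l).
have A2 : A ^+ 2 = 2 * k ^+ 2 by rewrite sqr_sqrtr ?k_sqr// mulr_ge0// ltW.
have hk := has_derivZ k (@has_deriv_id R).
have hs := has_deriv_comp (@has_deriv_sech R) hk.
have ht := has_deriv_comp (@has_deriv_tanh R) hk.
have ds := decay_scale (ltW k_gt0) (@decay_sech R).
have dst := decay_scale (ltW k_gt0) (decayM (@decay_sech R) (@decay_tanh R)).
rewrite ?addr0 ?mul1r in ds dst.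
exists (fun x => A * (- k * (sech (k * x) * tanh (k * x)))), (`|A| * 2 + `|A| * (k * 2)).
split.
- by apply: (has_deriv_eq (has_derivZ A hs)) => x; ring.
- apply: (has_deriv_eq (has_derivZ A (has_derivZ (- k) (has_derivM hs ht)))) => x.
  rewrite /U1 -/k -/A -{1}k_sqr.
  transitivity (k ^+ 2 * (A * sech (k * x)) - A * sech (k * x) * (2 * k ^+ 2) * sech (k * x) ^+ 2
     + A * k ^+ 2 * sech (k * x) * (sech (k * x) ^+ 2 + tanh (k * x) ^+ 2 - 1)).
    by rewrite /id; ring.
  by rewrite sech_tanh_sqr -A2; ring.
- by move=> x; rewrite /U1 mulrN sechN.
- apply: decayW (decayZ A ds) => //.
  by rewrite lerDl mulr_ge0// mulr_ge0// ltW.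
- apply: decayW (decayZ A (decayZ (- k) dst)) => //.
  by rewrite normrN (ger0_norm (ltW k_gt0)) mulr1 lerDr mulr_ge0.
Qed.

(** The rate is that of the weight of [phi], so a perturbation below r e^{- k |x|} with r < sqrt (2
    l) cannot destroy positivity. *)
Lemma U1_ge x : Num.sqrt (2 * l) * expR (- k * `|x|) <= U1 l x.
Proof.
rewrite /U1 ler_wpM2l ?sqrtr_ge0//; apply: le_trans (sech_ge _).
by rewrite normrM (ger0_norm (ltW k_gt0)) mulNr.
Qed.

Lemma V2_profile : exists dV C,
  [/\ has_deriv (V2 l) dV,
      has_deriv dV (fun x => l * V2 l x - 2^-1 * V2 l x ^+ 2),
      forall x, V2 l (- x) = V2 l x, decay k C (V2 l) & decay k C dV].
Proof.
pose h := k / 2.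
have h0 : 0 < h by rewrite divr_gt0.
have hl : l = 4 * h ^+ 2 by rewrite -k_sqr /h; field.
have hk := has_derivZ h (@has_deriv_id R).
have hs := has_deriv_comp (@has_deriv_sech R) hk.
have ht := has_deriv_comp (@has_deriv_tanh R) hk.
have dss := decay_scale (ltW h0) (decayM (@decay_sech R) (@decay_sech R)).
have dsst := decay_scale (ltW h0)
  (decayM (decayM (@decay_sech R) (@decay_sech R)) (@decay_tanh R)).
have e2 : (1 + 1) * h = k by rewrite /h; field.
rewrite addr0 !e2 in dss dsst.
exists (fun x => 3 * l * (- 2 * h * (sech (h * x) * sech (h * x) * tanh (h * x)))),
  (`|3 * l| * (2 * 2) + `|3 * l| * (`|-2 * h| * (2 * 2))).
split.
- by apply: (has_deriv_eq (has_derivZ _ (has_deriv_sqr hs))) => x; rewrite /id; ring.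
- apply: (has_deriv_eq (has_derivZ _ (has_derivZ _ (has_derivM (has_derivM hs hs) ht)))) => x.
  rewrite /V2 -/k -/h hl.
  transitivity (4 * h ^+ 2 * (3 * (4 * h ^+ 2) * sech (h * x) ^+ 2) -
    2^-1 * (3 * (4 * h ^+ 2) * sech (h * x) ^+ 2) ^+ 2
    + 48 * h ^+ 4 * sech (h * x) ^+ 2 * (sech (h * x) ^+ 2 + tanh (h * x) ^+ 2 - 1)).
    by rewrite /id; field.
  by rewrite sech_tanh_sqr; ring.
- by move=> x; rewrite /V2 mulrN sechN.
- by apply: decayW (decayZ (3 * l) dss) => //; rewrite lerDl mulr_ge0// mulr_ge0.
- apply: decayW (decayZ (3 * l) (decayZ (- 2 * h) dsst)) => //.
  by rewrite mulr1 lerDr mulr_ge0.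
Qed.

(** The rescaled model potential is that of the linearization at [U1]; [sech2_potential] does the
    same for [V2]. *)
Lemma sech_potential x :
  k ^+ 2 * (1 - 6 * sech (k * x) ^+ 2) = l - 3 * U1 l x ^+ 2.
Proof.
have e : Num.sqrt (2 * l) ^+ 2 = 2 * l by rewrite sqr_sqrtr// mulr_ge0// ltW.
rewrite k_sqr /U1 -/k; move: (sech (k * x)) => s.
by rewrite exprMn e; ring.
Qed.

Lemma sech2_potential x :
  (k / 2) ^+ 2 * (4 - 12 * sech (k / 2 * x) ^+ 2) = l - V2 l x.
Proof. by rewrite /V2 -/k -k_sqr; field. Qed.

End GroundStates.

Section MinimumPrinciple.
Context {R : realType}.
Variables (v dv g : R -> R) (l a M : R).
Hypotheses (l0 : 0 < l) (a0 : 0 < a) (hv : has_deriv v dv)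
  (hdv : has_deriv dv (fun x => l * v x - g x)) (cg : continuous g)
  (g0 : forall x, 0 < g x) (bv : decay a M v).

(** Second derivative test with explicit comparison: at such a minimum v'' = l v - g <= - g x, hence
    v'' <= - g x / 2 on an interval to the right; there [dv] lies below a linear function and [v]
    below a parabola that drops under [v x]. *)
Let no_nonpositive_minimum x : v x <= 0 -> ~ (forall y, v x <= v y).
Proof.
move=> vx vmin.
have dvx : dv x = 0.
  have xI : x \in `]x - 1, x + 1[ by rewrite in_itv /=; apply/andP; split; lra.
  have h : is_derive x (1 : R) v 0.
    apply: (@derive1_at_min _ v (x - 1) (x + 1) x) => //; first by lra.
    by move=> t _; case: (hv t).
  by have := hv x => h'; rewrite -(@derive_val _ _ _ _ _ _ _ h) (@derive_val _ _ _ _ _ _ _ h').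
have gx := g0 x.
have cdd : continuous (fun x => l * v x - g x).
  move=> y; apply: cvgB; last exact: cg.
  by apply: cvgMr; exact: (has_deriv_continuous hv).
have /cvgrPdist_lt /(_ _ (divr_gt0 gx (ltr0Sn R 1))) := cdd x.
move=> /nbhs_ballP [d /= d0 hd].
have lv : l * v x <= 0 by rewrite pmulr_rle0.
have near_x z : x <= z <= x + d / 2 -> l * v z - g z <= - (g x / 2).
  move=> /andP[xz zd].
  have : ball x d z by rewrite /ball /= ler0_norm; lra.
  move=> /hd; rewrite ltr_norml => /andP[]; lra.
have dv_le z : x <= z <= x + d / 2 -> dv z <= - (g x / 2) * (z - x).
  move=> /andP[xz zd].
  have := has_deriv_le hdv (has_derivZ (- (g x / 2)) (@has_deriv_id R)) xz.
  rewrite dvx /id => h; have : forall y, x <= y <= z -> l * v y - g y <= - (g x / 2) * 1.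
    by move=> y /andP[xy yz]; rewrite mulr1; apply: near_x; rewrite xy (le_trans yz).
  by move=> /h; lra.
have xd : x <= x + d / 2 by lra.
have hq := has_derivZ (- (g x / 4)) (has_deriv_sqr
  (has_derivB (@has_deriv_id R) (has_deriv_cst x))).
have := has_deriv_le hv hq xd; rewrite /id => h.
have /h : forall y, x <= y <= x + d / 2 -> dv y <= - (g x / 4) * (2 * (y - x) * (1 - 0)).
  by move=> y /dv_le; lra.
have := vmin (x + d / 2).
rewrite subrr expr0n /= mulr0 subr0.
have -> : x + d / 2 - x = d / 2 by ring.
have : 0 < g x / 4 * (d / 2) ^+ 2 by rewrite mulr_gt0 ?exprn_gt0// divr_gt0.
lra.
Qed.

(** A nonpositive value would produce a nonpositive global minimum: if [v] is negative at [x1],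
    decay confines the values below [v x1] to a compact interval. *)
Lemma minimum_principle x : 0 < v x.
Proof.
rewrite ltNge; apply/negP => vx.
have [vge0|] := pselect (forall y, 0 <= v y).
  by apply: (no_nonpositive_minimum vx) => y; apply: le_trans vx _.
move=> /existsNP [x1 /negP]; rewrite -ltNge => vx1.
have M0 := decay_ge0 bv.
(* By e^{a |y|} >= 1 + a |y|, the decay bound is below [- v x1] as soon as |y| is at least the
   second summand; the first one puts [x1] itself in the interval. *)
pose X := `|x1| + M / - v x1 / a.
have nv : 0 < - v x1 by rewrite oppr_gt0.
have X0 : 0 <= X by rewrite addr_ge0// !divr_ge0// ltW.
have far y : X <= `|y| -> v x1 <= v y.
  move=> Xy; have := bv y; rewrite ler_norml => /andP[+ _].
  apply: le_trans; rewrite -lerN2 opprK mulNr expRN ler_pdivrMr ?expR_gt0//.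
  rewrite mulrC -ler_pdivrMr//; apply: (le_trans _ (expR_ge1Dx _)).
  have : M / - v x1 <= a * `|y|.
    rewrite -ler_pdivrMl// mulrC; apply: le_trans Xy.
    by rewrite lerDr.
  lra.
have NX : - X <= X by lra.
have cv : {within `[- X, X], continuous v}.
  by apply: continuous_subspaceT; exact: has_deriv_continuous hv.
have [c cX hc] := EVT_min NX cv.
have x1X : x1 \in `[- X, X].
  by rewrite in_itv /= -ler_norml lerDl !divr_ge0// ltW.
have cx1 := hc _ x1X.
apply: (@no_nonpositive_minimum c); first exact: (le_trans cx1 (ltW vx1)).
move=> y; have [yX|Xy] := leP `|y| X.
  by apply: hc; rewrite in_itv /= -ler_norml.
by apply: (le_trans cx1); apply: far; exact: ltW.
Qed.

End MinimumPrinciple.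

(** * Solution of the system near the ground states *)

Section Continuity.
Context {R : realType}.
Implicit Types f g : R -> R.

Lemma continuous_add f g : continuous f -> continuous g ->
  continuous (fun x => f x + g x).
Proof. by move=> cf cg x; apply: cvgD; [exact: cf|exact: cg]. Qed.

Lemma continuous_mul f g : continuous f -> continuous g ->
  continuous (fun x => f x * g x).
Proof. by move=> cf cg x; apply: cvgM; [exact: cf|exact: cg]. Qed.

Lemma continuous_scale c f : continuous f -> continuous (fun x => c * f x).
Proof. by move=> cf; apply: continuous_mul => // x; exact: cvg_cst. Qed.

End Continuity.

Section Nonlinearity.
Context {R : realType}.
Variables (U V : R -> R) (b k a C : R).
Hypotheses (b0 : 0 <= b) (ak : 0 < a <= k) (C1 : 1 <= C)
  (bU : decay k C U) (bV : decay a C V).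
Implicit Types (phi chi : R -> R).

(** What is left of (U + phi)^3 + b (U + phi) (V + chi) once U^3 and the linear term 3 U^2 phi are
    removed. Powers are written as products so that [decayM] and [continuous_mul] apply. *)
Definition nonlin1 phi chi x :=
  3 * (U x * (phi x * phi x)) + phi x * (phi x * phi x) +
  b * ((U x + phi x) * (V x + chi x)).

Definition nonlin2 phi chi x :=
  2^-1 * (chi x * chi x) + 2^-1 * b * ((U x + phi x) * (U x + phi x)).

Let nn (n : nat) : `|n%:R| = n%:R :> R. Proof. by rewrite ger0_norm. Qed.
Let nb : `|b| = b. Proof. by rewrite ger0_norm. Qed.
Let nh : `|2^-1| = 2^-1 :> R. Proof. by rewrite ger0_norm. Qed.

Lemma decay_ext c M (f g : R -> R) : f =1 g -> decay c M f -> decay c M g.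
Proof. by move=> fg h x; rewrite -fg. Qed.

Lemma nonlin1_continuous phi chi : continuous U -> continuous V ->
  continuous phi -> continuous chi -> continuous (nonlin1 phi chi).
Proof.
move=> cU cV cp cc; have cpp := continuous_mul cp cp.
apply: continuous_add; first apply: continuous_add.
- by apply: continuous_scale; exact: continuous_mul.
- exact: continuous_mul.
- by apply: continuous_scale; apply: continuous_mul; exact: continuous_add.
Qed.

Lemma nonlin2_continuous phi chi : continuous U ->
  continuous phi -> continuous chi -> continuous (nonlin2 phi chi).
Proof.
move=> cU cp cc; apply: continuous_add; apply: continuous_scale.
  exact: continuous_mul.
by apply: continuous_mul; exact: continuous_add.
Qed.

(** The coupling term has rate exactly [k + a]; the other two have rate [3 * k], which is enough
    because [a <= k]. The surplus [a] over [k] is what the Green operator consumes. *)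
Lemma nonlin1_decay phi chi r : r <= 1 -> decay k r phi -> decay a r chi ->
  decay (k + a) (3 * C * r ^+ 2 + r ^+ 3 + b * (C + 1) ^+ 2) (nonlin1 phi chi).
Proof.
move=> r1 hp hc; have /andP[a0 a_k] := ak; have r0 := decay_ge0 hp.
have C_ge1 := C1; have b_ge0 := b0.
apply: decayD; first apply: decayD.
- by have := decayZ 3 (decayM bU (decayM hp hp)); apply: decayW; rewrite ?nn; nra.
- by have := decayM hp (decayM hp hp); apply: decayW; rewrite ?nn; nra.
- have := decayZ b (decayM (decayD bU hp) (decayD bV hc)).
  have Cr : C + r <= C + 1 by lra.
  have Cr0 : 0 <= C + r by lra.
  by apply: decayW => //; rewrite nb; apply: ler_wpM2l => //; exact: ler_pM.
Qed.

(** Each term of the difference is factored so as to contain [phi - phi'] or [chi - chi'], which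
    keeps the rates of [nonlin1_decay] and makes the constant proportional to [d]. *)
Lemma nonlin1_lipschitz phi chi phi' chi' r d : r <= 1 ->
  decay k r phi -> decay a r chi -> decay k r phi' -> decay a r chi' ->
  decay k d (fun x => phi x - phi' x) -> decay a d (fun x => chi x - chi' x) ->
  decay (k + a) (d * (6 * C * r + 3 * r ^+ 2 + 2 * b * (C + 1)))
    (fun x => nonlin1 phi chi x - nonlin1 phi' chi' x).
Proof.
move=> r1 hp hc hp' hc' dp dc; have /andP[a0 a_k] := ak; have r0 := decay_ge0 hp.
have C_ge1 := C1; have b_ge0 := b0.
have d0 := decay_ge0 dp.
have h1 : decay (k + a) (6 * C * r * d)
    (fun x => 3 * (U x * ((phi x - phi' x) * (phi x + phi' x)))).
  by have := decayZ 3 (decayM bU (decayM dp (decayD hp hp'))); apply: decayW;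
    rewrite ?nn; nra.
have h2 : decay (k + a) (3 * r ^+ 2 * d)
    (fun x => (phi x - phi' x) * (phi x * phi x + phi x * phi' x + phi' x * phi' x)).
  by have := decayM dp (decayD (decayD (decayM hp hp) (decayM hp hp')) (decayM hp' hp'));
    apply: decayW; rewrite ?nn; nra.
have h3 : decay (k + a) (2 * b * (C + 1) * d)
    (fun x => b * ((phi x - phi' x) * (V x + chi x) + (U x + phi' x) * (chi x - chi' x))).
  have := decayZ b (decayD (decayM dp (decayD bV hc)) (decayM (decayD bU hp') dc)).
  apply: decayW => //; rewrite nb.
  have : 0 <= b * (d * (1 - r)) by rewrite !mulr_ge0// subr_ge0.
  nra.
apply: (decay_ext _ (decayW (lexx _) _ (decayD (decayD h1 h2) h3))); last by nra.
by move=> x; rewrite /nonlin1; ring.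
Qed.

Lemma nonlin2_decay phi chi r : r <= 1 -> decay k r phi -> decay a r chi ->
  decay (a + a) (2^-1 * r ^+ 2 + 2^-1 * b * (C + 1) ^+ 2) (nonlin2 phi chi).
Proof.
move=> r1 hp hc; have /andP[a0 a_k] := ak; have r0 := decay_ge0 hp.
have C_ge1 := C1; have b_ge0 := b0.
apply: decayD.
- by have := decayZ 2^-1 (decayM hc hc); apply: decayW; rewrite ?nh; nra.
- have := decayZ (2^-1 * b) (decayM (decayD bU hp) (decayD bU hp)).
  apply: decayW; first by lra.
  have Cr : C + r <= C + 1 by lra.
  have Cr0 : 0 <= C + r by lra.
  by rewrite normrM nh nb; apply: ler_wpM2l; [exact: mulr_ge0|exact: ler_pM].
Qed.

Lemma nonlin2_lipschitz phi chi phi' chi' r d : r <= 1 ->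
  decay k r phi -> decay a r chi -> decay k r phi' -> decay a r chi' ->
  decay k d (fun x => phi x - phi' x) -> decay a d (fun x => chi x - chi' x) ->
  decay (a + a) (d * (r + b * (C + 1)))
    (fun x => nonlin2 phi chi x - nonlin2 phi' chi' x).
Proof.
move=> r1 hp hc hp' hc' dp dc; have /andP[a0 a_k] := ak; have r0 := decay_ge0 hp.
have C_ge1 := C1; have b_ge0 := b0.
have d0 := decay_ge0 dp.
have h1 : decay (a + a) (r * d)
    (fun x => 2^-1 * ((chi x - chi' x) * (chi x + chi' x))).
  by have := decayZ 2^-1 (decayM dc (decayD hc hc')); apply: decayW; rewrite ?nh; nra.
have h2 : decay (a + a) (b * (C + 1) * d)
    (fun x => 2^-1 * b * ((phi x - phi' x) * ((U x + phi x) + (U x + phi' x)))).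
  have := decayZ (2^-1 * b) (decayM dp (decayD (decayD bU hp) (decayD bU hp'))).
  apply: decayW; first by lra.
  rewrite normrM nh nb.
  have : 0 <= b * (d * (1 - r)) by rewrite !mulr_ge0// subr_ge0.
  nra.
apply: (decay_ext _ (decayW (lexx _) _ (decayD h1 h2))); last by nra.
by move=> x; rewrite /nonlin2; ring.
Qed.

End Nonlinearity.

(** [r] is twice the bound K b (C + 1)^2 on the contribution of the coupling; terms of higher order
    in [r] must fit into the other half. The threshold 1/48 achieves this: 3 K C r^2 <= r / 16 in
    the ball estimate, 6 K C r <= 1/8 in the Lipschitz one. *)
Lemma contraction_constants (R : realType) (K C b r : R) :
  1 <= C -> 1 <= K -> 0 < b -> r = 2 * K * (C + 1) ^+ 2 * b -> K * C * r <= 48^-1 ->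
  [/\ K * (3 * C * r ^+ 2 + r ^+ 3 + b * (C + 1) ^+ 2) <= r,
      K * (2^-1 * r ^+ 2 + 2^-1 * b * (C + 1) ^+ 2) <= r,
      K * (6 * C * r + 3 * r ^+ 2 + 2 * b * (C + 1)) <= 2^-1,
      K * (r + b * (C + 1)) <= 2^-1 & r <= 1].
Proof.
move=> C1 K1 b0 er KCr.
have Kb0 : 0 < K * b by rewrite mulr_gt0//; lra.
have r0 : 0 < r by rewrite er -mulrA mulrC -!mulrA pmulr_rgt0; nra.
have Kr0 : 0 < K * r by rewrite mulr_gt0//; lra.
have Kr : K * r <= 48^-1.
  by apply: le_trans KCr; rewrite mulrAC ler_peMr// ltW.
have r48 : r <= 48^-1 by apply: le_trans Kr; rewrite ler_peMl// ltW.
have KCrr : K * C * r * r <= 48^-1 * r by rewrite ler_wpM2r// ltW.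
have Krr : K * r * r <= 48^-1 * r by rewrite ler_wpM2r// ltW.
have Krrr : K * r * r * r <= 48^-1 * r * r by rewrite !ler_wpM2r// ltW.
have rr : r * r <= 48^-1 * r by rewrite ler_wpM2r// ltW.
have bKC : 2 * K * (C + 1) * b <= r.
  rewrite er ler_wpM2r ?(ltW b0)// expr2 mulrA ler_peMr//; last by lra.
  by rewrite !mulr_ge0//; lra.
split; [by lra| by lra| by lra| by lra| by lra].
Qed.

Section System.
Context {R : realType}.
Variables (l1 l2 : R).
Hypotheses (l1_gt0 : 0 < l1) (l2_gt0 : 0 < l2).
Let k1 := Num.sqrt l1.
Let k2 := Num.sqrt l2.

Let k1_gt0 : 0 < k1. Proof. by rewrite sqrtr_gt0. Qed.
Let k2_gt0 : 0 < k2. Proof. by rewrite sqrtr_gt0. Qed.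

(** The endpoint rate [c = k1] is taken so that solutions decay like [U1]; the price is the surplus
    rate [a] demanded of the source. *)
Lemma linearized_solver1 (a : R) : 0 < a ->
  exists2 K, 0 < K & exists S dS : (R -> R) -> R -> R,
  (forall f M, source (k1 + a) M f ->
    [/\ has_deriv (S f) (dS f),
        has_deriv (dS f) (fun x => (l1 - 3 * U1 l1 x ^+ 2) * S f x - f x),
        forall x, S f (- x) = S f x, decay k1 (K * M) (S f) &
        decay k1 (K * M) (dS f)]) /\
  (forall f g L M N, source (k1 + a) L f -> source (k1 + a) M g ->
    decay (k1 + a) N (fun x => f x - g x) ->
    decay k1 (K * N) (fun x => S f x - S g x)).
Proof.
move=> a0; have [p [dp [r [dr h]]]] := @sech_fundamental_pair R.
have W0 : (2 : R) != 0 by [].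
have c0 : 0 <= k1 <= 1 * k1 by rewrite mul1r lexx ltW.
have [K K0 [S [dS [h1 h2]]]] := scaled_green_solver k1_gt0 ltr01 W0 a0 c0 h.
exists K => //; exists S, dS; split => // f M /h1 [r1 r2 r3 r4 r5]; split => //.
by apply: (has_deriv_eq r2) => x; rewrite (sech_potential l1_gt0).
Qed.

(** After scaling the kernel functions have rate 2 (k2 / 2) = k2, so every [a <= k2] is an
    admissible weight. *)
Lemma linearized_solver2 (a : R) : 0 < a <= k2 ->
  exists2 K, 0 < K & exists S dS : (R -> R) -> R -> R,
  (forall f M, source (a + a) M f ->
    [/\ has_deriv (S f) (dS f),
        has_deriv (dS f) (fun x => (l2 - V2 l2 x) * S f x - f x),
        forall x, S f (- x) = S f x, decay a (K * M) (S f) &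
        decay a (K * M) (dS f)]) /\
  (forall f g L M N, source (a + a) L f -> source (a + a) M g ->
    decay (a + a) N (fun x => f x - g x) ->
    decay a (K * N) (fun x => S f x - S g x)).
Proof.
move=> /andP[a0 ak]; have [p [dp [r [dr h]]]] := @sech2_fundamental_pair R.
have W0 : (8 : R) != 0 by [].
have h0 : 0 < k2 / 2 by rewrite divr_gt0.
have c0 : 0 <= a <= 2 * (k2 / 2).
  by rewrite (ltW a0) /= (_ : 2 * (k2 / 2) = k2)//; field.
have [K K0 [S [dS [h1 h2]]]] := scaled_green_solver h0 (ltr0Sn R 1) W0 a0 c0 h.
exists K => //; exists S, dS; split => // f M /h1 [r1 r2 r3 r4 r5]; split => //.
by apply: (has_deriv_eq r2) => x; rewrite (sech2_potential l2_gt0).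
Qed.

(** The derivatives are bounded too, since the radius [r] has to control the W^{1,2} norm. *)
Definition perturbation (a b r : R) (phi dphi chi dchi : R -> R) :=
  [/\ has_deriv phi dphi, has_deriv dphi (fun x => (l1 - 3 * U1 l1 x ^+ 2) * phi x -
        nonlin1 (U1 l1) (V2 l2) b phi chi x),
      has_deriv chi dchi & has_deriv dchi (fun x => (l2 - V2 l2 x) * chi x -
        nonlin2 (U1 l1) b phi chi x)] /\
  [/\ forall x, phi (- x) = phi x, forall x, chi (- x) = chi x &
      [/\ decay k1 r phi, decay k1 r dphi, decay a r chi & decay a r dchi]].

(** [L] does not depend on [b], so the radius [L * b] tends to 0 with [b]. The cap [rho0] on the
    radius is there for the positivity of [u]. *)
Lemma perturbation_exists (rho0 : R) : 0 < rho0 ->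
  exists a L b0, [/\ 0 < a <= k1 /\ a <= k2, 0 < L, 0 < b0, L * b0 <= rho0 &
   forall b, 0 < b < b0 -> exists phi dphi chi dchi,
     perturbation a b (L * b) phi dphi chi dchi].
Proof.
move=> rho0_gt0.
have [dU [C1 [hU hdU eU bU bdU]]] := U1_profile l1_gt0.
have [dV [C2 [hV hdV eV bV bdV]]] := V2_profile l2_gt0.
rewrite -/k1 -/k2 in bU bdU bV bdV.
pose a := Num.min k1 k2.
have a0 : 0 < a by rewrite lt_min k1_gt0.
have ak1 : a <= k1 by rewrite ge_min lexx.
have ak2 : a <= k2 by rewrite ge_min lexx orbT.
have aa : 0 < a <= k1 by rewrite a0.
have [K1 K1_0 [S1 [dS1 [sol1 lip1]]]] := linearized_solver1 a0.
have [K2 K2_0 [S2 [dS2 [sol2 lip2]]]] := linearized_solver2 (introT andP (conj a0 ak2)).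
have C1_0 := decay_ge0 bU; have C2_0 := decay_ge0 bV.
pose C := C1 + C2 + 1; pose K := K1 + K2 + 1.
have C_ge1 : 1 <= C by rewrite /C; lra.
have K_ge1 : 1 <= K by rewrite /K; lra.
have {}bU : decay k1 C (U1 l1) by apply: decayW bU => //; rewrite /C; lra.
have {}bV : decay a C (V2 l2) by apply: decayW bV => //; rewrite /C; lra.
pose L := 2 * K * (C + 1) ^+ 2.
have KC : 1 <= K * C by rewrite -[1]mulr1 ler_pM.
(* The second entry is the smallness condition of [contraction_constants]. *)
pose rho := Num.min rho0 (48 * (K * C))^-1.
have rho_gt0 : 0 < rho by rewrite lt_min rho0_gt0 invr_gt0 mulr_gt0//; lra.
have C12 : 4 <= (C + 1) ^+ 2 by rewrite (_ : 4 = (1 + 1) ^+ 2 :> R) ?ler_pXn2r ?nnegrE//; [lra..|ring].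
have L8 : 8 <= L by rewrite /L; nra.
have L_gt0 : 0 < L by lra.
exists a, L, (rho / L); split => //.
- by rewrite divr_gt0.
- by rewrite mulrC divfK ?gt_eqF// ge_min lexx.
move=> b /andP[b0 bL].
have {}b_ge0 := ltW b0.
pose r := L * b; rewrite -/r.
have r0 : 0 < r by rewrite mulr_gt0.
have r_rho : r <= rho by rewrite /r mulrC -ler_pdivlMr// ltW.
have KCr : K * C * r <= 48^-1.
  have h : r <= (48 * (K * C))^-1 by apply: le_trans r_rho _; rewrite ge_min lexx orbT.
  have KC0 : 0 < K * C by lra.
  by rewrite mulrC -ler_pdivlMr// -invfM.
have [bd1 bd2 ct1 ct2 r1] := contraction_constants C_ge1 K_ge1 b0 (erefl r) KCr.
have cU := has_deriv_continuous hU; have cV := has_deriv_continuous hV.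
have src1 phi chi : continuous phi -> continuous chi -> (forall x, phi (- x) = phi x) ->
    (forall x, chi (- x) = chi x) -> decay k1 r phi -> decay a r chi ->
    source (k1 + a) (3 * C * r ^+ 2 + r ^+ 3 + b * (C + 1) ^+ 2)
      (nonlin1 (U1 l1) (V2 l2) b phi chi).
  move=> cp cc ep ec bp bc; split; last exact: nonlin1_decay.
    exact: nonlin1_continuous.
  by move=> x; rewrite /nonlin1 ep ec eU eV.
have src2 phi chi : continuous phi -> continuous chi -> (forall x, phi (- x) = phi x) ->
    (forall x, chi (- x) = chi x) -> decay k1 r phi -> decay a r chi ->
    source (a + a) (2^-1 * r ^+ 2 + 2^-1 * b * (C + 1) ^+ 2)
      (nonlin2 (U1 l1) b phi chi).
  move=> cp cc ep ec bp bc; split; last exact: (nonlin2_decay b_ge0 aa C_ge1).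
    exact: nonlin2_continuous.
  by move=> x; rewrite /nonlin2 ep ec eU.
(* The pair is one function on [bool * R]: [true] carries [phi], with rate [k1], and [false] carries
   [chi], with rate [a]. *)
pose w (t : bool * R) := expR (- (if t.1 then k1 else a) * `|t.2|).
pose P (z : bool * R -> R) := forall i,
  continuous (fun x => z (i, x)) /\ forall x, z (i, - x) = z (i, x).
pose F (z : bool * R -> R) (t : bool * R) :=
  let phi x := z (true, x) in let chi x := z (false, x) in
  if t.1 then S1 (nonlin1 (U1 l1) (V2 l2) b phi chi) t.2
  else S2 (nonlin2 (U1 l1) b phi chi) t.2.
have K1K : K1 <= K by rewrite /K; lra.
have K2K : K2 <= K by rewrite /K; lra.
have w_le1 t : w t <= 1.
  rewrite -expR0 ler_expR mulNr oppr_le0 mulr_ge0//; case: t.1; exact: ltW.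
have [|||z z' c Pz bz Pz' bz' c0 dz [i x]|z [Pz bz Fz]] :=
    @weighted_contraction R (bool * R)%type w P F r (fun t => expR_gt0 _) (ltW r0).
- by move=> i; split => // x; exact: cvg_cst.
- move=> z hz i; split.
    apply: continuous_uniform_limit => e e0; have [z' /(_ i) [cz' _] zz'] := hz e e0.
    exists (fun x => z' (i, x)) => // x; apply: (le_trans (zz' _)).
    by rewrite ler_piMr// ltW.
  move=> x; apply/eqP; rewrite -subr_eq0 -normr_le0; apply/ler_addgt0Pr => e e0.
  have [z' /(_ i) [_ ez'] zz'] := hz _ (divr_gt0 e0 (ltr0Sn R 1)).
  have -> : z (i, - x) - z (i, x) =
    (z (i, - x) - z' (i, - x)) - (z (i, x) - z' (i, x)) by rewrite ez'; ring.
  rewrite add0r; apply: (le_trans (ler_normB _ _)).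
  have := zz' (i, - x); have := zz' (i, x).
  have h t : e / 2 * w t <= e / 2 by rewrite ler_piMr// divr_ge0// ltW.
  have := h (i, x); have := h (i, - x); lra.
- move=> z Pz bz.
  have [[c1 e1] [c2 e2]] := (Pz true, Pz false).
  have bt : decay k1 r (fun x => z (true, x)) by move=> x; exact: bz.
  have bf : decay a r (fun x => z (false, x)) by move=> x; exact: bz.
  have [h1 _ h2 h3 _] := sol1 _ _ (src1 _ _ c1 c2 e1 e2 bt bf).
  have [h4 _ h5 h6 _] := sol2 _ _ (src2 _ _ c1 c2 e1 e2 bt bf).
  split.
    by case; split => //; rewrite /F /=; [exact: has_deriv_continuous h1|
      exact: has_deriv_continuous h4].
  have nn1 := decay_ge0 (nonlin1_decay (b := b) b_ge0 aa C_ge1 bU bV r1 bt bf).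
  have nn2 := decay_ge0 (nonlin2_decay (b := b) b_ge0 aa C_ge1 bU r1 bt bf).
  case=> [] [] x; rewrite /F /=.
    apply: (decayW (lexx _) _ h3); apply: le_trans bd1; exact: ler_wpM2r.
  apply: (decayW (lexx _) _ h6); apply: le_trans bd2; exact: ler_wpM2r.
- have [[c1 e1] [c2 e2]] := (Pz true, Pz false).
  have [[c1' e1'] [c2' e2']] := (Pz' true, Pz' false).
  have bt : decay k1 r (fun x => z (true, x)) by move=> y; exact: bz.
  have bf : decay a r (fun x => z (false, x)) by move=> y; exact: bz.
  have bt' : decay k1 r (fun x => z' (true, x)) by move=> y; exact: bz'.
  have bf' : decay a r (fun x => z' (false, x)) by move=> y; exact: bz'.
  have dt : decay k1 c (fun x => z (true, x) - z' (true, x)) by move=> y; exact: dz.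
  have df : decay a c (fun x => z (false, x) - z' (false, x)) by move=> y; exact: dz.
  have g1 := nonlin1_lipschitz b_ge0 aa C_ge1 bU bV r1 bt bf bt' bf' dt df.
  have g2 := nonlin2_lipschitz b_ge0 aa C_ge1 bU r1 bt bf bt' bf' dt df.
  have h1 := lip1 _ _ _ _ _ (src1 _ _ c1 c2 e1 e2 bt bf)
    (src1 _ _ c1' c2' e1' e2' bt' bf') g1.
  have h2 := lip2 _ _ _ _ _ (src2 _ _ c1 c2 e1 e2 bt bf)
    (src2 _ _ c1' c2' e1' e2' bt' bf') g2.
  have scl K' D : 0 < K' -> K' <= K -> 0 <= D -> K * D <= 2^-1 -> K' * (c * D) <= c / 2.
    move=> K'0 K'K D0 KD; rewrite mulrCA ler_wpM2l//; apply: le_trans KD.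
    exact: ler_wpM2r.
  case: i; rewrite /F /=.
    by apply: (decayW (lexx _) _ h1); apply: scl => //; nra.
  apply: (decayW (lexx _) _ h2); apply: scl => //.
  by rewrite addr_ge0 ?(ltW r0)// mulr_ge0//; lra.
have [[c1 e1] [c2 e2]] := (Pz true, Pz false).
have bt : decay k1 r (fun x => z (true, x)) by move=> x; exact: bz.
have bf : decay a r (fun x => z (false, x)) by move=> x; exact: bz.
have [h1 h1' h2 h3 h3'] := sol1 _ _ (src1 _ _ c1 c2 e1 e2 bt bf).
have [h4 h4' h5 h6 h6'] := sol2 _ _ (src2 _ _ c1 c2 e1 e2 bt bf).
set f1 := nonlin1 _ _ _ _ _ in h1 h1' h2 h3 h3'.
set f2 := nonlin2 _ _ _ _ in h4 h4' h5 h6 h6'.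
(* The fixed point equation identifies [S1 f1] with the component [phi] that enters its own source,
   so the linear equation solved by [S1] becomes the nonlinear one. *)
have E1 : S1 f1 = fun x => z (true, x) by apply/funext => x; rewrite -[in RHS]Fz.
have E2 : S2 f2 = fun x => z (false, x) by apply/funext => x; rewrite -[in RHS]Fz.
rewrite E1 in h1 h1'; rewrite E2 in h4 h4'.
have nn1 := decay_ge0 (nonlin1_decay (b := b) b_ge0 aa C_ge1 bU bV r1 bt bf).
have nn2 := decay_ge0 (nonlin2_decay (b := b) b_ge0 aa C_ge1 bU r1 bt bf).
exists (fun x => z (true, x)), (dS1 f1), (fun x => z (false, x)), (dS2 f2).
split; split => //; split => //.
- apply: (decayW (lexx _) _ h3'); apply: le_trans bd1; exact: ler_wpM2r.
- apply: (decayW (lexx _) _ h6'); apply: le_trans bd2; exact: ler_wpM2r.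
Qed.

End System.

(** * Integrability *)

Section Integration.
Context {R : realType}.
Local Notation mu := (@lebesgue_measure R).
Local Notation intg f := (mu.-integrable [set: R] (EFin \o f)).
Local Notation L2 f := (f \in Lfun mu 2%:E).
Implicit Types f g h : R -> R.

Lemma ae_mono (P Q : R -> Prop) : (forall x, P x -> Q x) ->
  {ae mu, forall x, P x} -> {ae mu, forall x, Q x}.
Proof. by move=> PQ; apply: filterS => //; exact: (ae_filter_ringOfSetsType mu). Qed.

Lemma ae_and (P Q : R -> Prop) : {ae mu, forall x, P x} ->
  {ae mu, forall x, Q x} -> {ae mu, forall x, P x /\ Q x}.
Proof.
move=> hP hQ; apply: filterI hP hQ; exact: (ae_filter_ringOfSetsType mu).
Qed.

Lemma integrable_measurable f : intg f -> measurable_fun setT f.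
Proof. by move=> /measurable_int /measurable_EFinP. Qed.

Lemma integrable_add f g : intg f -> intg g -> intg (fun x => f x + g x).
Proof. by move=> hf hg; have := integrableD measurableT hf hg. Qed.

Lemma integrable_sub f g : intg f -> intg g -> intg (fun x => f x - g x).
Proof. by move=> hf hg; have := integrableB measurableT hf hg. Qed.

Lemma integrable_scale c f : intg f -> intg (fun x => c * f x).
Proof. by move=> hf; have := integrableZl measurableT c hf. Qed.

Lemma ae_le_integrable f g : measurable_fun setT f -> intg g ->
  {ae mu, forall x, `|f x| <= g x} -> intg f.
Proof.
move=> mf ig fg; have mg := integrable_measurable ig.
apply/integrableP; split; first exact/measurable_EFinP.
have ig' : intg (fun x => `|g x|) by exact: integrable_norm.
apply: le_lt_trans (integrable_lty measurableT ig').
apply: ae_ge0_le_integral => //=.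
- by apply/measurable_EFinP; exact: measurableT_comp.
- by apply/measurable_EFinP; exact: measurableT_comp.
- by apply: ae_mono fg => x h _; rewrite lee_fin (le_trans h)// ler_norm.
Qed.

Lemma ae_eq_Rint f g : measurable_fun setT f -> measurable_fun setT g ->
  {ae mu, forall x, f x = g x} -> \int[mu]_x f x = \int[mu]_x g x.
Proof.
move=> mf mg fg; congr fine; apply: ae_eq_integral => //.
- exact/measurable_EFinP.
- exact/measurable_EFinP.
- by apply: ae_mono fg => x e _ /=; rewrite e.
Qed.

Lemma ae_le_Rint f g : measurable_fun setT f -> intg g ->
  {ae mu, forall x, `|f x| <= g x} -> `|\int[mu]_x f x| <= \int[mu]_x g x.
Proof.
move=> mf ig fg; have if_ := ae_le_integrable mf ig fg.
apply: (le_trans (le_normr_Rintegral measurableT if_)).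
have ig' : intg (fun x => `|g x|) by exact: integrable_norm.
have mg := integrable_measurable ig.
have -> : \int[mu]_x g x = \int[mu]_x `|g x|.
  apply: ae_eq_Rint => //; first exact: measurableT_comp.
  by apply: ae_mono fg => x h; rewrite ger0_norm// (le_trans _ h).
rewrite /Rintegral fine_le//.
- exact: (integrable_fin_num measurableT (integrable_norm if_)).
- exact: (integrable_fin_num measurableT ig').
- apply: ae_ge0_le_integral => //=.
  + by apply/measurable_EFinP; exact: measurableT_comp.
  + by apply/measurable_EFinP; exact: measurableT_comp.
  + by apply: ae_mono fg => x h _; rewrite lee_fin (le_trans h)// ler_norm.
Qed.

Lemma Rdominated_convergence (f_ : nat -> R -> R) f g :
  (forall n, measurable_fun setT (f_ n)) -> measurable_fun setT f ->
  (forall x, f_ n x @[n --> \oo] --> f x) -> intg g ->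
  (forall n x, `|f_ n x| <= g x) ->
  intg f /\ \int[mu]_x f_ n x @[n --> \oo] --> \int[mu]_x f x.
Proof.
move=> mf_ mf cf ig fg.
have [||||h1 _ h2] := @dominated_convergence _ _ _ mu setT measurableT
  (fun n x => (f_ n x)%:E) (EFin \o f) (EFin \o g) _ _ _ ig.
- by move=> n; apply/measurable_EFinP; exact: mf_.
- exact/measurable_EFinP.
- by apply: aeW => x _; apply: cvg_EFin; [exact: nearW|exact: cf].
- by apply: aeW => x n _; rewrite lee_fin.
split => //; apply: fine_cvg.
by rewrite fineK//; exact: (integrable_fin_num measurableT h1).
Qed.

Lemma L2P f : L2 f <-> measurable_fun setT f /\ intg (fun x => f x ^+ 2).
Proof.
split=> [h|[mf hf]].
  by split; [move: h => /andP[]; rewrite inE|exact: Lfun2_integrable_sqr].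
rewrite inE; apply/andP; split; rewrite inE//=.
rewrite /finite_norm unlock poweR_lty//.
apply: le_lt_trans (integrable_lty measurableT hf).
apply: ge0_le_integral => //=.
- apply/measurable_EFinP; apply/(@measurableT_comp _ _ _ _ _ _ (fun x : R => x `^ 2)) => //.
  exact: measurableT_comp.
- by apply/measurable_EFinP; exact: measurable_funX.
- by move=> x _; rewrite lee_fin powR_mulrn// real_normK ?num_real.
Qed.

Lemma L2_measurable f : L2 f -> measurable_fun setT f.
Proof. by move=> /L2P[]. Qed.

Lemma L2_mul f g : L2 f -> L2 g -> intg (fun x => f x * g x).
Proof. by move=> hf hg; have /Lfun1_integrable := Lfun2_mul_Lfun1 hf hg. Qed.

Lemma L2_add f g : L2 f -> L2 g -> L2 (fun x => f x + g x).
Proof.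
move=> hf hg; apply/L2P; split.
  by apply: measurable_funD; exact: L2_measurable.
have := integrable_add (integrable_add (L2_mul hf hf) (integrable_scale 2 (L2_mul hf hg)))
  (L2_mul hg hg).
by congr (integrable _ _ _); apply/funext => x /=; congr EFin; ring.
Qed.

Lemma L2_scale c f : L2 f -> L2 (fun x => c * f x).
Proof.
move=> /[dup] hf /L2P[mf if2]; apply/L2P; split; first exact: measurable_funM.
have := integrable_scale (c ^+ 2) if2.
by congr (integrable _ _ _); apply/funext => x /=; congr EFin; ring.
Qed.

Lemma L2_sub f g : L2 f -> L2 g -> L2 (fun x => f x - g x).
Proof.
move=> hf hg.
rewrite (_ : (fun x => f x - g x) = (fun x => f x + -1 * g x)).
  by apply: L2_add => //; exact: L2_scale.
by apply/funext => x; rewrite mulN1r.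
Qed.

Lemma L2_norm f : L2 f -> L2 (fun x => `|f x|).
Proof.
move=> /L2P[mf if2]; apply/L2P; split; first exact: measurableT_comp.
by under eq_fun do rewrite real_normK ?num_real//.
Qed.

Lemma ae_bounded_mul_L2 f g (C : R) : measurable_fun setT f ->
  {ae mu, forall x, `|f x| <= C} -> L2 g -> L2 (fun x => f x * g x).
Proof.
move=> mf bf /[dup] Lg /L2P[mg ig]; apply/L2P; split; first exact: measurable_funM.
apply: ae_le_integrable (integrable_scale (C ^+ 2) ig) _.
  by apply: measurable_funX; exact: measurable_funM.
apply: ae_mono bf => x fx.
rewrite normrX normrM exprMn (real_normK (num_real (g x))).
by rewrite ler_wpM2r ?sqr_ge0// ler_pXn2r ?nnegrE// (le_trans _ fx).
Qed.

Lemma integrable_exp_norm (a : R) : 0 < a -> intg (fun x => expR (- a * `|x|)).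
Proof.
move=> a0.
have ce : continuous (fun x : R => expR (- a * `|x|)).
  move=> x; apply: (@continuous_comp _ _ _ (fun x : R => - a * `|x|) expR).
    by apply: cvgMr; exact: norm_continuous.
  exact: continuous_expR.
have ce' : continuous (fun x : R => expR (- a * x)).
  exact: has_deriv_continuous (has_deriv_expZ (- a)).
apply/integrableP; split; first by apply/measurable_EFinP; exact: continuous_measurable_fun.
under eq_integral do rewrite /= ger0_norm ?expR_ge0//.
rewrite ge0_symfun_integralT//; last by move=> x /=; rewrite normrN.
rewrite -set_itvcy (_ : (\int[_]_(x in _) _ = (a^-1)%:E)%E) ?ltry//.
under eq_integral => x.
  rewrite inE /= in_itv /= andbT => x0; rewrite (ger0_norm x0); over.
have hF := has_derivZ (- a^-1) (has_deriv_expZ (- a)).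
rewrite (@ge0_continuous_FTC2y R _ (fun x => - a^-1 * expR (- a * x)) 0 0) //.
- by rewrite mulr0 expR0 mulr1 -EFinB opprK add0r.
- exact: continuous_subspaceT.
- rewrite -[X in _ --> X](mulr0 (- a^-1)); apply: cvgMr.
  under eq_fun do rewrite mulNr.
  apply: (@cvg_comp _ _ _ (fun x => a * x) (fun x => expR (- x)) _ (pinfty_nbhs R)).
    exact: gt0_cvgMry.
  exact: cvgr_expR.
- by apply: cvg_at_right_filter; exact: (has_deriv_continuous hF).
- by move=> x _; rewrite (has_deriv_derive1 x hF); field; rewrite gt_eqF.
Qed.

Lemma decay_integrable a M f : 0 < a -> continuous f -> decay a M f -> intg f.
Proof.
move=> a0 cf bf.
apply: ae_le_integrable (integrable_scale M (integrable_exp_norm a0)) _.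
  exact: continuous_measurable_fun.
exact: aeW.
Qed.

Lemma decay_L2 a M f : 0 < a -> continuous f -> decay a M f -> L2 f.
Proof.
move=> a0 cf bf; apply/L2P; split; first exact: continuous_measurable_fun.
apply: (@decay_integrable (a + a) (M * M)); first by rewrite addr_gt0.
- exact: continuous_mul.
- exact: decayM.
Qed.

Lemma decay_sqr_integral_le a M f : 0 < a -> continuous f -> decay a M f ->
  \int[mu]_x (f x ^+ 2) <= M ^+ 2 * \int[mu]_x expR (- (a + a) * `|x|).
Proof.
move=> a0 cf bf; have aa : 0 < a + a by rewrite addr_gt0.
rewrite -RintegralZl//; last exact: integrable_exp_norm.
apply: le_Rintegral => //.
- by have /L2P[] := decay_L2 a0 cf bf.
- exact: (integrable_scale _ (integrable_exp_norm aa)).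
- by move=> x _; apply: le_trans (decayM bf bf x); rewrite -expr2 ler_norm.
Qed.

End Integration.

(** * Test functions *)

Section TestFunctions.
Context {R : realType}.
Local Notation mu := (@lebesgue_measure R).
Local Notation intg f := (mu.-integrable [set: R] (EFin \o f)).
Local Notation L2 f := (f \in Lfun mu 2%:E).
Implicit Types f g h p phi : R -> R.

Lemma continuous_pos_part : continuous (fun t : R => (t + `|t|) / 2).
Proof.
move=> t; apply: cvgMl; apply: cvgD; first exact: cvg_id.
exact: norm_continuous.
Qed.

(** The primitive of the positive part, that is half its square: it is C^1, which suffices for C^1
    test functions. *)
Lemma smooth_pos_part : exists S : R -> R,
  [/\ has_deriv S (fun t => (t + `|t|) / 2), forall t, t <= 0 -> S t = 0 &
      forall t, 0 < t -> 0 < S t].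
Proof.
have [S [S0 hS]] := primitive_exists continuous_pos_part.
exists S; split => //.
- move=> t t0; apply/eqP; rewrite -normr_le0.
  have := has_deriv_abs_le hS (has_deriv_cst 0) t0.
  rewrite S0 sub0r normrN subrr; apply => z /andP[_ z0].
  by rewrite (ler0_norm z0) subrr mul0r normr0.
- move=> t t0.
  have := has_deriv_le (has_derivZ 2^-1 (has_deriv_sqr (@has_deriv_id R))) hS (ltW t0).
  rewrite S0 subr0 expr0n /= mulr0 subr0 => h.
  have : 2^-1 * t ^+ 2 <= S t.
    by apply: h => z /andP[z0 _]; rewrite (ger0_norm z0) /id; lra.
  by apply: lt_le_trans; rewrite mulr_gt0// exprn_gt0.
Qed.

Lemma C1c_intro phi dphi (X : R) : has_deriv phi dphi -> continuous dphi ->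
  (forall x, X <= `|x| -> phi x = 0) -> C1c phi.
Proof.
move=> h c v; split.
- by move=> x; case: (h x).
- rewrite (_ : derive1 phi = dphi)//; apply/funext => x; exact: has_deriv_derive1.
- apply: (@subclosed_compact _ _ `[- `|X|, `|X|]); first exact: closed_closure.
    exact: segment_compact.
  apply: (@subset_trans _ (closure `[- `|X|, `|X|])); last first.
    by rewrite -(closure_id _).1//; exact: interval_closed.
  apply: closure_subset => x /= px; rewrite in_itv /= -ler_norml.
  have [//|xX] := leP `|x| `|X|; move: px; rewrite v ?eqxx//.
  exact: le_trans (ler_norm _) (ltW xX).
Qed.

Lemma C1cE phi : C1c phi -> [/\ has_deriv phi (derive1 phi),
  continuous (derive1 phi) & exists X, forall x, X <= `|x| -> phi x = 0].
Proof.
move=> [h c k]; split => //.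
  by move=> x; rewrite derive1E; exact/derivableP.
have [M [_ hM]] := compact_bounded k.
exists (M + 2) => x xM; apply/eqP; apply: contraT => px.
have : `|x| <= M + 1.
  apply: (hM (M + 1)); first by rewrite ltrDl.
  exact: subset_closure.
by lra.
Qed.

Lemma deriv_vanishes phi dphi (X : R) : has_deriv phi dphi ->
  (forall x, X <= `|x| -> phi x = 0) -> forall x, X < `|x| -> dphi x = 0.
Proof.
move=> h v x xX.
have h0 : is_derive x (1 : R) phi 0.
  apply: (near_eq_is_derive _ (has_deriv_cst 0 x)).
  near=> y; rewrite v//; near: y.
  have /cvgrPdist_lt /(_ (`|x| - X)) := @norm_continuous _ R x.
  rewrite subr_gt0 => /(_ xX); apply: filterS => y /=.
  by rewrite ltr_norml => /andP[_]; lra.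
by rewrite -(@derive_val _ _ _ _ _ _ _ (h x)) (@derive_val _ _ _ _ _ _ _ h0).
Unshelve. all: by end_near. Qed.

(** Lets compactly supported functions enter the estimates for decaying ones, at any nonnegative
    rate. *)
Lemma compact_support_decay (a X : R) phi : 0 <= a -> continuous phi ->
  (forall x, X < `|x| -> phi x = 0) -> exists M, decay a M phi.
Proof.
move=> a0 cp v.
have XX : - `|X| <= `|X| by rewrite ge0_cp.
have cn : {within `[- `|X|, `|X|], continuous (fun x => `|phi x|)}.
  apply: continuous_subspaceT => x.
  by apply: continuous_comp; [exact: cp|exact: norm_continuous].
have [c _ hc] := EVT_max XX cn.
exists (`|phi c| * expR (a * `|X|)) => x.
have [xX|xX] := leP `|x| `|X|; last first.
  by rewrite v ?normr0 ?mulr_ge0 ?expR_ge0// (le_lt_trans (ler_norm _) xX).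
rewrite -mulrA -expRD; apply: (@le_trans _ _ `|phi c|).
  by apply: hc; rewrite in_itv /= -ler_norml.
rewrite ler_peMr// -[1]expR0 ler_expR.
have : a * `|x| <= a * `|X| by rewrite ler_wpM2l.
lra.
Qed.

(** Fundamental theorem of calculus on [- n - 1, n + 1]: dominated convergence handles the integral
    and the decay of [P] kills the boundary values. *)
Lemma integral_deriv0 P dP (a M : R) : 0 < a -> has_deriv P dP -> continuous dP ->
  intg dP -> decay a M P -> \int[mu]_x dP x = 0.
Proof.
move=> a0 hP cdP idP bP.
have M0 := decay_ge0 bP.
pose I (n : nat) : set R := `[- n.+1%:R, n.+1%:R]%classic.
have mI n : measurable (I n) by exact: measurable_itv.
have [|||||_ lim] := @Rdominated_convergence R (fun n => dP \_ (I n)) dP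
    (fun x => `|dP x|).
- move=> n; apply/(measurable_restrictT _ _).1 => //.
  by apply: measurable_funTS; exact: continuous_measurable_fun.
- exact: continuous_measurable_fun.
- move=> x; apply: cvg_near_cst; near=> n.
  rewrite patchE mem_set// /I /= in_itv /= -ler_norml.
  apply: (le_trans (ltW (truncnS_gt _))); rewrite ler_nat ltnS.
  by near: n; exact: nbhs_infty_ge.
- exact: integrable_norm.
- by move=> n x; rewrite patchE; case: ifP => // _; rewrite normr0.
apply: (cvg_unique _ lim) => //.
have hI n : \int[mu]_x (dP \_ (I n)) x = P n.+1%:R - P (- n.+1%:R).
  rewrite -Rintegral_mkcond /Rintegral (@continuous_FTC2 _ _ P)//.
  - by rewrite -subr_gt0 opprK addr_gt0.
  - exact: continuous_subspaceT.
  - have cP := has_deriv_continuous hP; split.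
    + by move=> x _; case: (hP x).
    + by apply: cvg_at_right_filter; exact: cP.
    + by apply: cvg_at_left_filter; exact: cP.
  - by move=> x _; exact: has_deriv_derive1.
apply/norm_cvg0P.
apply: (@squeeze_cvgr _ _ _ _ (cst 0) (fun n => 2 * M / a * harmonic n)).
- apply: nearW => n; rewrite normr_ge0 /= hI; apply: (le_trans (ler_normB _ _)).
  have := bP n.+1%:R; have := bP (- n.+1%:R); rewrite normrN (ger0_norm (ler0n R n.+1)).
  have n0 : 0 < n.+1%:R :> R by [].
  have : expR (- a * n.+1%:R) <= a^-1 * n.+1%:R^-1.
    rewrite mulNr expRN -invfM lef_pV2 ?posrE ?expR_gt0 ?mulr_gt0//.
    by apply: le_trans (expR_ge1Dx _); rewrite lerDr.
  move=> /(ler_wpM2l M0) h h1 h2.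
  rewrite /= (_ : 2 * M / a / n.+1%:R = M * (a^-1 / n.+1%:R) + M * (a^-1 / n.+1%:R)); last by ring.
  by apply: lerD; [exact: le_trans h2 h|exact: le_trans h1 h].
- exact: cvg_cst.
- rewrite -[X in _ --> X](mulr0 (2 * M / a)); apply: cvgMr; exact: cvg_harmonic.
Unshelve. all: by end_near. Qed.

Lemma decay_weak_derivative p dp (a M : R) : 0 < a -> has_deriv p dp -> continuous dp ->
  decay a M p -> decay a M dp -> weak_derivative p dp.
Proof.
move=> a0 hp cdp bp bdp phi /C1cE[hphi cphi' [X vphi]].
have cp := has_deriv_continuous hp; have cphi := has_deriv_continuous hphi.
have vphi' x : X < `|x| -> phi x = 0 by move=> /ltW; exact: vphi.
have [B1 b1] := compact_support_decay (ltW a0) cphi vphi'.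
have [B2 b2] := compact_support_decay (ltW a0) cphi' (deriv_vanishes hphi vphi).
have aa : 0 < a + a by rewrite addr_gt0.
have i1 : intg (fun x => p x * derive1 phi x).
  exact: decay_integrable aa (continuous_mul cp cphi') (decayM bp b2).
have i2 : intg (fun x => dp x * phi x).
  exact: decay_integrable aa (continuous_mul cdp cphi) (decayM bdp b1).
apply/eqP; rewrite -subr_eq0 opprK addrC; apply/eqP.
rewrite -RintegralD//.
apply: (@integral_deriv0 (fun x => p x * phi x) _ (a + a) (M * B1)) => //.
- exact: has_derivM.
- by apply: continuous_add; exact: continuous_mul.
- exact: integrable_add.
- exact: decayM.
Qed.

Lemma decay_W12 p dp (a M : R) : 0 < a -> has_deriv p dp -> continuous dp ->
  decay a M p -> decay a M dp -> W12 p.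
Proof.
move=> a0 hp cdp bp bdp; split.
  exact: decay_L2 (has_deriv_continuous hp) bp.
exists dp; first exact: decay_L2 bdp.
exact: decay_weak_derivative bdp.
Qed.

Definition C1 f := exists2 df, has_deriv f df & continuous df.

Lemma C1_cst (c : R) : C1 (fun=> c).
Proof. by exists (fun=> 0); [exact: has_deriv_cst|move=> x; exact: cvg_cst]. Qed.

Lemma C1_id : C1 id.
Proof. by exists (fun=> 1); [exact: has_deriv_id|move=> x; exact: cvg_cst]. Qed.

Lemma C1D f g : C1 f -> C1 g -> C1 (fun x => f x + g x).
Proof.
move=> [df hf cf] [dg hg cg].
by exists (fun x => df x + dg x); [exact: has_derivD|exact: continuous_add].
Qed.

Lemma C1M f g : C1 f -> C1 g -> C1 (fun x => f x * g x).
Proof.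
move=> [df hf cf] [dg hg cg].
exists (fun x => df x * g x + f x * dg x); first exact: has_derivM.
have := has_deriv_continuous hf; have := has_deriv_continuous hg => ? ?.
by apply: continuous_add; exact: continuous_mul.
Qed.

Lemma C1B f g : C1 f -> C1 g -> C1 (fun x => f x - g x).
Proof.
move=> hf hg; rewrite (_ : (fun x => f x - g x) = (fun x => f x + -1 * g x)).
  by apply: C1D => //; apply: C1M => //; exact: C1_cst.
by apply/funext => x; rewrite mulN1r.
Qed.

Lemma C1_comp f g : C1 f -> C1 g -> C1 (fun x => f (g x)).
Proof.
move=> [df hf cf] [dg hg cg].
exists (fun x => df (g x) * dg x); first exact: has_deriv_comp.
apply: continuous_mul => // x.
by apply: continuous_comp; [exact: (has_deriv_continuous hg)|exact: cf].
Qed.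

Lemma C1V f : (forall x, f x != 0) -> C1 f -> C1 (fun x => (f x)^-1).
Proof.
move=> f0 [df hf cf]; have h := has_deriv_inv f0 hf.
exists (fun x => -1 * df x * ((f x)^-1 * (f x)^-1)).
  by apply: (has_deriv_eq h) => x; rewrite mulN1r expr2 invfM.
have cV := has_deriv_continuous h.
by apply: continuous_mul; [exact: continuous_scale|exact: continuous_mul].
Qed.

(** With [S] from [smooth_pos_part], eta = S(4 - x^2) / (S(4 - x^2) + S(x^2 - 1)); the denominator
    is positive because |x| < 2 and |x| > 1 cover the line. *)
Lemma cutoff_exists : exists eta deta : R -> R, exists B : R,
  [/\ has_deriv eta deta, continuous deta, forall x, `|x| <= 1 -> eta x = 1,
      forall x, 2 <= `|x| -> eta x = 0 &
      (forall x, `|eta x| <= 1) /\ (forall x, `|deta x| <= B)].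
Proof.
have [S [hS Sle0 Sgt0]] := smooth_pos_part.
have Sge0 t : 0 <= S t by have [/Sle0->|/Sgt0/ltW] := leP t 0.
have C1S : C1 S by exists (fun t => (t + `|t|) / 2) => //; exact: continuous_pos_part.
pose A x := S (4 - x * x); pose E x := S (x * x - 1).
pose D x := A x + E x.
have D0 x : 0 < D x.
  have [h|h] := leP (4 - x * x) 0.
    by apply: ltr_wpDl; [exact: Sge0|apply: Sgt0; lra].
  by apply: ltr_wpDr; [exact: Sge0|exact: Sgt0].
have D0' x : D x != 0 by rewrite gt_eqF.
have C1A : C1 A.
  by apply: (C1_comp C1S); apply: C1B; [exact: C1_cst|exact: C1M C1_id C1_id].
have C1E : C1 E.
  by apply: (C1_comp C1S); apply: C1B; [exact: C1M C1_id C1_id|exact: C1_cst].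
pose eta x := A x * (D x)^-1.
have [deta heta cdeta] : C1 eta by apply: C1M => //; apply: C1V => //; exact: C1D.
have sq_norm (x : R) : x * x = `|x| * `|x| by rewrite -expr2 -[LHS]real_normK ?num_real.
have v x : 2 <= `|x| -> eta x = 0.
  by move=> x2; rewrite /eta /A Sle0 ?mul0r// sq_norm; nra.
have vd := deriv_vanishes heta v.
have [B bB] := compact_support_decay (lexx 0) cdeta vd.
exists eta, deta, B; split => //.
- move=> x x1; rewrite /eta /D /E Sle0 ?addr0 ?mulfV//.
    rewrite gt_eqF// Sgt0// sq_norm.
    by have := normr_ge0 x; nra.
  by rewrite sq_norm; have := normr_ge0 x; nra.
- split=> x; last by have := bB x; rewrite oppr0 mul0r expR0 mulr1.
  have A0 : 0 <= A x by exact: Sge0.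
  rewrite /eta ger0_norm ?divr_ge0 ?(ltW (D0 x))//.
  by rewrite ler_pdivrMr// mul1r /D lerDl; exact: Sge0.
Qed.

(** Take T(x) = S(r^2 - (x - c)^2), positive exactly on the ball; then 1 - 1 / (1 + (n + 1) T) tends
    to 1 where T > 0 and is 0 elsewhere. *)
Lemma bump_exists (c r : R) : 0 < r -> exists b : nat -> R -> R,
  [/\ forall n, C1c (b n), forall n x, 0 <= b n x <= \1_(ball c r) x &
      forall x, b n x @[n --> \oo] --> (\1_(ball c r) x : R)].
Proof.
move=> r0.
have [S [hS Sle0 Sgt0]] := smooth_pos_part.
have Sge0 t : 0 <= S t by have [/Sle0->|/Sgt0/ltW] := leP t 0.
have C1S : C1 S by exists (fun t => (t + `|t|) / 2) => //; exact: continuous_pos_part.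
pose T (x : R) := S (r * r - (x - c) * (x - c)).
have C1T : C1 T.
  have h : C1 (fun x => x - c) by apply: C1B; [exact: C1_id|exact: C1_cst].
  by apply: (C1_comp C1S); apply: C1B; [exact: C1_cst|exact: C1M].
have T0 x : 0 <= T x by exact: Sge0.
have sq_norm (x : R) : x * x = `|x| * `|x| by rewrite -expr2 -[LHS]real_normK ?num_real.
have Tout x : ~ ball c r x -> T x = 0.
  move=> /negP; rewrite /ball /= -leNgt distrC => h; apply: Sle0.
  by rewrite [X in _ - X]sq_norm; nra.
have Tin x : ball c r x -> 0 < T x.
  rewrite /ball /= distrC => h; apply: Sgt0.
  by rewrite [X in _ - X]sq_norm; have := normr_ge0 (x - c); nra.
pose b (n : nat) (x : R) := 1 - (1 + n.+1%:R * T x)^-1.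
have D1 n x : 1 <= 1 + n.+1%:R * T x by rewrite lerDl mulr_ge0.
have Dgt0 n x : 0 < 1 + n.+1%:R * T x by apply: lt_le_trans (D1 n x).
have D0 n x : 1 + n.+1%:R * T x != 0 by rewrite gt_eqF.
exists b; split.
- move=> n.
  have [db hb cdb] : C1 (b n).
    apply: C1B; first exact: C1_cst.
    apply: C1V => //; apply: C1D; first exact: C1_cst.
    by apply: C1M => //; exact: C1_cst.
  apply: (C1c_intro (X := `|c| + r) hb cdb) => x xr.
  rewrite /b Tout ?mulr0 ?addr0 ?invr1 ?subrr//.
  rewrite /ball /= => h.
  have := ler_distD c x 0; rewrite !subr0 [`|x - c|]distrC; lra.
- move=> n x; rewrite /b subr_ge0 invf_le1// D1 /= indicE.
  have [xb|xb] := pselect (ball c r x).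
    by rewrite mem_set// lerBlDr lerDl invr_ge0 ltW.
  by rewrite memNset// Tout// mulr0 addr0 invr1 subrr.
- move=> x; rewrite indicE; have [xb|xb] := pselect (ball c r x); last first.
    rewrite memNset//; apply: cvg_near_cst; apply: nearW => n.
    by rewrite /b Tout// mulr0 addr0 invr1 subrr.
  rewrite mem_set// -[X in _ --> X]subr0; apply: cvgB; first exact: cvg_cst.
  have Tx := Tin _ xb.
  apply: (@squeeze_cvgr _ _ _ _ (cst 0) (fun n => (T x)^-1 * harmonic n)).
  + apply: nearW => n; rewrite invr_ge0 (ltW (Dgt0 n x)) /= -invfM.
    rewrite lef_pV2 ?posrE ?mulr_gt0//.
    by rewrite mulrC lerDr.
  + exact: cvg_cst.
  + rewrite -[X in _ --> X](mulr0 (T x)^-1); apply: cvgMr; exact: cvg_harmonic.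
Qed.

End TestFunctions.

(** * Functions with weak derivatives *)

Section Sobolev.
Context {R : realType}.
Local Notation mu := (@lebesgue_measure R).
Local Notation intg f := (mu.-integrable [set: R] (EFin \o f)).
Local Notation L2 f := (f \in Lfun mu 2%:E).
Implicit Types f g h p phi : R -> R.

(** For |x| <= X, |h| is at most e^X |h| e^{- |x|}, a product of two square integrable functions. *)
Lemma L2_integrable_bounded (K : set R) (X : R) h : measurable K ->
  (forall x, K x -> `|x| <= X) -> L2 h -> mu.-integrable K (EFin \o h).
Proof.
move=> mK bK Lh.
have ce : continuous (fun x : R => expR (- 1 * `|x|)).
  move=> x; apply: (@continuous_comp _ _ _ (fun x : R => - 1 * `|x|) expR).
    by apply: cvgMr; exact: norm_continuous.
  exact: continuous_expR.
have de : decay 1 1 (fun x : R => expR (- 1 * `|x|)).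
  by move=> x; rewrite ger0_norm ?expR_ge0// mul1r.
have Le := decay_L2 ltr01 ce de.
have i1 := integrable_scale (expR X) (L2_mul Lh Le).
have i2 : mu.-integrable K (EFin \o (fun x : R => expR X * (h x * expR (- 1 * `|x|)))).
  by apply: integrableS i1.
apply: le_integrable i2 => //.
  by apply/measurable_EFinP; apply: measurable_funTS; exact: L2_measurable.
move=> x Kx /=; rewrite lee_fin !normrM mulrCA !(ger0_norm (expR_ge0 _)) -expRD.
by rewrite ler_peMr// -{1}expR0 ler_expR mulN1r subr_ge0 bK.
Qed.

Lemma L2_locally_integrable h : L2 h -> locally_integrable setT h.
Proof.
move=> Lh; split; [exact: L2_measurable|exact: openT|move=> K _ cK].
have mK := compact_measurable cK.
have [M [_ hM]] := compact_bounded cK.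
have bK x : K x -> `|x| <= M + 1 by apply: hM; rewrite ltrDl.
by have /integrableP[_] := L2_integrable_bounded mK bK Lh.
Qed.

Lemma ball_bounded (c r x : R) : ball c r x -> `|x| <= `|c| + r.
Proof.
rewrite /ball /= => h; have := ler_distD c x 0.
rewrite !subr0 distrC; lra.
Qed.

(** By Lebesgue differentiation almost every value of [h] is a limit of averages over small balls; 2
    r is the length of the ball. *)
Lemma ae_bound_of_averages h (C : R) : L2 h ->
  (forall c r : R, 0 < r <= 1 -> `|\int[mu]_(x in ball c r) h x| <= 2 * r * C) ->
  {ae mu, forall x, `|h x| <= C}.
Proof.
move=> Lh avg.
have := lebesgue_differentiation (L2_locally_integrable Lh).
apply: ae_mono => x hx; apply/ler_addgt0Pr => e e0.
have : \forall r \near 0^'+, (davg h x r < e%:E)%E.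
  have lt_e : nbhs (0 : \bar R)%E [set y | (y < e%:E)%E].
    by apply: open_nbhs_nbhs; split; [exact: open_ereal_lt_ereal|rewrite /= lte_fin].
  exact: (hx _ lt_e).
move=> hlt.
have [r [rlt [r0 r1]]] : exists r, (davg h x r < e%:E)%E /\ (0 < r /\ r <= 1).
  near ((0 : R)^'+) => r; exists r; split; first by near: r.
  by split; near: r; [exact: nbhs_right_gt|exact: nbhs_right_le].
have mB : @measurable _ (measurableTypeR R) (ball x r) by exact: measurable_ball.
have iB := L2_integrable_bounded mB (fun y => @ball_bounded x r y) Lh.
have muB : mu (ball x r) = (r *+ 2)%:E by rewrite lebesgue_measure_ball// ltW.
have ic : mu.-integrable (ball x r) (EFin \o (cst (h x))).
  apply/integrableP; split; first exact/measurable_EFinP/measurable_cst.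
  rewrite (_ : (\int[mu]_(y in ball x r) _)%E = (`|h x|%:E * mu (ball x r))%E).
    by rewrite muB -EFinM ltry.
  by rewrite -integral_cst.
have iD : mu.-integrable (ball x r) (EFin \o (fun y => h y - h x)).
  by have := integrableB mB iB ic.
have i2 : 0 < r *+ 2 by rewrite mulrn_wgt0.
have dE : davg h x r = ((r *+ 2)^-1 * \int[mu]_(y in ball x r) `|h y - h x|)%:E.
  rewrite /davg /iavg muB inver gt_eqF// EFinM; congr (_ * _)%E.
  rewrite /Rintegral fineK//.
  exact: (integrable_fin_num mB (integrable_norm iD)).
move: rlt; rewrite dE lte_fin mulrC ltr_pdivrMr// => rlt.
have le1 := le_normr_Rintegral mB iD.
have eqI : \int[mu]_(y in ball x r) (h y - h x) =
    \int[mu]_(y in ball x r) h y - h x * (r *+ 2).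
  by rewrite RintegralB// Rintegral_cst//; congr (_ - h x * _); exact: (congr1 fine muB).
have := avg x r; rewrite r0 r1 => /(_ isT) le2.
rewrite eqI in le1.
have : `|h x| * (r *+ 2) <= 2 * r * C + e * (r *+ 2).
  rewrite -[r *+ 2 in leLHS](ger0_norm (ltW i2)) -normrM.
  have -> : h x * (r *+ 2) = \int[mu]_(y in ball x r) h y -
    (\int[mu]_(y in ball x r) h y - h x * (r *+ 2)) by ring.
  apply: (le_trans (ler_normB _ _)); apply: lerD => //.
  exact: (le_trans le1 (ltW rlt)).
have -> : 2 * r * C + e * (r *+ 2) = (C + e) * (r *+ 2) by ring.
by rewrite ler_pM2r.
Unshelve. all: by end_near. Qed.

Lemma C1c_L2 phi : C1c phi -> L2 phi /\ L2 (derive1 phi).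
Proof.
move=> /C1cE[hphi cphi' [X vphi]].
have vphi' x : X < `|x| -> phi x = 0 by move=> /ltW; exact: vphi.
have [B1 b1] := compact_support_decay (@ler01 R) (has_deriv_continuous hphi) vphi'.
have [B2 b2] := compact_support_decay (@ler01 R) cphi' (deriv_vanishes hphi vphi).
split; [exact: decay_L2 ltr01 (has_deriv_continuous hphi) b1|exact: decay_L2 ltr01 cphi' b2].
Qed.

Lemma integral_bump_limit h (c r : R) (b : nat -> R -> R) : L2 h ->
  (forall n, C1c (b n)) -> (forall n x, 0 <= b n x <= \1_(ball c r) x) ->
  (forall x, b n x @[n --> \oo] --> (\1_(ball c r) x : R)) ->
  \int[mu]_x (h x * b n x) @[n --> \oo] --> \int[mu]_(x in ball c r) h x.
Proof.
move=> Lh cb bb lb.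
have mB : @measurable _ (measurableTypeR R) (ball c r) by exact: measurable_ball.
have mh := L2_measurable Lh.
have mind : measurable_fun setT (\1_(ball c r) : R -> R) by exact: measurable_indic.
rewrite Rintegral_mkcond patch_indic.
have ig : intg (fun x => `|h x * \1_(ball c r) x|).
  apply: integrable_norm.
  have := L2_integrable_bounded mB (fun y => @ball_bounded c r y) Lh.
  by move=> /(integrable_mkcond _ mB).1; rewrite restrict_EFin patch_indic.
have [//||||_ //] := @Rdominated_convergence R (fun n x => h x * b n x)
  (fun x => h x * \1_(ball c r) x) _ _ _ _ ig.
- move=> n; apply: measurable_funM => //.
  by have [/L2_measurable] := C1c_L2 (cb n).
- exact: measurable_funM.
- by move=> x; apply: cvgMr; exact: lb.
- move=> n x; rewrite !normrM ler_wpM2l//.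
  by have /andP[b0 b1] := bb n x; rewrite !ger0_norm// (le_trans b0).
Qed.

(** Tested against bumps, [g1 - g2] has zero integral over every ball, so [ae_bound_of_averages]
    applies with bound 0. *)
Lemma weak_derivative_unique u g1 g2 : L2 g1 -> L2 g2 ->
  weak_derivative u g1 -> weak_derivative u g2 -> {ae mu, forall x, g1 x = g2 x}.
Proof.
move=> L1 L2' w1 w2.
have L12 := L2_sub L1 L2'.
have /(ae_bound_of_averages L12) : forall c r : R, 0 < r <= 1 ->
    `|\int[mu]_(x in ball c r) (g1 x - g2 x)| <= 2 * r * 0.
  move=> c r /andP[r0 _]; have [b [cb bb lb]] := bump_exists c r0.
  have := integral_bump_limit L12 cb bb lb.
  have -> : (fun n => \int[mu]_x ((g1 x - g2 x) * b n x)) = (fun=> 0).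
    apply/funext => n; have [Lb _] := C1c_L2 (cb n).
    under eq_Rintegral do rewrite mulrBl.
    rewrite RintegralB//; [|exact: L2_mul..].
    have := w1 _ (cb n); rewrite (w2 _ (cb n)) => /oppr_inj ->.
    by rewrite subrr.
  move=> lim; rewrite mulr0 (_ : \int[mu]_(x in ball c r) _ = 0) ?normr0//.
  by apply: (cvg_unique _ lim) => //; exact: cvg_cst.
apply: ae_mono => x; rewrite normr_le0 subr_eq0 => /eqP ->//.
Qed.

Lemma wderivP u : W12 u -> L2 (wderiv u) /\ weak_derivative u (wderiv u).
Proof.
move=> [_ [g Lg wg]].
by apply: (@getPex _ [set g | L2 g /\ weak_derivative u g]); exists g.
Qed.

Lemma weak_derivativeD u v gu gv : L2 u -> L2 v -> L2 gu -> L2 gv ->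
  weak_derivative u gu -> weak_derivative v gv ->
  weak_derivative (fun x => u x + v x) (fun x => gu x + gv x).
Proof.
move=> Lu Lv Lgu Lgv wu wv phi cphi; have [L1 L1'] := C1c_L2 cphi.
under eq_Rintegral do rewrite mulrDl.
rewrite RintegralD//; [|exact: L2_mul..].
under [in RHS]eq_Rintegral do rewrite mulrDl.
rewrite [in RHS]RintegralD//; [|exact: L2_mul..].
by rewrite (wu _ cphi) (wv _ cphi) opprD.
Qed.

(** Replaces the weak derivative chosen in [sqnorm] by any explicit one. *)
Lemma sqnormE (l : R) u g : L2 u -> L2 g -> weak_derivative u g ->
  sqnorm l u = \int[mu]_x (g x ^+ 2) + l * \int[mu]_x (u x ^+ 2).
Proof.
move=> Lu Lg wg.
have Wu : W12 u by split => //; exists g.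
have [Lw ww] := wderivP Wu.
have /L2P[mu_ iu] := Lu; have /L2P[mg ig] := Lg; have /L2P[mw iw] := Lw.
rewrite /sqnorm RintegralD//; last exact: (integrable_scale l iu).
  rewrite RintegralZl//; congr (_ + _).
  apply: ae_eq_Rint.
  - by apply: measurable_funX; exact: measurableT_comp.
  - exact: measurable_funX.
  - apply: ae_mono (weak_derivative_unique Lw Lg ww wg) => x ->.
    by rewrite real_normK ?num_real.
by have /L2P[] := L2_norm Lw.
Qed.

(** Test functions may decay instead of having compact support: cut off with eta(x / (n + 1)), whose
    derivative is O(1 / n), and pass to the limit. It will be used with the derivative of a bound
    state as [p]. *)
Lemma weak_derivative_test_decay h g p dp (a M : R) : L2 h -> L2 g ->
  weak_derivative h g -> 0 < a -> has_deriv p dp -> continuous dp ->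
  decay a M p -> decay a M dp ->
  \int[mu]_x (h x * dp x) = - \int[mu]_x (g x * p x).
Proof.
move=> Lh Lg wh a0 hp cdp bp bdp.
have cp := has_deriv_continuous hp.
have Lp := decay_L2 a0 cp bp; have Ldp := decay_L2 a0 cdp bdp.
have [eta [deta [B [heta cdeta eta1 eta0 [beta bdeta]]]]] := @cutoff_exists R.
have B0 : 0 <= B by apply: le_trans (bdeta 0).
pose s (n : nat) : R := n.+1%:R^-1.
have s0 n : 0 < s n by rewrite invr_gt0.
have s1 n : s n <= 1 by rewrite invf_le1// ler1n.
have hs n := has_derivZ (s n) (@has_deriv_id R).
pose phi n x := p x * eta (s n * x).
pose dphi n x := dp x * eta (s n * x) + p x * (s n * deta (s n * x)).
have ceta := has_deriv_continuous heta.
have cs n f : continuous f -> continuous (fun x => f (s n * x)).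
  move=> cf x; apply: continuous_comp; last exact: cf.
  by apply: cvgMr; exact: cvg_id.
have hphi n : has_deriv (phi n) (dphi n).
  have := has_derivM hp (has_deriv_comp heta (hs n)).
  by move=> /has_deriv_eq; apply => x; rewrite /dphi /id; ring.
have cdphi n : continuous (dphi n).
  apply: continuous_add; first by apply: continuous_mul => //; exact: cs.
  by apply: continuous_mul => //; apply: continuous_scale; exact: cs.
have Cphi n : C1c (phi n).
  apply: (C1c_intro (X := 2 * n.+1%:R) (hphi n) (cdphi n)) => x hx.
  rewrite /phi eta0 ?mulr0// normrM (ger0_norm (ltW (s0 n))) /s.
  by rewrite mulrC ler_pdivlMr.
have limeta x : eta (s n * x) @[n --> \oo] --> (1 : R).
  apply: cvg_near_cst; near=> n; apply: eta1.
  rewrite normrM (ger0_norm (ltW (s0 n))) mulrC ler_pdivrMr// mul1r.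
  apply: (le_trans (ltW (truncnS_gt _))); rewrite ler_nat ltnS.
  by near: n; exact: nbhs_infty_ge.
have limdeta x : s n * deta (s n * x) @[n --> \oo] --> (0 : R).
  apply/norm_cvg0P.
  apply: (@squeeze_cvgr _ _ _ _ (cst 0) (fun n => B * harmonic n)).
  - apply: nearW => n; rewrite normr_ge0 /= normrM (ger0_norm (ltW (s0 n))) mulrC.
    by rewrite ler_wpM2r ?(ltW (s0 n)).
  - exact: cvg_cst.
  - rewrite -[X in _ --> X](mulr0 B); apply: cvgMr; exact: cvg_harmonic.
have mh := L2_measurable Lh; have mg := L2_measurable Lg.
have mc f : continuous f -> measurable_fun setT f by exact: continuous_measurable_fun.
have [|||||_ lim1] := @Rdominated_convergence R (fun n x => h x * dphi n x)
  (fun x => h x * dp x) (fun x => `|h x| * `|dp x| + B * (`|h x| * `|p x|)).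
- by move=> n; apply: measurable_funM => //; apply: mc.
- by apply: measurable_funM => //; apply: mc.
- move=> x; apply: cvgMr.
  rewrite -[X in _ --> X]addr0 -[X in _ --> X + _]mulr1 -[X in _ --> _ + X](mulr0 (p x)).
  by apply: cvgD; apply: cvgMr.
- apply: integrable_add; last apply: integrable_scale.
    by apply: L2_mul; exact: L2_norm.
  by apply: L2_mul; exact: L2_norm.
- move=> n x; rewrite normrM.
  have -> : `|h x| * `|dp x| + B * (`|h x| * `|p x|) =
    `|h x| * (`|dp x| * 1 + `|p x| * (1 * B)) by ring.
  rewrite ler_wpM2l//; apply: (le_trans (ler_normD _ _)); rewrite !normrM.
  apply: lerD; rewrite ler_wpM2l// ler_pM//.
  by rewrite (ger0_norm (ltW (s0 n))).
have [|||||_ lim2] := @Rdominated_convergence R (fun n x => g x * phi n x)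
  (fun x => g x * p x) (fun x => `|g x| * `|p x|).
- move=> n; apply: measurable_funM => //; apply: mc.
  exact: has_deriv_continuous (hphi n).
- by apply: measurable_funM => //; apply: mc.
- by move=> x; apply: cvgMr; rewrite -[X in _ --> X]mulr1; apply: cvgMr.
- by apply: L2_mul; exact: L2_norm.
- move=> n x; rewrite !normrM ler_wpM2l// ler_piMr//.
apply: (cvg_unique _ lim1) => //.
have -> : (fun n => \int[mu]_x (h x * dphi n x)) =
    (fun n => - \int[mu]_x (g x * phi n x)).
  apply/funext => n; rewrite -(wh _ (Cphi n)).
  by apply: eq_Rintegral => x _; rewrite (has_deriv_derive1 x (hphi n)).
exact: cvgN.
Unshelve. all: by end_near. Qed.

(* The averages of h over a ball are estimated by testing with the primitive of a
   bump, cut off at distance 2, and Lebesgue differentiation concludes. *)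
Lemma W12_ae_bounded : exists2 C : R, 0 <= C & forall h g N, L2 h -> L2 g ->
  weak_derivative h g -> \int[mu]_x (g x ^+ 2) + \int[mu]_x (h x ^+ 2) <= N ->
  {ae mu, forall x, `|h x| <= N + C}.
Proof.
have [eta [deta [B [heta cdeta eta1 eta0 [beta bdeta]]]]] := @cutoff_exists R.
have B0 : 0 <= B by apply: le_trans (bdeta 0).
(* 4 is the length of [c - 2, c + 2], where the cutoff lives and eta^2 + eta'^2 <= 1 + B^2. The
   inequality 2 x y <= x^2 + y^2 gives an additive bound, not a homogeneous one; uniformity on balls
   of W^{1,2} is all that matters. *)
exists (4 * (1 + B ^+ 2)); first by rewrite mulr_ge0// addr_ge0// sqr_ge0.
move=> h g N Lh Lg wh hN; apply: ae_bound_of_averages => // c r /andP[r0 r1].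
have /L2P[mh ih] := Lh; have /L2P[mg ig] := Lg.
have N0 : 0 <= N.
  by apply: le_trans hN; rewrite addr_ge0//; apply: Rintegral_ge0 => x _; exact: sqr_ge0.
have [b [cb bb lb]] := bump_exists c r0.
pose J : R -> R := \1_(`[c - 2, c + 2]%classic).
have iJ : intg J by exact: integrable_indic_itv.
have intJ : \int[mu]_x J x = 4.
  have m4 : mu (`[c - 2, c + 2]%classic : set R) = 4%:E.
    rewrite lebesgue_measure_itv /= lte_fin.
    have -> : c - 2 < c + 2 by lra.
    by rewrite -EFinB; congr EFin; ring.
  have -> : \int[mu]_x J x = fine (mu (`[c - 2, c + 2]%classic : set R)).
    by rewrite /Rintegral /J integral_indic// setIT.
  by rewrite m4.
have bnd n : `|\int[mu]_x (h x * b n x)| <= 2 * r * (N + 4 * (1 + B ^+ 2)).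
  have [hb cdb _] := C1cE (cb n).
  have cbn := has_deriv_continuous hb.
  have [P [_ hP]] := primitive_exists cbn.
  pose H x := P x - P c.
  have hH : has_deriv H (b n).
    by apply: (has_deriv_eq (has_derivB hP (has_deriv_cst (P c)))) => x; rewrite subr0.
  have bn0 x : r < `|x - c| -> b n x = 0.
    move=> xr; have := bb n x; rewrite indicE memNset /=.
      by move=> bx; apply/eqP; rewrite eq_le andbC.
    by rewrite /ball /= distrC => /ltW; rewrite leNgt xr.
  have bn1 x : `|b n x| <= 1.
    have /andP[h0 h1] := bb n x; rewrite ger0_norm//; apply: (le_trans h1).
    by rewrite indicE; case: (_ \in _).
  have near_c x : `|x - c| <= r -> `|H x| <= r.
    move=> xr; have [cx|/ltW xc] := leP c x.
      have := has_deriv_abs_le hP (@has_deriv_id R) cx (fun z _ => bn1 z).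
      by move=> /le_trans; apply; apply: le_trans xr; exact: ler_norm.
    have := has_deriv_abs_le hP (@has_deriv_id R) xc (fun z _ => bn1 z).
    rewrite /H distrC => /le_trans; apply; apply: le_trans xr.
    by rewrite distrC; exact: ler_norm.
  (* [H] vanishes at the center, has slope at most 1, and is constant outside the ball of radius
     [r]. This factor [r] is what turns the estimate into one on averages. *)
  have Hr x : `|H x| <= r.
    have [/near_c//|xr] := leP `|x - c| r.
    have [cx|/ltW xc] := leP c x.
      have le : c + r <= x by move: xr; rewrite ger0_norm ?subr_ge0//; lra.
      have := has_deriv_abs_le hH (has_deriv_cst 0) le.
      have e0 z : c + r <= z <= x -> `|b n z| <= 0.
        move=> /andP[]; rewrite le_eqVlt => /predU1P[<- _|cz _]; last first.
          by rewrite bn0 ?normr0// ger0_norm; lra.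
        have /andP[h0] := bb n (c + r); rewrite indicE memNset /=; last first.
          by rewrite /ball /= opprD addNKr normrN (ger0_norm (ltW r0)) ltxx.
        by move=> h1; rewrite ger0_norm.
      move=> /(_ e0); rewrite subrr normr_le0 subr_eq0 => /eqP ->.
      by apply: near_c; rewrite addrC addKr (ger0_norm (ltW r0)).
    have le : x <= c - r by move: xr; rewrite ler0_norm ?subr_le0//; lra.
    have := has_deriv_abs_le hH (has_deriv_cst 0) le.
    have e0 z : x <= z <= c - r -> `|b n z| <= 0.
      move=> /andP[_]; rewrite le_eqVlt => /predU1P[->|cz]; last first.
        by rewrite bn0 ?normr0// ler0_norm; lra.
      have /andP[h0] := bb n (c - r); rewrite indicE memNset /=; last first.
        by rewrite /ball /= opprB addrC subrK (ger0_norm (ltW r0)) ltxx.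
      by move=> h1; rewrite ger0_norm.
    move=> /(_ e0); rewrite subrr normr_le0 subr_eq0 => /eqP <-.
    by apply: near_c; rewrite addrC addKr normrN (ger0_norm (ltW r0)).
  have hsh := has_derivB (@has_deriv_id R) (has_deriv_cst c).
  (* As [r <= 1], the shifted cutoff is 1 on the support of [b n], so p' = b n + H eta'(x - c) and
     testing with [p] expresses the integral of [h * b n]. *)
  pose p x := H x * eta (x - c).
  have hp : has_deriv p (fun x => b n x + H x * deta (x - c)).
    apply: (has_deriv_eq (has_derivM hH (has_deriv_comp heta hsh))) => x /=.
    rewrite subr0 mulr1; congr (_ + _).
    have [xc|xc] := leP `|x - c| 1; first by rewrite eta1// mulr1.
    by rewrite bn0 ?mul0r//; exact: le_lt_trans xc.
  have csh : continuous (fun x : R => x - c) := has_deriv_continuous hsh.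
  have cH := has_deriv_continuous hH.
  have cdsh : continuous (fun x => deta (x - c)).
    by move=> x; apply: continuous_comp; [exact: csh|exact: cdeta].
  have vp x : `|c| + 2 <= `|x| -> p x = 0.
    move=> cx; rewrite /p eta0 ?mulr0//.
    have := ler_distD c x 0; rewrite !subr0; lra.
  have cdp : continuous (fun x => b n x + H x * deta (x - c)).
    by apply: continuous_add => //; exact: continuous_mul.
  have Cp := C1c_intro hp cdp vp.
  have [Lbn _] := C1c_L2 (cb n).
  have iHd : intg (fun x => h x * (H x * deta (x - c))).
    apply: L2_mul => //; have [_] := C1c_L2 Cp.
    rewrite (_ : derive1 p = (fun x => b n x + H x * deta (x - c))).
      move=> L; have := L2_sub L Lbn.
      by rewrite (_ : (fun x => _ - _) = (fun x => H x * deta (x - c)))//;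
        apply/funext => x; ring.
    by apply/funext => x; exact: (has_deriv_derive1 x hp).
  have eqn : \int[mu]_x (h x * b n x) =
      - (\int[mu]_x (g x * p x) + \int[mu]_x (h x * (H x * deta (x - c)))).
    have := wh _ Cp; under eq_Rintegral do rewrite (has_deriv_derive1 _ hp) mulrDr.
    rewrite RintegralD//; last exact: L2_mul.
    by move=> e; rewrite opprD -e addrK.
  have [Lp _] := C1c_L2 Cp.
  have etaJ x : eta (x - c) ^+ 2 + (deta (x - c)) ^+ 2 <= (1 + B ^+ 2) * J x.
    rewrite /J indicE; have [xc|xc] := leP `|x - c| 2.
      rewrite mem_set ?mulr1.
        by rewrite -(real_normK (num_real (eta _))) -(real_normK (num_real (deta _)))
          lerD// ?expr_le1// ler_pXn2r ?nnegrE.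
      by move: xc; rewrite /= in_itv /= ler_norml; lra.
    rewrite eta0 ?(ltW xc)// (deriv_vanishes heta eta0 xc) expr0n /= addr0.
    by rewrite mulr_ge0// addr_ge0// sqr_ge0.
  rewrite eqn normrN -RintegralD//; last exact: L2_mul.
  have iG : intg (fun x => r * ((g x ^+ 2 + h x ^+ 2) + (1 + B ^+ 2) * J x)).
    apply: integrable_scale; apply: integrable_add; last exact: integrable_scale.
    exact: integrable_add.
  have := @ae_le_Rint R (fun x => g x * p x + h x * (H x * deta (x - c))) _ _ iG.
  move=> X; apply: (le_trans (X _ _)).
    - exact: (integrable_measurable (integrable_add (L2_mul Lg Lp) iHd)).
    - apply: aeW => x; apply: (le_trans (ler_normD _ _)); rewrite !normrM.
      have e1 := etaJ x; have Hx := Hr x.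
      rewrite -(real_normK (num_real (eta (x - c)))) -(real_normK (num_real (deta (x - c)))) in e1.
      rewrite -(real_normK (num_real (g x))) -(real_normK (num_real (h x))).
      move: e1 Hx (normr_ge0 (g x)) (normr_ge0 (h x)) (normr_ge0 (H x))
        (normr_ge0 (eta (x - c))) (normr_ge0 (deta (x - c))).
      move: (`|g x|) (`|h x|) (`|H x|) (`|eta _|) (`|deta _|) (J x) => G' H' K' E' D' J'.
      move=> e1 Kr G0 H0 K0 E0 D0.
      have q1 : G' * (K' * E') <= r * (G' * E').
        by rewrite mulrCA ler_wpM2r// mulr_ge0.
      have q2 : H' * (K' * D') <= r * (H' * D').
        by rewrite mulrCA ler_wpM2r// mulr_ge0.
      apply: (le_trans (lerD q1 q2)); rewrite -mulrDr ler_wpM2l ?(ltW r0)//.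
      have := sqr_ge0 (G' - E'); have := sqr_ge0 (H' - D').
      have := sqr_ge0 G'; have := sqr_ge0 H'; have := sqr_ge0 E'; have := sqr_ge0 D'.
      nra.
    - rewrite RintegralZl//.
        rewrite RintegralD//; last exact: integrable_scale.
          rewrite RintegralD// RintegralZl// intJ -mulrA mulrCA ler_wpM2l ?(ltW r0)//.
          have := sqr_ge0 B; lra.
        exact: integrable_add.
      by apply: integrable_add; [exact: integrable_add|exact: integrable_scale].
have lim := integral_bump_limit Lh cb bb lb.
apply/ler_addgt0Pr => e e0.
have /cvgrPdist_le /(_ _ e0) near_lim := lim.
near \oo => n.
rewrite -[X in `|X|](subrK (\int[mu]_x (h x * b n x))) addrC.
apply: (le_trans (ler_normD _ _)); apply: lerD; first exact: bnd.
by near: n.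
Unshelve. all: by end_near. Qed.

End Sobolev.

(** * The energy functional *)

Section Energy.
Context {R : realType}.
Local Notation mu := (@lebesgue_measure R).
Local Notation intg f := (mu.-integrable [set: R] (EFin \o f)).
Local Notation L2 f := (f \in Lfun mu 2%:E).
Implicit Types u v du dv f g h : R -> R.

Lemma Rint_axpy (c : R) f g : intg f -> intg g ->
  intg (fun x => c * f x + g x) /\
  \int[mu]_x (c * f x + g x) = c * \int[mu]_x f x + \int[mu]_x g x.
Proof.
move=> hf hg; have hcf := integrable_scale c hf.
by split; [exact: integrable_add|rewrite RintegralD// RintegralZl].
Qed.

(** Boundedness makes [u * u] square integrable, hence the cubic and quartic terms of [Phi]
    integrable. *)
Definition bounded_W12 u g :=
  [/\ L2 u, L2 g, weak_derivative u g & exists C : R, {ae mu, forall x, `|u x| <= C}].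

Lemma bounded_W12D u v gu gv : bounded_W12 u gu -> bounded_W12 v gv ->
  bounded_W12 (fun x => u x + v x) (fun x => gu x + gv x).
Proof.
move=> [Lu Lgu wu [C bu]] [Lv Lgv wv [D bv]]; split.
- exact: L2_add.
- exact: L2_add.
- exact: weak_derivativeD.
- exists (C + D); apply: ae_mono (ae_and bu bv) => x [h1 h2].
  by apply: (le_trans (ler_normD _ _)); exact: lerD.
Qed.

Lemma bounded_W12_mul u g f : bounded_W12 u g -> L2 f -> L2 (fun x => u x * f x).
Proof. by move=> [/L2_measurable mu_ _ _ [C bu]] Lf; exact: ae_bounded_mul_L2 bu Lf. Qed.

Variables (l1 l2 b : R).

(** Nested to the right and ended by 0, so that it is an iterate of [c * f + g] and [Rint_axpy]
    integrates it term by term. *)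
Definition energy_density (u du v dv : R) : R :=
  2^-1 * du ^+ 2 + (2^-1 * l1 * u ^+ 2 + (- 4^-1 * u ^+ 4 +
  (2^-1 * dv ^+ 2 + (2^-1 * l2 * v ^+ 2 + (- 6^-1 * v ^+ 3 +
  (- (2^-1 * b) * (u ^+ 2 * v) + 0)))))).

Lemma PhiE u du v dv : bounded_W12 u du -> bounded_W12 v dv ->
  intg (fun x => energy_density (u x) (du x) (v x) (dv x)) /\
  Phi l1 l2 b (u, v) = \int[mu]_x energy_density (u x) (du x) (v x) (dv x).
Proof.
move=> hu hv; have [Lu Ldu wu _] := hu; have [Lv Ldv wv _] := hv.
have Luu := bounded_W12_mul hu Lu; have Lvv := bounded_W12_mul hv Lv.
have ext f g : f =1 g -> intg f -> intg g by move=> /funext ->.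
have iu2 : intg (fun x => u x ^+ 2) by apply: ext (L2_mul Lu Lu) => x; ring.
have iv2 : intg (fun x => v x ^+ 2) by apply: ext (L2_mul Lv Lv) => x; ring.
have idu2 : intg (fun x => du x ^+ 2) by apply: ext (L2_mul Ldu Ldu) => x; ring.
have idv2 : intg (fun x => dv x ^+ 2) by apply: ext (L2_mul Ldv Ldv) => x; ring.
have iu4 : intg (fun x => u x ^+ 4) by apply: ext (L2_mul Luu Luu) => x; ring.
have iv3 : intg (fun x => v x ^+ 3) by apply: ext (L2_mul Lvv Lv) => x; ring.
have iu2v : intg (fun x => u x ^+ 2 * v x) by apply: ext (L2_mul Luu Lv) => x; ring.
have i0 : intg (fun=> 0 : R) by exact: integrable0.
have [j1 e1] := Rint_axpy (- (2^-1 * b)) iu2v i0.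
have [j2 e2] := Rint_axpy (- 6^-1) iv3 j1.
have [j3 e3] := Rint_axpy (2^-1 * l2) iv2 j2.
have [j4 e4] := Rint_axpy 2^-1 idv2 j3.
have [j5 e5] := Rint_axpy (- 4^-1) iu4 j4.
have [j6 e6] := Rint_axpy (2^-1 * l1) iu2 j5.
have [j7 e7] := Rint_axpy 2^-1 idu2 j6.
split; first exact: j7.
rewrite /energy_density e7 e6 e5 e4 e3 e2 e1 /Phi /=.
rewrite (sqnormE l1 Lu Ldu wu) (sqnormE l2 Lv Ldv wv).
have -> : \int[mu]_x (0 : R) = 0 by rewrite /Rintegral integral0.
ring.
Qed.

Definition energy_remainder (u v g1 h1 g2 h2 : R) : R :=
  2^-1 * g1 ^+ 2 + 2^-1 * g2 ^+ 2
  + (2^-1 * l1 - 3 / 2 * u ^+ 2 - u * h1 - 4^-1 * h1 ^+ 2 - 2^-1 * b * (v + h2)) * h1 ^+ 2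
  + (2^-1 * l2 - 2^-1 * v - 6^-1 * h2) * h2 ^+ 2
  - b * (u * (h1 * h2)).

(** Grouped as h1 u'' + g1 u' and h2 v'' + g2 v', the brackets being u'' and v'' by the system; each
    group then integrates to 0 by parts. *)
Definition energy_differential (u du v dv g1 h1 g2 h2 : R) : R :=
  (h1 * (l1 * u - (u ^+ 3 + b * (u * v))) + g1 * du) +
  (h2 * (l2 * v - (2^-1 * v ^+ 2 + 2^-1 * b * u ^+ 2)) + g2 * dv).

Lemma energy_densityD u du v dv g1 h1 g2 h2 (x : R) :
  energy_density (u x + h1 x) (du x + g1 x) (v x + h2 x) (dv x + g2 x) =
  energy_density (u x) (du x) (v x) (dv x) +
  energy_differential (u x) (du x) (v x) (dv x) (g1 x) (h1 x) (g2 x) (h2 x) +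
  energy_remainder (u x) (v x) (g1 x) (h1 x) (g2 x) (h2 x).
Proof. by rewrite /energy_density /energy_differential /energy_remainder; field. Qed.

(** The bound [K] on the increments absorbs their higher powers into the coefficients, leaving a
    quadratic form in the increments and their derivatives. *)
Lemma energy_remainder_bound (M K u v g1 h1 g2 h2 : R) : 0 < l1 -> 0 < l2 -> 0 <= b ->
  `|u| <= M -> `|v| <= M -> `|h1| <= K -> `|h2| <= K ->
  `|energy_remainder u v g1 h1 g2 h2| <=
  (1 + l1 + l2 + 2 * M ^+ 2 + M * K + K ^+ 2 + M + K + 2 * b * (M + K)) *
    ((g1 ^+ 2 + h1 ^+ 2) + (g2 ^+ 2 + h2 ^+ 2)).
Proof.
move=> l1_gt0 l2_gt0 b0 bu bv bh1 bh2.
have M0 : 0 <= M by apply: le_trans bu.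
have K0 : 0 <= K by apply: le_trans bh1.
pose A := 2^-1 * l1 - 3 / 2 * u ^+ 2 - u * h1 - 4^-1 * h1 ^+ 2 - 2^-1 * b * (v + h2).
pose B := 2^-1 * l2 - 2^-1 * v - 6^-1 * h2.
pose A' := l1 + 2 * M ^+ 2 + M * K + K ^+ 2 + b * (M + K).
pose B' := l2 + M + K.
have u2 : u ^+ 2 <= M ^+ 2 by rewrite -(real_normK (num_real u)) ler_pXn2r ?nnegrE.
have h12 : h1 ^+ 2 <= K ^+ 2 by rewrite -(real_normK (num_real h1)) ler_pXn2r ?nnegrE.
have uh : `|u * h1| <= M * K by rewrite normrM ler_pM.
have bvh : `|b * (v + h2)| <= b * (M + K).
  rewrite normrM (ger0_norm b0) ler_wpM2l//; apply: (le_trans (ler_normD _ _)).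
  exact: lerD.
have hA : `|A| <= A'.
  move: uh bvh; rewrite /A /A' !ler_norml => /andP[? ?] /andP[? ?].
  have := sqr_ge0 u; have := sqr_ge0 h1.
  by move=> *; apply/andP; split; lra.
have hB : `|B| <= B'.
  move: bv bh2; rewrite /B /B' !ler_norml => /andP[? ?] /andP[? ?].
  by apply/andP; split; lra.
have hC : `|b * (u * (h1 * h2))| <= b * M * (h1 ^+ 2 + h2 ^+ 2).
  rewrite !normrM (ger0_norm b0) -mulrA ler_wpM2l// ler_pM// ?mulr_ge0//.
  rewrite -(real_normK (num_real h1)) -(real_normK (num_real h2)).
  have := sqr_ge0 (`|h1| - `|h2|); have := sqr_ge0 `|h1|; have := sqr_ge0 `|h2|; nra.
have -> : energy_remainder u v g1 h1 g2 h2 =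
    (2^-1 * g1 ^+ 2 + 2^-1 * g2 ^+ 2 + A * h1 ^+ 2 + B * h2 ^+ 2) - b * (u * (h1 * h2)).
  by [].
apply: (le_trans (ler_normB _ _)).
have s1 := sqr_ge0 g1; have s2 := sqr_ge0 g2; have s3 := sqr_ge0 h1; have s4 := sqr_ge0 h2.
have q1 : `|2^-1 * g1 ^+ 2 + 2^-1 * g2 ^+ 2 + A * h1 ^+ 2 + B * h2 ^+ 2| <=
    2^-1 * g1 ^+ 2 + 2^-1 * g2 ^+ 2 + A' * h1 ^+ 2 + B' * h2 ^+ 2.
  apply: (le_trans (ler_normD _ _)); apply: lerD; last first.
    by rewrite normrM (ger0_norm s4) ler_wpM2r.
  apply: (le_trans (ler_normD _ _)); apply: lerD; last first.
    by rewrite normrM (ger0_norm s3) ler_wpM2r.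
  by rewrite ger0_norm//; lra.
apply: (le_trans (lerD q1 hC)).
have A'0 : 0 <= A' by apply: le_trans hA.
have B'0 : 0 <= B' by apply: le_trans hB.
have bM0 : 0 <= b * M by rewrite mulr_ge0.
have bK0 : 0 <= b * K by rewrite mulr_ge0.
have -> : 1 + l1 + l2 + 2 * M ^+ 2 + M * K + K ^+ 2 + M + K + 2 * b * (M + K) =
  1 + A' + B' + b * M + b * K by rewrite /A' /B'; ring.
move: A' B' A'0 B'0 {q1 hA hB hC} (b * M) (b * K) bM0 bK0.
move=> A' B' A'0 B'0 m k m0 k0.
move: s1 s2 s3 s4; move: (g1 ^+ 2) (g2 ^+ 2) (h1 ^+ 2) (h2 ^+ 2) => G1 G2 H1 H2.
move=> s1 s2 s3 s4.
have p1 : 0 <= A' * (G1 + G2 + H2) by rewrite mulr_ge0// !addr_ge0.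
have p2 : 0 <= B' * (G1 + G2 + H1) by rewrite mulr_ge0// !addr_ge0.
have p3 : 0 <= m * (G1 + G2) by rewrite mulr_ge0// !addr_ge0.
have p4 : 0 <= k * (G1 + H1 + (G2 + H2)) by rewrite mulr_ge0// !addr_ge0.
lra.
Qed.

Lemma classical_critical_point u du v dv (a M : R) :
  0 < l1 -> 0 < l2 -> 0 <= b -> 0 < a ->
  has_deriv u du -> has_deriv du (fun x => l1 * u x - (u x ^+ 3 + b * (u x * v x))) ->
  has_deriv v dv ->
  has_deriv dv (fun x => l2 * v x - (2^-1 * v x ^+ 2 + 2^-1 * b * u x ^+ 2)) ->
  decay a M u -> decay a M du -> decay a M v -> decay a M dv ->
  critical_point l1 l2 b (u, v).
Proof.
move=> l1_gt0 l2_gt0 b0 a0 hu hdu hv hdv bu bdu bv bdv.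
have cu := has_deriv_continuous hu; have cdu := has_deriv_continuous hdu.
have cv := has_deriv_continuous hv; have cdv := has_deriv_continuous hdv.
have M0 := decay_ge0 bu.
have exp_le1 x : expR (- a * `|x|) <= 1 :> R.
  by rewrite -expR0 ler_expR mulNr oppr_le0 mulr_ge0// ltW.
have bnd f : decay a M f -> forall x, `|f x| <= M.
  by move=> bf x; apply: (le_trans (bf x)); rewrite ler_piMr.
have Wu := decay_W12 a0 hu cdu bu bdu; have Wv := decay_W12 a0 hv cdv bv bdv.
split; first by split.
have Bu : bounded_W12 u du.
  split; [exact: decay_L2 a0 cu bu|exact: decay_L2 a0 cdu bdu| |].
    exact: decay_weak_derivative a0 hu cdu bu bdu.
  by exists M; apply: aeW; exact: bnd.
have Bv : bounded_W12 v dv.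
  split; [exact: decay_L2 a0 cv bv|exact: decay_L2 a0 cdv bdv| |].
    exact: decay_weak_derivative a0 hv cdv bv bdv.
  by exists M; apply: aeW; exact: bnd.
pose ddu x := l1 * u x - (u x ^+ 3 + b * (u x * v x)).
pose ddv x := l2 * v x - (2^-1 * v x ^+ 2 + 2^-1 * b * u x ^+ 2).
have u2 x : u x ^+ 2 <= M ^+ 2.
  by rewrite -(real_normK (num_real (u x))) ler_pXn2r ?nnegrE// bnd.
have cddu : continuous ddu.
  apply: continuous_add; first exact: continuous_scale.
  have h : continuous (fun x => -1 * (u x * (u x * u x) + b * (u x * v x))).
    apply: continuous_scale; apply: continuous_add.
      by do 2 apply: continuous_mul => //.
    by apply: continuous_scale; exact: continuous_mul.
  rewrite (_ : (fun x : R => _) = (fun x => -1 * (u x * (u x * u x) + b * (u x * v x))))//.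
  by apply/funext => x; ring.
have cddv : continuous ddv.
  apply: continuous_add; first exact: continuous_scale.
  have h : continuous (fun x => -1 * (2^-1 * (v x * v x) + 2^-1 * b * (u x * u x))).
    by apply: continuous_scale; apply: continuous_add; apply: continuous_scale;
      exact: continuous_mul.
  rewrite (_ : (fun x : R => _) =
    (fun x => -1 * (2^-1 * (v x * v x) + 2^-1 * b * (u x * u x))))//.
  by apply/funext => x; ring.
pose Mu := (l1 + (M ^+ 2 + b * M)) * M.
have bddu : decay a Mu ddu.
  move=> x; rewrite /ddu /Mu.
  have -> : l1 * u x - (u x ^+ 3 + b * (u x * v x)) =
    (l1 - (u x ^+ 2 + b * v x)) * u x by ring.
  rewrite normrM -mulrA ler_pM//.
  apply: (le_trans (ler_normB _ _)); rewrite (ger0_norm (ltW l1_gt0)) lerD//.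
  apply: (le_trans (ler_normD _ _)); rewrite (ger0_norm (sqr_ge0 _)) lerD//.
  by rewrite normrM (ger0_norm b0) ler_wpM2l// bnd.
pose Mv := (l2 + 2^-1 * M + 2^-1 * b * M) * M.
have bddv : decay a Mv ddv.
  move=> x.
  have -> : ddv x = (l2 - 2^-1 * v x) * v x - 2^-1 * b * u x * u x by rewrite /ddv; ring.
  have -> : Mv * expR (- a * `|x|) = (l2 + 2^-1 * M) * (M * expR (- a * `|x|)) +
    2^-1 * b * M * (M * expR (- a * `|x|)) by rewrite /Mv; ring.
  have hb : 0 <= 2^-1 * b by rewrite mulr_ge0.
  apply: (le_trans (ler_normB _ _)); rewrite !(normrM _ (_ x)).
  apply: lerD; apply: ler_pM => //.
    apply: (le_trans (ler_normB _ _)); rewrite (ger0_norm (ltW l2_gt0)) lerD//.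
    by rewrite normrM ger0_norm// ler_wpM2l// bnd.
  by rewrite -normrM (ger0_norm hb) ler_wpM2l// bnd.
have [C C0 essb] := @W12_ae_bounded R.
(* Equivalence constant: [m] times the standard squared W^{1,2} norm is at most the weighted one,
   for both components. *)
pose m := Num.min 1 (Num.min l1 l2).
have m0 : 0 < m by rewrite !lt_min ltr01 l1_gt0.
have m1 : m <= 1 by rewrite ge_min lexx.
have ml1 : m <= l1 by rewrite !ge_min lexx !orbT.
have ml2 : m <= l2 by rewrite !ge_min lexx !orbT.
pose K := m^-1 + C.
have K0 : 0 <= K by rewrite addr_ge0// invr_ge0 ltW.
pose K' := 1 + l1 + l2 + 2 * M ^+ 2 + M * K + K ^+ 2 + M + K + 2 * b * (M + K).
have K'0 : 0 < K'.
  have h1 : 0 <= M * K by rewrite mulr_ge0.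
  have h2 : 0 <= b * (M + K) by rewrite mulr_ge0// addr_ge0.
  have h3 := sqr_ge0 M; have h4 := sqr_ge0 K.
  by rewrite /K'; lra.
(* Norm at most 1 provides the bound [K] on the increments; the second entry turns K' N^2 / m into
   at most e N. *)
move=> e e0; exists (Num.min 1 (e * m / K')).
  by rewrite lt_min ltr01 divr_gt0// mulr_gt0.
move=> [h1 h2] [/= Wh1 Wh2]; rewrite lt_min => /andP[hlt1 hlt2].
have [Lg1 wg1] := wderivP Wh1; have [Lg2 wg2] := wderivP Wh2.
have [Lh1 _] := Wh1; have [Lh2 _] := Wh2.
set g1 := wderiv h1 in Lg1 wg1; set g2 := wderiv h2 in Lg2 wg2.
have /L2P[_ ih1] := Lh1; have /L2P[_ ih2] := Lh2.
have /L2P[_ ig1] := Lg1; have /L2P[_ ig2] := Lg2.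
pose N := normEE l1 l2 (h1, h2).
pose I1 := \int[mu]_x (g1 x ^+ 2) + \int[mu]_x (h1 x ^+ 2).
pose I2 := \int[mu]_x (g2 x ^+ 2) + \int[mu]_x (h2 x ^+ 2).
have Ige0 f : 0 <= \int[mu]_x (f x ^+ 2) by apply: Rintegral_ge0 => x _; exact: sqr_ge0.
have N0 : 0 <= N by exact: sqrtr_ge0.
have q1 : m * I1 <= sqnorm l1 h1.
  rewrite (sqnormE l1 Lh1 Lg1 wg1) mulrDr lerD//; last exact: ler_wpM2r.
  by rewrite ler_piMl.
have q2 : m * I2 <= sqnorm l2 h2.
  rewrite (sqnormE l2 Lh2 Lg2 wg2) mulrDr lerD//; last exact: ler_wpM2r.
  by rewrite ler_piMl.
have I10 : 0 <= I1 by rewrite addr_ge0.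
have I20 : 0 <= I2 by rewrite addr_ge0.
have mI10 : 0 <= m * I1 by rewrite mulr_ge0// ltW.
have mI20 : 0 <= m * I2 by rewrite mulr_ge0// ltW.
have N2 : N ^+ 2 = sqnorm l1 h1 + sqnorm l2 h2.
  by rewrite sqr_sqrtr// addr_ge0//; [exact: le_trans q1|exact: le_trans q2].
have IN : m * (I1 + I2) <= N ^+ 2 by rewrite N2 mulrDr lerD.
have N1 : N ^+ 2 <= 1 by rewrite expr_le1// ltW.
have I1m : I1 <= m^-1 by rewrite -[m^-1]mul1r ler_pdivlMr//; lra.
have I2m : I2 <= m^-1 by rewrite -[m^-1]mul1r ler_pdivlMr//; lra.
have eb1 := essb _ _ _ Lh1 Lg1 wg1 I1m.
have eb2 := essb _ _ _ Lh2 Lg2 wg2 I2m.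
have Bh1 : bounded_W12 h1 g1 by split => //; exists K.
have Bh2 : bounded_W12 h2 g2 by split => //; exists K.
have [iw Ew] := PhiE Bu Bv.
have [iwh Ewh] := PhiE (bounded_W12D Bu Bh1) (bounded_W12D Bv Bh2).
have Lddu := decay_L2 a0 cddu bddu; have Lddv := decay_L2 a0 cddv bddv.
have [_ Ldu _ _] := Bu; have [_ Ldv _ _] := Bv.
have bdu' : decay a (M + Mu) du by apply: decayW bdu => //; rewrite lerDl (decay_ge0 bddu).
have bddu' : decay a (M + Mu) ddu by apply: decayW bddu => //; rewrite lerDr.
have bdv' : decay a (M + Mv) dv by apply: decayW bdv => //; rewrite lerDl (decay_ge0 bddv).
have bddv' : decay a (M + Mv) ddv by apply: decayW bddv => //; rewrite lerDr.
have z1 := weak_derivative_test_decay Lh1 Lg1 wg1 a0 hdu cddu bdu' bddu'.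
have z2 := weak_derivative_test_decay Lh2 Lg2 wg2 a0 hdv cddv bdv' bddv'.
pose ell x := energy_differential (u x) (du x) (v x) (dv x) (g1 x) (h1 x) (g2 x) (h2 x).
pose rem x := energy_remainder (u x) (v x) (g1 x) (h1 x) (g2 x) (h2 x).
have a1 := L2_mul Lh1 Lddu; have a2 := L2_mul Lg1 Ldu.
have a3 := L2_mul Lh2 Lddv; have a4 := L2_mul Lg2 Ldv.
have iell : intg ell by exact: integrable_add (integrable_add a1 a2) (integrable_add a3 a4).
(* [du] and [dv] serve as decaying test functions: this is the weak form of the system. *)
have ell0 : \int[mu]_x ell x = 0.
  rewrite RintegralD//; [|exact: integrable_add|exact: integrable_add].
  by rewrite !RintegralD// z1 z2; ring.
have irem : intg rem.
  have := integrable_sub (integrable_sub iwh iw) iell.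
  congr (integrable _ _ _); apply/funext => x /=; congr EFin.
  by rewrite (energy_densityD u du v dv g1 h1 g2 h2 x) /ell /rem; ring.
have diff : Phi l1 l2 b ((u, v) + (h1, h2)) - Phi l1 l2 b (u, v) = \int[mu]_x rem x.
  have -> : (u, v) + (h1, h2) = (fun x => u x + h1 x, fun x => v x + h2 x) by [].
  rewrite Ew Ewh.
  have -> : \int[mu]_x energy_density (u x + h1 x) (du x + g1 x) (v x + h2 x) (dv x + g2 x) =
    \int[mu]_x ((energy_density (u x) (du x) (v x) (dv x) + ell x) + rem x).
    by apply: eq_Rintegral => x _; exact: energy_densityD.
  rewrite RintegralD//; last exact: integrable_add.
  by rewrite RintegralD// ell0; ring.
rewrite subr0 diff -/N.
have iS : intg (fun x => (g1 x ^+ 2 + h1 x ^+ 2) + (g2 x ^+ 2 + h2 x ^+ 2)).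
  by apply: integrable_add; exact: integrable_add.
apply: (@le_trans _ _ (K' * (I1 + I2))).
  have -> : K' * (I1 + I2) =
    \int[mu]_x (K' * ((g1 x ^+ 2 + h1 x ^+ 2) + (g2 x ^+ 2 + h2 x ^+ 2))).
    rewrite RintegralZl// RintegralD//; [|exact: integrable_add..].
    by rewrite !RintegralD.
  apply: ae_le_Rint; [exact: integrable_measurable|exact: integrable_scale|].
  apply: ae_mono (ae_and eb1 eb2) => x [e1 e2].
  by apply: energy_remainder_bound => //; exact: bnd.
have : K' * (I1 + I2) <= K' * (N ^+ 2 / m).
  by rewrite ler_wpM2l ?(ltW K'0)// ler_pdivlMr// mulrC.
move=> /le_trans; apply.
have -> : K' * (N ^+ 2 / m) = N * K' / m * N by ring.
by rewrite ler_wpM2r// ler_pdivrMr// -ler_pdivlMr// ltW.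
Qed.

End Energy.

(** * The bound states *)

Section BoundState.
Context {R : realType}.
Local Notation mu := (@lebesgue_measure R).

Lemma not_ae_False : ~ {ae mu, forall x : R, False}.
Proof.
move=> h.
have m01 : @measurable _ (measurableTypeR R) `[0, 1]%classic by exact: measurable_itv.
have : \int[mu]_x (\1_(`[0, 1]%classic) x : R) = \int[mu]_x (0 : R).
  by apply: ae_eq_Rint => //; apply: ae_mono h.
have m1 : mu (`[0, 1]%classic : set R) = 1%:E.
  by rewrite lebesgue_measure_itv /= lte_fin ltr01 -EFinB subr0.
rewrite {1}/Rintegral integral_indic// setIT => e.
have : fine (mu (`[0, 1]%classic : set R)) = 0 by rewrite [LHS]e /Rintegral integral0.
by rewrite m1 /= => /eqP; rewrite oner_eq0.
Qed.

(** Each squared norm is at most (1 + l) M^2 times the integral of e^{- 2 a |x|}, so the norm is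
    linear in [M], which will be the radius. *)
Lemma normEE_decay_le (l1 l2 a M : R) (phi dphi chi dchi : R -> R) :
  0 <= l1 -> 0 <= l2 -> 0 < a ->
  has_deriv phi dphi -> continuous dphi -> has_deriv chi dchi -> continuous dchi ->
  decay a M phi -> decay a M dphi -> decay a M chi -> decay a M dchi ->
  normEE l1 l2 (phi, chi) <=
  Num.sqrt ((2 + l1 + l2) * \int[mu]_x expR (- (a + a) * `|x|)) * M.
Proof.
move=> l1_ge0 l2_ge0 a0 hp cdp hc cdc bp bdp bc bdc.
have cp := has_deriv_continuous hp; have cc := has_deriv_continuous hc.
set I := \int[mu]_x _.
have I0 : 0 <= I by apply: Rintegral_ge0 => x _; exact: expR_ge0.
have M0 := decay_ge0 bp.
have sq (l : R) p dp : 0 <= l -> has_deriv p dp -> continuous dp -> decay a M p ->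
    decay a M dp -> sqnorm l p <= (1 + l) * (M ^+ 2 * I).
  move=> l0 h c b1 b2; have ch := has_deriv_continuous h.
  rewrite (sqnormE l (decay_L2 a0 ch b1) (decay_L2 a0 c b2) (decay_weak_derivative a0 h c b1 b2)).
  rewrite mulrDl mul1r lerD//; first exact: decay_sqr_integral_le.
  by rewrite ler_wpM2l//; exact: decay_sqr_integral_le.
have Q0 : 0 <= (2 + l1 + l2) * I by rewrite mulr_ge0//; lra.
rewrite -[M in leRHS](ger0_norm M0) -sqrtr_sqr -sqrtrM//.
apply: ler_wsqrtr => /=.
apply: (le_trans (lerD (sq l1 _ _ l1_ge0 hp cdp bp bdp) (sq l2 _ _ l2_ge0 hc cdc bc bdc))).
by rewrite le_eqVlt; apply/orP; left; apply/eqP; ring.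
Qed.

Lemma perturbation_bound_state (l1 l2 a b r : R) (phi dphi chi dchi : R -> R) :
  0 < l1 -> 0 < l2 -> 0 < b -> 0 < a <= Num.sqrt l1 -> a <= Num.sqrt l2 ->
  r < Num.sqrt (2 * l1) ->
  perturbation l1 l2 a b r phi dphi chi dchi ->
  let w := ((fun x => U1 l1 x + phi x), (fun x => V2 l2 x + chi x)) in
  [/\ bound_state l1 l2 b w, in_HH w & positive_rep w].
Proof.
move=> l1_gt0 l2_gt0 b0 /andP[a0 ak1] ak2 rU.
move=> [[hphi hdphi hchi hdchi] [ephi echi [bphi bdphi bchi bdchi]]].
have [dU [C1 [hU hdU eU bU bdU]]] := U1_profile l1_gt0.
have [dV [C2 [hV hdV eV bV bdV]]] := V2_profile l2_gt0.
set u := fun x => U1 l1 x + phi x; set v := fun x => V2 l2 x + chi x => w.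
pose du x := dU x + dphi x; pose dv x := dV x + dchi x.
have hu : has_deriv u du by exact: has_derivD.
have hv : has_deriv v dv by exact: has_derivD.
have hdu : has_deriv du (fun x => l1 * u x - (u x ^+ 3 + b * (u x * v x))).
  apply: (has_deriv_eq (has_derivD hdU hdphi)) => x.
  by rewrite /nonlin1 /u /v; ring.
have hdv : has_deriv dv (fun x => l2 * v x - (2^-1 * v x ^+ 2 + 2^-1 * b * u x ^+ 2)).
  apply: (has_deriv_eq (has_derivD hdV hdchi)) => x.
  by rewrite /nonlin2 /u /v; field.
have C1_0 := decay_ge0 bU; have C2_0 := decay_ge0 bV; have r0 := decay_ge0 bphi.
pose M := C1 + C2 + r.
have bu : decay a M u.
  by apply: decayW (decayD bU bphi) => //; rewrite /M; lra.
have bdu : decay a M du.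
  by apply: decayW (decayD bdU bdphi) => //; rewrite /M; lra.
have bv : decay a M v.
  have bV' : decay a C2 (V2 l2) by apply: decayW bV.
  by apply: decayW (decayD bV' bchi) => //; rewrite /M; lra.
have bdv : decay a M dv.
  have bV' : decay a C2 dV by apply: decayW bdV.
  by apply: decayW (decayD bV' bdchi) => //; rewrite /M; lra.
have cu := has_deriv_continuous hu; have cv := has_deriv_continuous hv.
(* [U1] and [phi] share the rate sqrt l1, so comparing the constants sqrt (2 l1) and [r] decides. *)
have u_gt0 x : 0 < u x.
  have h1 := U1_ge l1_gt0 x; have := bphi x; rewrite ler_norml => /andP[h2 _].
  have e0 : 0 < expR (- Num.sqrt l1 * `|x|) by exact: expR_gt0.
  have : 0 < (Num.sqrt (2 * l1) - r) * expR (- Num.sqrt l1 * `|x|).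
    by rewrite mulr_gt0// subr_gt0.
  rewrite /u; lra.
(* The source v^2 / 2 + b u^2 / 2 is strictly positive because [b] and [u] are. *)
have v_gt0 x : 0 < v x.
  apply: (minimum_principle l2_gt0 a0 hv hdv _ _ bv).
    rewrite (_ : (fun x => _) = (fun x => 2^-1 * (v x * v x) + 2^-1 * b * (u x * u x))).
      by apply: continuous_add; apply: continuous_scale; exact: continuous_mul.
    by apply/funext => y; ring.
  move=> y; have := sqr_ge0 (v y) => h.
  have : 0 < b * u y ^+ 2 by rewrite mulr_gt0// exprn_gt0.
  lra.
have crit := classical_critical_point l1_gt0 l2_gt0 (ltW b0) a0 hu hdu hv hdv bu bdu bv bdv.
split.
- split => // h; apply: not_ae_False; apply: ae_mono h => x [e _].
  by have := u_gt0 x; rewrite -[u x]/(w.1 x) e ltxx.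
- split; first by case: crit.
  by split => x /=; [rewrite /u eU ephi|rewrite /v eV echi].
- by split.
Qed.

End BoundState.

Theorem theorem6 (R : realType) (lambda1 lambda2 beta' : R)
    (hlambda1 : 0 < lambda1) (hlambda2 : 0 < lambda2) (hbeta' : 0 < beta') :
  exists eps0 : R, 0 < eps0 /\
  exists w : R -> (R -> R) * (R -> R),
    (forall eps, 0 < eps < eps0 ->
       [/\ bound_state lambda1 lambda2 (eps * beta') (w eps),
           in_HH (w eps) &
           positive_rep (w eps)]) /\
    in_HH (U1 lambda1, V2 lambda2) /\
    normEE lambda1 lambda2 (w eps - (U1 lambda1, V2 lambda2))
      @[eps --> 0^'+] --> (0 : R).
Proof.
have m0 : 0 < Num.sqrt (2 * lambda1) by rewrite sqrtr_gt0 mulr_gt0.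
(* Capping the radius at half of sqrt (2 lambda1) gives the strict inequality required for
   positivity. *)
have [a [L [b0 [[aa ak2] L0 b0_gt0 Lb0 ex]]]] :=
  perturbation_exists hlambda1 hlambda2 (divr_gt0 m0 (ltr0Sn R 1)).
have /andP[a0 ak1] := aa.
have [dU [C1 [hU hdU eU bU bdU]]] := U1_profile hlambda1.
have [dV [C2 [hV hdV eV bV bdV]]] := V2_profile hlambda2.
(* The family must be defined for every real [eps]; outside the admissible range its value is
   arbitrary. *)
have /choice [z hz] : forall eps : R, exists z : ((R -> R) * (R -> R)) * ((R -> R) * (R -> R)),
    0 < eps * beta' < b0 ->
    perturbation lambda1 lambda2 a (eps * beta') (L * (eps * beta')) z.1.1 z.1.2 z.2.1 z.2.2.
  move=> eps; have [/ex [p [dp [c [dc h]]]]|_] := boolP (0 < eps * beta' < b0).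
    by exists ((p, dp), (c, dc)).
  by exists ((id, id), (id, id)).
have in_range eps : 0 < eps < b0 / beta' -> 0 < eps * beta' < b0.
  by move=> /andP[e0 e1]; rewrite mulr_gt0//= -ltr_pdivlMr.
exists (b0 / beta'); split; first by rewrite divr_gt0.
exists (fun eps => ((fun x => U1 lambda1 x + (z eps).1.1 x),
                    (fun x => V2 lambda2 x + (z eps).2.1 x))).
split; [|split].
- move=> eps heps; have /andP[be0 be1] := in_range _ heps.
  apply: (perturbation_bound_state hlambda1 hlambda2 be0 aa ak2 _ (hz _ (in_range _ heps))).
  have : L * (eps * beta') <= L * b0 by apply: ler_wpM2l; exact: ltW.
  lra.
- split; last by split.
  have cddU : continuous dU := has_deriv_continuous hdU.
  have cddV : continuous dV := has_deriv_continuous hdV.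
  split => /=.
    by apply: (decay_W12 _ hU cddU bU bdU); rewrite sqrtr_gt0.
  by apply: (decay_W12 _ hV cddV bV bdV); rewrite sqrtr_gt0.
- set Q := Num.sqrt ((2 + lambda1 + lambda2) *
    \int[@lebesgue_measure R]_x expR (- (a + a) * `|x|)).
  (* The radius is [L * (eps * beta')], so the distance to the ground states is linear in [eps]. *)
  apply: (@squeeze_cvgr _ _ _ _ (cst 0) (fun eps => Q * L * beta' * eps)).
  + near=> eps.
    have heps : 0 < eps < b0 / beta'.
      by apply/andP; split; near: eps;
        [exact: nbhs_right_gt|apply: nbhs_right_lt; rewrite divr_gt0].
    have [[hphi hdphi hchi hdchi] [_ _ [bphi bdphi bchi bdchi]]] := hz _ (in_range _ heps).
    rewrite sqrtr_ge0 /=.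
    have -> : ((fun x => U1 lambda1 x + (z eps).1.1 x), (fun x => V2 lambda2 x + (z eps).2.1 x)) -
        (U1 lambda1, V2 lambda2) = ((z eps).1.1, (z eps).2.1).
      by congr pair; apply/funext => x /=; rewrite addrC addKr.
    have -> : Q * L * beta' * eps = Q * (L * (eps * beta')) by ring.
    apply: (normEE_decay_le (ltW hlambda1) (ltW hlambda2) a0 hphi _ hchi _ _ _ bchi bdchi).
    * exact: has_deriv_continuous hdphi.
    * exact: has_deriv_continuous hdchi.
    * by apply: decayW bphi.
    * by apply: decayW bdphi.
  + exact: cvg_cst.
  + rewrite -[X in _ --> X](mulr0 (Q * L * beta')).
    by apply: cvgMr; apply: cvg_at_right_filter; exact: cvg_id.
Unshelve. all: by end_near. Qed.
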